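(* Assume that $\omega$ satisfies the Diophantine condition and that $a\in\mathcal E_\mu$ for some $\mu>0$ with $\mathcal N_\mu(a)\le M$ (precise formulations in the context). Let $c\in(0,1)$. For all $n\in\mathbb N$ there exists $\varepsilon_n>0$ (depending on $n$ and $c$) such that the decomposition of order $n$ exists, meaning that for all $0<\varepsilon\le\varepsilon_n$, $$\|\Phi^{[n]}-\mathrm{id}\|\le \frac{c\,\varepsilon}{\varepsilon_n}\le c,\qquad |A^{[n]}|\le (1+c)M.$$ Furthermore, for all $0<\varepsilon\le\varepsilon_n$, the defect satisfies $$\forall \tau\ge 0,\qquad \left|\varepsilon\int_0^\tau \delta^{[n]}_\sigma\,d\sigma\right|\le\left(\frac{\varepsilon}{\varepsilon_n}\right)^{n+1}.$$
   Context: $(X,|\cdot|)$ is a Banach space and $\mathrm{End}(X)$ is the space of (bounded) linear maps $X\to X$ with the induced norm, also denoted $|\cdot|$ (Fourier coefficients are taken in the complexification if $X$ is real). For $\varphi:\mathbb R_+\to\mathrm{End}(X)$, the time average is $\langle\varphi\rangle=\lim_{\tau\to\infty}\frac1\tau\int_0^\tau\varphi_\sigma\,d\sigma$, and $\|\varphi\|=\sup_{\tau\ge0}|\varphi_\tau|$. A time average of a constant map is itself; constants are identified with constant maps. Fix $r\ge1$ and $\omega\in\mathbb R^r$; $\mathbb T=\mathbb R/(2\pi\mathbb Z)$; for $\alpha\in\mathbb Z^r$, $|\alpha|=|\alpha_1|+\dots+|\alpha_r|$. Diophantine condition: there exist $c_D>0$ and $\nu\ge r-1$ such that $|\alpha\cdot\omega|\ge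 c_D/|\alpha|^\nu$ for all $\alpha\in\mathbb Z^r\setminus\{0\}$ (if $r=1$, one takes $\nu=0$, $c_D=|\omega|$). For $\kappa\ge0$, $\mathcal T_\kappa$ is the set of $\varphi^\sharp\in C^0(\mathbb T^r,\mathrm{End}(X))$, with Fourier coefficients $\widehat\varphi^\sharp_\alpha$, such that $\|\varphi^\sharp\|_\kappa:=\sum_{\alpha\in\mathbb Z^r}e^{\kappa|\alpha|}|\widehat\varphi^\sharp_\alpha|<\infty$; $\mathcal E^\sharp_\kappa$ is the set of maps $\tau\mapsto\varphi^\sharp_{\omega\tau}$ with $\varphi^\sharp\in\mathcal T_\kappa$. $\mathcal E^\flat$ is the set of $\varphi^\flat\in C^0(\mathbb R_+,\mathrm{End}(X))$ with $\|\varphi^\flat\|_{L^\infty_{\exp}}:=\sup_{\tau\ge0}e^\tau|\varphi^\flat_\tau|<\infty$. Under the Diophantine condition, the sum $\mathcal E_\kappa=\mathcal E^\sharp_\kappa\oplus\mathcal E^\flat$ is direct and each $\varphi\in\mathcal E_\kappa$ splits uniquely as $\varphi_\tau=\varphi^\sharp_{\omega\tau}+\varphi^\flat_\tau$; set $\mathcal N_\kappa(\varphi)=\|\varphi^\sharp\|_\kappa+\|\varphi^\flat\|_{L^\infty_{\exp}}$. Assumption on $a$: $\tau\mapsto a_\tau\in\mathrm{End}(X)$ belongs to $\mathcal E_\mu$ for some $\mu>0$, and $M>0$ is a constant with $\|a\|\le\mathcal N_\mu(a)\le M$. For $\varphi$ with $\langle\varphi\rangle=\mathrm{id}$ set $\Lambda\{\varphi\}_\tau=a_\tau\varphi_\tau-\varphi_\tau\langle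 a\varphi\rangle$. For $\varepsilon>0$ define inductively $\Phi^{[0]}=\mathrm{id}$ and $$A^{[n]}=\langle a\Phi^{[n]}\rangle,\qquad \Phi^{[n+1]}_\tau=\mathrm{id}+\varepsilon\int_0^\tau\Lambda\{\Phi^{[n]}\}_\sigma d\sigma-\varepsilon\Big\langle\int_0^{\bullet}\Lambda\{\Phi^{[n]}\}_\sigma d\sigma\Big\rangle,$$ so that $\langle\Phi^{[n]}\rangle=\mathrm{id}$ and $\partial_\tau\Phi^{[n+1]}=\varepsilon\Lambda\{\Phi^{[n]}\}$. The defect is $$\delta^{[n]}_\tau=\frac1\varepsilon\partial_\tau\Phi^{[n]}_\tau-\big(a_\tau\Phi^{[n]}_\tau-\Phi^{[n]}_\tau A^{[n]}\big)=\Lambda\{\Phi^{[n-1]}\}_\tau-\Lambda\{\Phi^{[n]}\}_\tau,$$ with the convention $\Lambda\{\Phi^{[-1]}\}=0$. *)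

(* Defs.v *)
From Stdlib Require Import Reals Lra List ZArith.
From Stdlib Require Import ProofIrrelevance FunctionalExtensionality.
From Stdlib Require Import PropExtensionality ClassicalEpsilon.
From mathcomp Require Import all_boot.
From Coquelicot Require Import Coquelicot.

Set Implicit Arguments.
Unset Strict Implicit.
Unset Printing Implicit Defensive.

Local Open Scope R_scope.

Definition sup (P : R -> Prop) : R := real (Lub_Rbar P).

Lemma sup_ub (P : R -> Prop) (b x : R) :
  (forall y, P y -> y <= b) -> P x -> x <= sup P.
Proof.
intros Hb Hx; unfold sup.
destruct (Lub_Rbar_correct P) as [H1 H2].
assert (Hb' : is_ub_Rbar P (Finite b)) by (intros y Hy; apply Hb; exact Hy).
specialize (H2 _ Hb'); specialize (H1 _ Hx).
destruct (Lub_Rbar P); simpl in *; tauto.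
Qed.

Lemma sup_le (P : R -> Prop) (b x0 : R) :
  P x0 -> (forall y, P y -> y <= b) -> sup P <= b.
Proof.
intros Hx Hb; unfold sup.
destruct (Lub_Rbar_correct P) as [H1 H2].
assert (Hb' : is_ub_Rbar P (Finite b)) by (intros y Hy; apply Hb; exact Hy).
specialize (H2 _ Hb'); specialize (H1 _ Hx).
destruct (Lub_Rbar P); simpl in *; tauto.
Qed.

Section FromNorm.

Variables (K : AbsRing) (V : ModuleSpace K) (N : V -> R).
Hypothesis N_triangle : forall x y, N (plus x y) <= N x + N y.
Hypothesis N_scal : forall (k : K) x, N (scal k x) <= abs k * N x.
Hypothesis N_eq0 : forall x, N x = 0 -> x = zero.

Lemma fromnorm_zero : N zero = 0.
Proof.
assert (Hopp : forall x, N (opp x) <= N x).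
{ intros x; rewrite -scal_opp_one.
  eapply Rle_trans; [apply N_scal|]; rewrite abs_opp_one; lra. }
assert (H0 : N zero <= 0).
{ assert (H := N_scal (zero : K) (zero : V)).
  rewrite (scal_zero_l (K := K) (V := V)) (abs_zero (K := K)) Rmult_0_l in H.
  exact H. }
assert (H1 := N_triangle zero zero); rewrite plus_zero_l in H1; lra.
Qed.

Lemma fromnorm_opp x : N (opp x) = N x.
Proof.
assert (Hopp : forall x, N (opp x) <= N x).
{ intros y; rewrite -scal_opp_one.
  eapply Rle_trans; [apply N_scal|]; rewrite abs_opp_one; lra. }
apply Rle_antisym; [apply Hopp|].
generalize (Hopp (opp x)); rewrite opp_opp; auto.
Qed.

Let nball (x : V) (e : R) (y : V) := N (minus y x) < e.

Lemma nball_center (x : V) (e : posreal) : nball x e x.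
Proof. unfold nball; rewrite minus_eq_zero fromnorm_zero; apply cond_pos. Qed.

Lemma nball_sym (x y : V) (e : R) : nball x e y -> nball y e x.
Proof.
unfold nball; rewrite -(fromnorm_opp (minus y x)) opp_minus; auto.
Qed.

Lemma nball_triangle (x y z : V) (e1 e2 : R) :
  nball x e1 y -> nball y e2 z -> nball x (e1 + e2) z.
Proof.
unfold nball; intros H1 H2; rewrite (minus_trans y z x).
eapply Rle_lt_trans; [apply N_triangle|]; lra.
Qed.

Definition fromnorm_uniform : UniformSpace.mixin_of V :=
  UniformSpace.Mixin V zero nball nball_center nball_sym nball_triangle.

Definition fromnorm_aux : NormedModuleAux K :=
  NormedModuleAux.Pack K V
    (NormedModuleAux.Class K V (ModuleSpace.class K V) fromnorm_uniform) V.

Lemma fromnorm_ball_norm (x y : fromnorm_aux) (e : R) :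
  N (minus y x) < e -> ball x e y.
Proof. exact (fun h => h). Qed.

Lemma fromnorm_norm_ball (x y : fromnorm_aux) (e : posreal) :
  ball x e y -> N (minus y x) < 1 * e.
Proof. rewrite Rmult_1_l; exact (fun h => h). Qed.

Definition fromnorm_normed : NormedModule K :=
  NormedModule.Pack K V
    (NormedModule.Class K V (NormedModuleAux.class K fromnorm_aux)
       (@NormedModule.Mixin K fromnorm_aux N 1 N_triangle N_scal
          fromnorm_ball_norm fromnorm_norm_ball N_eq0)) V.

Hypothesis N_complete :
  forall F : (V -> Prop) -> Prop, ProperFilter F ->
  (forall eps : posreal, exists x, F (fun y => N (minus y x) < eps)) ->
  exists x, forall eps : posreal, F (fun y => N (minus y x) < eps).

Let nlim (F : (fromnorm_normed -> Prop) -> Prop) : fromnorm_normed :=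
  epsilon (inhabits (zero : fromnorm_normed))
    (fun x => forall eps : posreal, F (ball x eps)).

Lemma nlim_correct (F : (fromnorm_normed -> Prop) -> Prop) :
  ProperFilter F -> cauchy F -> forall eps : posreal, F (ball (nlim F) eps).
Proof.
intros PF CF; unfold nlim; apply epsilon_spec.
exact (N_complete PF CF).
Qed.

Lemma nlim_close (F1 F2 : (fromnorm_normed -> Prop) -> Prop) :
  filter_le F1 F2 -> filter_le F2 F1 -> close (nlim F1) (nlim F2).
Proof.
intros H12 H21.
replace F2 with F1; [intros eps; apply ball_center|].
apply functional_extensionality; intros P.
apply propositional_extensionality; split; [apply H21|apply H12].
Qed.

Definition fromnorm : CompleteNormedModule K :=
  CompleteNormedModule.Pack K V
    (CompleteNormedModule.Class K V (NormedModule.class K fromnorm_normed)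
       (@CompleteSpace.Mixin fromnorm_normed nlim nlim_correct nlim_close)) V.

End FromNorm.

Section BoundedOperators.

Variables (K : AbsRing) (X : NormedModule K).
Hypothesis K_comm : forall x y : K, mult x y = mult y x.

Definition bop := {f : X -> X | is_linear f}.

Lemma bop_eq (f g : bop) : (forall x, sval f x = sval g x) -> f = g.
Proof.
destruct f as [f Hf], g as [g Hg]; simpl; intros H.
assert (E : f = g) by (apply functional_extensionality; exact H).
subst g; f_equal; apply proof_irrelevance.
Qed.

Definition bop_id : bop := exist _ (fun x => x) (is_linear_id).

Definition bop_comp (f g : bop) : bop :=
  exist _ (fun x => sval f (sval g x)) (is_linear_comp _ _ (proj2_sig g) (proj2_sig f)).

Lemma is_linear_plus_fun (f g : bop) :
  is_linear (fun x => plus (sval f x) (sval g x)).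
Proof.
exact (is_linear_comp _ _ (is_linear_prod _ _ (proj2_sig f) (proj2_sig g)) is_linear_plus).
Qed.

Lemma is_linear_scal_fun (k : K) (f : bop) :
  is_linear (fun x => scal k (sval f x)).
Proof.
exact (is_linear_comp _ _ (proj2_sig f) (is_linear_scal_r k K_comm)).
Qed.

Definition bop_zero : bop := exist _ (fun _ => zero) is_linear_zero.
Definition bop_plus (f g : bop) : bop := exist _ _ (is_linear_plus_fun f g).
Definition bop_scal (k : K) (f : bop) : bop := exist _ _ (is_linear_scal_fun k f).
Definition bop_opp (f : bop) : bop :=
  exist _ (fun x => opp (sval f x)) (is_linear_comp _ _ (proj2_sig f) is_linear_opp).

Definition bop_AbelianMonoid_mixin : AbelianMonoid.mixin_of bop.
Proof.
apply (AbelianMonoid.Mixin bop bop_plus bop_zero);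
  intros; apply bop_eq; intros t; simpl.
- apply plus_comm.
- apply plus_assoc.
- apply plus_zero_r.
Defined.

Definition bop_AbelianGroup_mixin :
  AbelianGroup.mixin_of (AbelianMonoid.Pack bop bop_AbelianMonoid_mixin bop).
Proof.
apply (AbelianGroup.Mixin (AbelianMonoid.Pack bop bop_AbelianMonoid_mixin bop) bop_opp).
intros f; apply bop_eq; intros t; simpl.
exact (plus_opp_r (sval f t)).
Defined.

Definition bop_AbelianGroup : AbelianGroup :=
  AbelianGroup.Pack bop (AbelianGroup.Class bop _ bop_AbelianGroup_mixin) bop.

Definition bop_ModuleSpace_mixin : ModuleSpace.mixin_of K bop_AbelianGroup.
Proof.
apply (ModuleSpace.Mixin K bop_AbelianGroup bop_scal).
- intros x y u; apply bop_eq; intros t; exact (scal_assoc x y (sval u t)).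
- intros u; apply bop_eq; intros t; exact (scal_one (sval u t)).
- intros x u v; apply bop_eq; intros t; exact (scal_distr_l x (sval u t) (sval v t)).
- intros x y u; apply bop_eq; intros t; exact (scal_distr_r x y (sval u t)).
Defined.

Definition bop_ModuleSpace : ModuleSpace K :=
  ModuleSpace.Pack K bop
    (ModuleSpace.Class K bop (AbelianGroup.class bop_AbelianGroup)
       bop_ModuleSpace_mixin) bop.

(* The point [x = 0] contributes the value [0 / 0 = 0], so that the supremum is
   [0], as it should be, also when [X] is the null space. *)
Definition opnorm (f : bop) : R :=
  sup (fun v => exists x : X, v = norm (sval f x) / norm x).

Lemma bop_bounded (f : bop) :
  exists M, 0 < M /\ forall x, norm (sval f x) / norm x <= M.
Proof.
destruct (linear_norm _ (proj2_sig f)) as [M [HM H]].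
exists M; split; [exact HM|]; intros x.
destruct (Req_dec (norm x) 0) as [E|E].
- rewrite E; unfold Rdiv; rewrite Rinv_0 Rmult_0_r; lra.
- assert (Hp : 0 < norm x) by (assert (h := norm_ge_0 x); lra).
  apply Rmult_le_reg_r with (norm x); [exact Hp|].
  replace (norm (sval f x) / norm x * norm x) with (norm (sval f x))
    by (field; exact E).
  apply H.
Qed.

Lemma opnorm_ge0 (f : bop) : 0 <= opnorm f.
Proof.
destruct (bop_bounded f) as [M [_ H]].
apply sup_ub with M.
- intros y [x ->]; apply H.
- exists zero; rewrite norm_zero; unfold Rdiv; rewrite Rinv_0; ring.
Qed.

Lemma opnorm_le_apply (f : bop) (x : X) : norm (sval f x) <= opnorm f * norm x.
Proof.
destruct (bop_bounded f) as [M [_ H]].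
destruct (Req_dec (norm x) 0) as [E|E].
- apply norm_eq_zero in E.
  rewrite E (linear_zero _ (proj2_sig f)) !norm_zero; lra.
- assert (Hp : 0 < norm x) by (assert (h := norm_ge_0 x); lra).
  replace (norm (sval f x)) with (norm (sval f x) / norm x * norm x)
    by (field; exact E).
  apply Rmult_le_compat_r; [lra|].
  apply sup_ub with M; [intros y [z ->]; apply H|exists x; reflexivity].
Qed.

Lemma opnorm_le (f : bop) (M : R) :
  0 <= M -> (forall x, norm (sval f x) <= M * norm x) -> opnorm f <= M.
Proof.
intros HM H; apply sup_le with (x0 := norm (sval f zero) / norm (@zero X)).
- exists zero; reflexivity.
- intros y [x ->].
  destruct (Req_dec (norm x) 0) as [E|E].
  + rewrite E; unfold Rdiv; rewrite Rinv_0 Rmult_0_r; lra.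
  + assert (Hp : 0 < norm x) by (assert (h := norm_ge_0 x); lra).
    apply Rmult_le_reg_r with (norm x); [exact Hp|].
    replace (norm (sval f x) / norm x * norm x) with (norm (sval f x))
      by (field; exact E).
    apply H.
Qed.

Lemma opnorm_triangle (f g : bop_ModuleSpace) :
  opnorm (plus f g) <= opnorm f + opnorm g.
Proof.
assert (hf := opnorm_ge0 f); assert (hg := opnorm_ge0 g).
apply opnorm_le; [lra|]; intros x; simpl.
eapply Rle_trans; [exact (norm_triangle (sval f x) (sval g x))|].
rewrite Rmult_plus_distr_r; apply Rplus_le_compat; apply opnorm_le_apply.
Qed.

Lemma opnorm_scal (k : K) (f : bop_ModuleSpace) :
  opnorm (scal k f) <= abs k * opnorm f.
Proof.
assert (hf := opnorm_ge0 f); assert (hk := abs_ge_0 k).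
apply opnorm_le; [apply Rmult_le_pos; assumption|]; intros x; simpl.
eapply Rle_trans; [exact (norm_scal k (sval f x))|].
rewrite Rmult_assoc; apply Rmult_le_compat_l; [exact hk|apply opnorm_le_apply].
Qed.

Lemma opnorm_eq0 (f : bop_ModuleSpace) : opnorm f = 0 -> f = zero.
Proof.
intros H; apply bop_eq; intros x; simpl.
apply norm_eq_zero.
assert (h1 := opnorm_le_apply f x); assert (h2 := norm_ge_0 (sval f x)).
rewrite H in h1; lra.
Qed.

Lemma bop_minus_apply (g f : bop_ModuleSpace) (x : X) (e : R) :
  opnorm (minus g f) < e -> norm (minus (sval g x) (sval f x)) <= e * norm x.
Proof.
intros H; eapply Rle_trans; [exact (opnorm_le_apply (minus g f) x)|].
apply Rmult_le_compat_r; [apply norm_ge_0|left; exact H].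
Qed.

Hypothesis X_complete : forall F : (X -> Prop) -> Prop,
  ProperFilter F -> cauchy F -> exists l, forall eps : posreal, F (ball l eps).

Lemma opnorm_complete (F : (bop_ModuleSpace -> Prop) -> Prop) : ProperFilter F ->
  (forall eps : posreal, exists f, F (fun g => opnorm (minus g f) < eps)) ->
  exists f, forall eps : posreal, F (fun g => opnorm (minus g f) < eps).
Proof.
intros PF CF.
assert (Hx : forall x : X, exists l : X, forall eta : posreal,
   F (fun g : bop => norm (minus (sval g x) l) < eta)).
{ intros x; set (Fx := filtermap (fun g : bop => sval g x) F).
  assert (PFx : ProperFilter Fx) by (apply filtermap_proper_filter; exact PF).
  assert (CFx : cauchy Fx).
  { intros eps.
    assert (hx := norm_ge_0 x).
    assert (Hd : 0 < eps / (1 + norm x))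
      by (apply Rdiv_lt_0_compat; [apply cond_pos|lra]).
    destruct (CF (mkposreal _ Hd)) as [f Hf]; exists (sval f x).
    unfold Fx, filtermap; revert Hf; apply filter_imp; intros g Hg; simpl in Hg.
    apply norm_compat1; eapply Rle_lt_trans; [exact (bop_minus_apply x Hg)|].
    apply Rlt_le_trans with (eps / (1 + norm x) * (1 + norm x)).
    - apply Rmult_lt_compat_l; [exact Hd|lra].
    - right; field; lra. }
  destruct (X_complete PFx CFx) as [l Hl]; exists l; intros eta.
  assert (hfac := norm_factor_gt_0 (V := X)).
  assert (Hd : 0 < eta / norm_factor (V := X))
    by (apply Rdiv_lt_0_compat; [apply cond_pos|exact hfac]).
  generalize (Hl (mkposreal _ Hd)).
  unfold Fx at 1, filtermap; apply filter_imp; intros g Hg.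
  apply norm_compat2 in Hg; simpl in Hg.
  replace (pos eta) with (norm_factor (V := X) * (eta / norm_factor (V := X)));
    [exact Hg|field; lra]. }
destruct (choice _ Hx) as [L HL].
assert (Hsep : forall u v : X, (forall eta : posreal, norm (minus u v) <= eta) -> u = v).
{ intros u v H.
  assert (h : norm (minus u v) = 0).
  { apply Rle_antisym; [|apply norm_ge_0].
    apply le_epsilon; intros e He; rewrite Rplus_0_l; exact (H (mkposreal e He)). }
  apply norm_eq_zero in h.
  transitivity (plus (minus u v) v); [|rewrite h plus_zero_l; reflexivity].
  unfold minus; rewrite -plus_assoc plus_opp_l plus_zero_r; reflexivity. }
assert (Llin : is_linear L).
{ split.
  - intros x y; apply Hsep; intros eta.
    assert (Hd : 0 < eta / 3) by (assert (h := cond_pos eta); lra).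
    pose (d := mkposreal _ Hd).
    destruct (filter_ex _ (filter_and _ _ (HL (plus x y) d)
       (filter_and _ _ (HL x d) (HL y d)))) as [g [H1 [H2 H3]]]; simpl in H1, H2, H3.
    rewrite (linear_plus _ (proj2_sig g)) in H1.
    rewrite (minus_trans (plus (sval g x) (sval g y))).
    eapply Rle_trans; [apply norm_triangle|].
    rewrite -(norm_opp (minus (L (plus x y)) _)) opp_minus.
    replace (minus (plus (sval g x) (sval g y)) (plus (L x) (L y)))
      with (plus (minus (sval g x) (L x)) (minus (sval g y) (L y))).
    + assert (h := norm_triangle (minus (sval g x) (L x)) (minus (sval g y) (L y))).
      apply Rle_trans with (eta / 3 + (eta / 3 + eta / 3)); [|lra].
      apply Rplus_le_compat; [left; exact H1|].
      eapply Rle_trans; [exact h|].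
      apply Rplus_le_compat; left; [exact H2|exact H3].
    + unfold minus; rewrite opp_plus -!plus_assoc; f_equal.
      rewrite !plus_assoc; f_equal; apply plus_comm.
  - intros k x; apply Hsep; intros eta.
    assert (hk := abs_ge_0 k).
    assert (Hd : 0 < eta / (2 + abs k))
      by (apply Rdiv_lt_0_compat; [apply cond_pos|lra]).
    pose (d := mkposreal _ Hd).
    destruct (filter_ex _ (filter_and _ _ (HL (scal k x) d) (HL x d)))
      as [g [H1 H2]]; simpl in H1, H2.
    rewrite (linear_scal _ (proj2_sig g)) in H1.
    rewrite (minus_trans (scal k (sval g x))).
    eapply Rle_trans; [apply norm_triangle|].
    rewrite -(norm_opp (minus (L (scal k x)) _)) opp_minus -scal_minus_distr_l.
    assert (h := norm_scal k (minus (sval g x) (L x))).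
    assert (h' : abs k * norm (minus (sval g x) (L x)) <= abs k * (eta / (2 + abs k)))
      by (apply Rmult_le_compat_l; lra).
    assert (E : pos eta = eta / (2 + abs k) + abs k * (eta / (2 + abs k))
                      + eta / (2 + abs k)) by (field; lra).
    apply Rle_trans with (eta / (2 + abs k) + abs k * (eta / (2 + abs k))).
    + apply Rplus_le_compat; [left; exact H1|].
      exact (Rle_trans _ _ _ h h').
    + assert (h1 : 0 < eta / (2 + abs k)) by exact Hd; lra.
  - destruct (CF (mkposreal 1 Rlt_0_1)) as [f0 Hf0]; simpl in Hf0.
    assert (h0 := opnorm_ge0 f0).
    exists (opnorm f0 + 1); split; [lra|]; intros x.
    apply le_epsilon; intros e He.
    destruct (filter_ex _ (filter_and _ _ Hf0 (HL x (mkposreal e He))))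
      as [g [H1 H2]]; simpl in H1, H2.
    assert (h1 := bop_minus_apply x H1).
    assert (h2 := opnorm_le_apply f0 x).
    replace (L x) with (plus (opp (minus (sval g x) (L x)))
       (plus (minus (sval g x) (sval f0 x)) (sval f0 x))).
    + eapply Rle_trans; [apply norm_triangle|]; rewrite norm_opp.
      assert (h4 := norm_triangle (minus (sval g x) (sval f0 x)) (sval f0 x)).
      apply Rle_trans with (e + (1 * norm x + opnorm f0 * norm x)); [|lra].
      apply Rplus_le_compat; [left; exact H2|].
      eapply Rle_trans; [exact h4|]; apply Rplus_le_compat; [exact h1|exact h2].
    + unfold minus; rewrite opp_plus opp_opp.
      rewrite -(plus_assoc (sval g x)) plus_opp_l plus_zero_r.
      rewrite (plus_comm (opp _)) -plus_assoc plus_opp_l plus_zero_r; reflexivity. }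
exists (exist _ L Llin : bop); intros eps.
assert (Hd : 0 < eps / 4) by (assert (h := cond_pos eps); lra).
destruct (CF (mkposreal _ Hd)) as [f Hf]; generalize Hf; apply filter_imp; simpl.
intros g Hg; apply Rle_lt_trans with (eps / 2);
  [|assert (h := cond_pos eps); lra].
apply opnorm_le; [assert (h := cond_pos eps); lra|]; intros x.
apply le_epsilon; intros e He.
destruct (filter_ex _ (filter_and _ _ Hf (HL x (mkposreal e He))))
  as [h [H1 H2]]; simpl in H1, H2.
change (norm (minus (sval g x) (L x)) <= eps / 2 * norm x + e).
rewrite (minus_trans (sval f x)) (minus_trans (sval h x) (sval f x)).
assert (h1 := bop_minus_apply x Hg).
assert (h2 := bop_minus_apply x H1).
rewrite -norm_opp opp_minus in h2.
eapply Rle_trans; [apply norm_triangle|].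
apply Rle_trans with (eps / 4 * norm x + (eps / 4 * norm x + e)); [|lra].
apply Rplus_le_compat; [exact h1|].
eapply Rle_trans; [apply norm_triangle|].
apply Rplus_le_compat; [exact h2|left; exact H2].
Qed.

End BoundedOperators.

Lemma cauchy_converges (K : AbsRing) (X : CompleteNormedModule K)
  (F : (X -> Prop) -> Prop) : ProperFilter F -> cauchy F ->
  exists l : X, forall eps : posreal, F (ball l eps).
Proof. intros PF CF; exists (lim F); exact (complete_cauchy F PF CF). Qed.

Definition End_space (K : AbsRing) (K_comm : forall x y : K, mult x y = mult y x)
    (X : CompleteNormedModule K) : CompleteNormedModule K :=
  fromnorm (opnorm_triangle (K_comm := K_comm)) (opnorm_scal (K_comm := K_comm))
    (opnorm_eq0 (K_comm := K_comm))
    (opnorm_complete (K_comm := K_comm) (@cauchy_converges K X)).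

Section Realification.

Variable V : CompleteNormedModule C_AbsRing.

Definition real_ModuleSpace_mixin :
  ModuleSpace.mixin_of R_Ring (CompleteNormedModule.AbelianGroup _ V).
Proof.
apply (ModuleSpace.Mixin R_Ring (CompleteNormedModule.AbelianGroup _ V)
         (fun (t : R) (v : V) => scal (RtoC t : C_AbsRing) v)).
- intros x y u; rewrite (RtoC_mult x y); exact (scal_assoc (RtoC x : C_AbsRing) (RtoC y) u).
- intros u; exact (scal_one u).
- intros x u v; exact (scal_distr_l (RtoC x : C_AbsRing) u v).
- intros x y u; rewrite (RtoC_plus x y); exact (scal_distr_r (RtoC x : C_AbsRing) (RtoC y) u).
Defined.

Definition real_NormedModuleAux : NormedModuleAux R_AbsRing :=
  NormedModuleAux.Pack R_AbsRing V
    (NormedModuleAux.Class R_AbsRing V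
       (ModuleSpace.Class R_Ring V
          (AbelianGroup.class (CompleteNormedModule.AbelianGroup _ V))
          real_ModuleSpace_mixin)
       (UniformSpace.class (CompleteNormedModule.UniformSpace _ V))) V.

Definition real_NormedModule_mixin :
  NormedModule.mixin_of R_AbsRing real_NormedModuleAux.
Proof.
apply (NormedModule.Mixin R_AbsRing real_NormedModuleAux
         (fun v : V => norm v) (norm_factor (V := V))).
- exact (@norm_triangle _ V).
- intros t v; eapply Rle_trans; [exact (norm_scal (RtoC t : C_AbsRing) v)|].
  right; f_equal; exact (Cmod_R t).
- exact (@norm_compat1 _ V).
- exact (@norm_compat2 _ V).
- exact (@norm_eq_zero _ V).
Defined.

Definition realification : CompleteNormedModule R_AbsRing :=
  CompleteNormedModule.Pack R_AbsRing V
    (CompleteNormedModule.Class R_AbsRing V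
       (NormedModule.Class R_AbsRing V
          (NormedModuleAux.class _ real_NormedModuleAux) real_NormedModule_mixin)
       (CompleteSpace.class (CompleteNormedModule.CompleteSpace _ V))) V.

End Realification.

Section Complexification.

Variable X : NormedModule R_AbsRing.

(* The pair [(x, y)] stands for [x + i y]. *)
Definition cplx_scal (z : C) (v : X * X) : X * X :=
  (minus (scal (fst z) (fst v)) (scal (snd z) (snd v)),
   plus (scal (fst z) (snd v)) (scal (snd z) (fst v))).

Let lc (a b : R) (p q : X) : X := plus (scal a p) (scal b q).

Lemma lc_plus a b c d p q : plus (lc a b p q) (lc c d p q) = lc (a + c) (b + d) p q.
Proof.
unfold lc; rewrite (scal_distr_r a c p) (scal_distr_r b d q).
rewrite -!plus_assoc; f_equal.
rewrite !plus_assoc; f_equal; apply plus_comm.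
Qed.

Lemma lc_plus_vec a b p q p' q' :
  lc a b (plus p p') (plus q q') = plus (lc a b p q) (lc a b p' q').
Proof.
unfold lc; rewrite !scal_distr_l -!plus_assoc; f_equal.
rewrite !plus_assoc; f_equal; apply plus_comm.
Qed.

Lemma lc_scal (k a b : R) p q : scal k (lc a b p q) = lc (k * a) (k * b) p q.
Proof. unfold lc; rewrite scal_distr_l !scal_assoc; reflexivity. Qed.

Lemma lc_l p q : lc 1 0 p q = p.
Proof.
unfold lc; rewrite (scal_one p) (scal_zero_l (V := X) q); apply plus_zero_r.
Qed.

Lemma lc_r p q : lc 0 1 p q = q.
Proof.
unfold lc; rewrite (scal_one q) (scal_zero_l (V := X) p); apply plus_zero_l.
Qed.

Lemma lc_norm a b p q : norm (lc a b p q) <= Rabs a * norm p + Rabs b * norm q.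
Proof.
eapply Rle_trans; [exact (norm_triangle (scal a p : X) (scal b q : X))|].
apply Rplus_le_compat; [exact (norm_scal a p)|exact (norm_scal b q)].
Qed.

Lemma lc_lc a b a1 b1 a2 b2 p q :
  lc a b (lc a1 b1 p q) (lc a2 b2 p q) = lc (a * a1 + b * a2) (a * b1 + b * b2) p q.
Proof. unfold lc at 1; rewrite !lc_scal lc_plus; reflexivity. Qed.

Lemma cplx_scal_lc (z : C) (v : X * X) :
  cplx_scal z v = (lc (fst z) (- snd z) (fst v) (snd v),
                   lc (snd z) (fst z) (fst v) (snd v)).
Proof.
unfold cplx_scal, lc, minus; f_equal.
- f_equal; symmetry; exact (scal_opp_l (snd z) (snd v)).
- apply plus_comm.
Qed.

Definition cplx_ModuleSpace_mixin :
  ModuleSpace.mixin_of C_Ring (prod_AbelianGroup X X).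
Proof.
apply (ModuleSpace.Mixin C_Ring (prod_AbelianGroup X X) cplx_scal).
- intros [a b] [c d] [p q]; rewrite !cplx_scal_lc; simpl.
  rewrite !lc_lc; f_equal; f_equal; unfold mult; simpl; ring.
- intros [p q]; rewrite cplx_scal_lc; simpl.
  f_equal; [|exact (lc_r p q)].
  transitivity (lc 1 0 p q); [f_equal; ring|exact (lc_l p q)].
- intros [a b] [p q] [p' q']; rewrite !cplx_scal_lc.
  apply (f_equal2 pair); exact (lc_plus_vec _ _ p q p' q').
- intros [a b] [c d] [p q]; rewrite !cplx_scal_lc.
  apply (f_equal2 pair); simpl; symmetry; (eapply eq_trans; [exact (lc_plus _ _ _ _ p q)|]);
    f_equal; unfold plus; simpl; ring.
Defined.

Definition cplx_ModuleSpace : ModuleSpace C_Ring :=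
  ModuleSpace.Pack C_Ring (X * X)
    (ModuleSpace.Class C_Ring (X * X)
       (AbelianGroup.class (prod_AbelianGroup X X)) cplx_ModuleSpace_mixin) (X * X).

(* Taylor norm: for it, a bounded operator of [X] and its complexification have the
   same norm. *)
Definition taylor_norm (v : X * X) : R :=
  sup (fun s => exists t : R,
    s = norm (plus (scal (cos t) (fst v)) (scal (sin t) (snd v)))).

Lemma lc_cos_sin (t : R) p q : norm (lc (cos t) (sin t) p q) <= norm p + norm q.
Proof.
eapply Rle_trans; [apply lc_norm|].
assert (hc : Rabs (cos t) <= 1) by (apply Rabs_le; apply COS_bound).
assert (hs : Rabs (sin t) <= 1) by (apply Rabs_le; apply SIN_bound).
rewrite -{2}(Rmult_1_l (norm p)) -{2}(Rmult_1_l (norm q)).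
apply Rplus_le_compat; (apply Rmult_le_compat_r; [apply norm_ge_0|assumption]).
Qed.

Lemma taylor_norm_ge (v : X * X) (t : R) :
  norm (lc (cos t) (sin t) (fst v) (snd v)) <= taylor_norm v.
Proof.
apply sup_ub with (norm (fst v) + norm (snd v)).
- intros y [t' ->]; apply lc_cos_sin.
- exists t; reflexivity.
Qed.

Lemma taylor_norm_le (v : X * X) (M : R) :
  (forall t, norm (lc (cos t) (sin t) (fst v) (snd v)) <= M) -> taylor_norm v <= M.
Proof.
intros H; apply sup_le with (norm (lc (cos 0) (sin 0) (fst v) (snd v))).
- exists 0; reflexivity.
- intros y [t ->]; apply H.
Qed.

Lemma taylor_norm_fst (v : X * X) : norm (fst v) <= taylor_norm v.
Proof.
generalize (taylor_norm_ge v 0); rewrite cos_0 sin_0 lc_l; exact (fun h => h).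
Qed.

Lemma taylor_norm_snd (v : X * X) : norm (snd v) <= taylor_norm v.
Proof.
generalize (taylor_norm_ge v (PI / 2)); rewrite cos_PI2 sin_PI2 lc_r; exact (fun h => h).
Qed.

Lemma taylor_triangle (u v : cplx_ModuleSpace) :
  taylor_norm (plus u v) <= taylor_norm u + taylor_norm v.
Proof.
apply taylor_norm_le; intros t.
destruct u as [p q], v as [p' q'].
change (norm (lc (cos t) (sin t) (plus p p') (plus q q'))
        <= taylor_norm (p, q) + taylor_norm (p', q')).
rewrite lc_plus_vec; eapply Rle_trans; [apply norm_triangle|].
apply Rplus_le_compat; [exact (taylor_norm_ge (p, q) t)|exact (taylor_norm_ge (p', q') t)].
Qed.

Lemma unit_angle (x y : R) : x * x + y * y = 1 -> exists t, cos t = x /\ sin t = y.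
Proof.
intros H.
assert (Hx : -1 <= x <= 1) by (split; nra).
assert (Hs : sin (acos x) = sqrt (y * y)).
{ rewrite sin_acos; [|exact Hx]; f_equal; unfold Rsqr; lra. }
destruct (Rle_dec 0 y) as [Hy|Hy].
- exists (acos x); rewrite cos_acos; [|exact Hx]; rewrite Hs sqrt_square; auto.
- exists (- acos x); rewrite cos_neg cos_acos; [|exact Hx]; split; [reflexivity|].
  rewrite sin_neg Hs; replace (y * y) with (- y * - y) by ring.
  rewrite sqrt_square; lra.
Qed.

Lemma taylor_scal (z : C_AbsRing) (v : cplx_ModuleSpace) :
  taylor_norm (scal z v) <= abs z * taylor_norm v.
Proof.
apply taylor_norm_le; intros t.
destruct z as [a b], v as [p q].
change (@scal _ cplx_ModuleSpace (a, b) (p, q)) with (cplx_scal (a, b) (p, q)).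
rewrite cplx_scal_lc; simpl fst; simpl snd; rewrite lc_lc.
change (@abs C_AbsRing (a, b)) with (Cmod (a, b)).
assert (hab : Cmod (a, b) * Cmod (a, b) = a * a + b * b).
{ unfold Cmod; simpl fst; simpl snd.
  rewrite sqrt_sqrt; [ring|nra]. }
assert (hr := Cmod_ge_0 (a, b)).
set (rho := Cmod (a, b)) in *.
assert (ht := sin2_cos2 t); unfold Rsqr in ht.
destruct (Req_dec rho 0) as [E|E].
- assert (a = 0) by nra; assert (b = 0) by nra; subst a b.
  rewrite E Rmult_0_l; eapply Rle_trans; [apply lc_norm|].
  replace (cos t * 0 + sin t * 0) with 0 by ring.
  replace (cos t * - 0 + sin t * 0) with 0 by ring.
  rewrite Rabs_R0; lra.
- destruct (@unit_angle ((cos t * a + sin t * b) / rho) ((cos t * - b + sin t * a) / rho))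
    as [u [Hc Hs]].
  { replace (_ + _) with ((a * a + b * b) * (sin t * sin t + cos t * cos t)
                          / (rho * rho)) by (field; exact E).
    rewrite hab ht; field; rewrite -hab; apply Rmult_integral_contrapositive; tauto. }
  replace (cos t * a + sin t * b) with (rho * cos u) by (rewrite Hc; field; exact E).
  replace (cos t * - b + sin t * a) with (rho * sin u) by (rewrite Hs; field; exact E).
  rewrite -lc_scal; eapply Rle_trans; [exact (norm_scal rho _)|].
  change (abs rho) with (Rabs rho); rewrite (Rabs_pos_eq _ hr).
  apply Rmult_le_compat_l; [exact hr|exact (taylor_norm_ge (p, q) u)].
Qed.

Lemma taylor_eq0 (v : cplx_ModuleSpace) : taylor_norm v = 0 -> v = zero.
Proof.
intros H; destruct v as [p q].
assert (h1 := taylor_norm_fst (p, q)); assert (h2 := taylor_norm_snd (p, q)).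
rewrite H in h1 h2; simpl in h1, h2.
apply (f_equal2 pair); apply norm_eq_zero; apply Rle_antisym;
  first [assumption|apply norm_ge_0].
Qed.

Hypothesis X_complete : forall F : (X -> Prop) -> Prop,
  ProperFilter F -> cauchy F -> exists l, forall eps : posreal, F (ball l eps).

Lemma taylor_complete_comp (pr : X * X -> X) (F : (cplx_ModuleSpace -> Prop) -> Prop) :
  (forall u v : cplx_ModuleSpace, norm (minus (pr v) (pr u)) <= taylor_norm (minus v u)) ->
  ProperFilter F ->
  (forall eps : posreal, exists u, F (fun v => taylor_norm (minus v u) < eps)) ->
  exists l : X, forall eps : posreal,
    F (fun v : cplx_ModuleSpace => norm (minus (pr v) l) < eps).
Proof.
intros Hpr PF CF.
set (Fx := filtermap pr F : (X -> Prop) -> Prop).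
assert (PFx : ProperFilter Fx) by (apply filtermap_proper_filter; exact PF).
assert (CFx : cauchy Fx).
{ intros eps; destruct (CF eps) as [u Hu]; exists (pr u).
  unfold Fx, filtermap; revert Hu; apply filter_imp; intros v Hv.
  apply norm_compat1; exact (Rle_lt_trans _ _ _ (Hpr u v) Hv). }
destruct (X_complete PFx CFx) as [l Hl]; exists l; intros eta.
assert (hfac := norm_factor_gt_0 (V := X)).
assert (Hd : 0 < eta / norm_factor (V := X))
  by (apply Rdiv_lt_0_compat; [apply cond_pos|exact hfac]).
generalize (Hl (mkposreal _ Hd)).
unfold Fx, filtermap; apply filter_imp; intros v Hv.
apply norm_compat2 in Hv; simpl in Hv.
replace (pos eta) with (norm_factor (V := X) * (eta / norm_factor (V := X)));
  [exact Hv|field; lra].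
Qed.

Lemma taylor_complete (F : (cplx_ModuleSpace -> Prop) -> Prop) : ProperFilter F ->
  (forall eps : posreal, exists u, F (fun v => taylor_norm (minus v u) < eps)) ->
  exists u, forall eps : posreal, F (fun v => taylor_norm (minus v u) < eps).
Proof.
intros PF CF.
destruct (@taylor_complete_comp fst F) as [p Hp];
  [intros u v; exact (taylor_norm_fst (minus v u))|exact PF|exact CF|].
destruct (@taylor_complete_comp snd F) as [q Hq];
  [intros u v; exact (taylor_norm_snd (minus v u))|exact PF|exact CF|].
exists (p, q); intros eps.
assert (Hd : 0 < eps / 4) by (assert (h := cond_pos eps); lra).
generalize (filter_and _ _ (Hp (mkposreal _ Hd)) (Hq (mkposreal _ Hd))).
apply filter_imp; intros [x y] [H1 H2]; simpl in H1, H2.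
apply Rle_lt_trans with (eps / 4 + eps / 4); [|assert (h := cond_pos eps); lra].
apply taylor_norm_le; intros t.
eapply Rle_trans; [apply lc_cos_sin|].
apply Rplus_le_compat; left; [exact H1|exact H2].
Qed.

Lemma taylor_bop (f : X -> X) (Hf : is_linear f) (v : X * X) (M : R) :
  0 <= M -> (forall x, norm (f x) <= M * norm x) ->
  taylor_norm (f (fst v), f (snd v)) <= M * taylor_norm v.
Proof.
intros HM H; apply taylor_norm_le; intros t; simpl.
replace (lc (cos t) (sin t) (f (fst v)) (f (snd v)))
  with (f (lc (cos t) (sin t) (fst v) (snd v))).
- eapply Rle_trans; [apply H|]; apply Rmult_le_compat_l; [exact HM|apply taylor_norm_ge].
- unfold lc; rewrite (linear_plus _ Hf) !(linear_scal _ Hf); reflexivity.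
Qed.

Lemma cplx_scal_bop (f : X -> X) (Hf : is_linear f) (z : C) (v : X * X) :
  (f (fst (cplx_scal z v)), f (snd (cplx_scal z v)))
  = cplx_scal z (f (fst v), f (snd v)).
Proof.
rewrite !cplx_scal_lc; unfold lc; simpl.
rewrite !(linear_plus _ Hf) !(linear_scal _ Hf); reflexivity.
Qed.

End Complexification.

Definition complexification (X : CompleteNormedModule R_AbsRing) :
    CompleteNormedModule C_AbsRing :=
  @fromnorm C_AbsRing (cplx_ModuleSpace X) (@taylor_norm X)
    (@taylor_triangle X) (@taylor_scal X) (@taylor_eq0 X)
    (taylor_complete (@cauchy_converges _ X)).

Lemma is_linear_cplx (X : CompleteNormedModule R_AbsRing) (f : X -> X) :
  is_linear f ->
  is_linear (fun v : complexification X => (f (fst v), f (snd v)) : complexification X).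
Proof.
intros Hf; split.
- intros [p q] [p' q']; apply (f_equal2 pair); [exact (linear_plus _ Hf p p')|exact (linear_plus _ Hf q q')].
- intros z v; exact (cplx_scal_bop Hf z v).
- destruct (linear_norm _ Hf) as [M [HM H]]; exists M; split; [exact HM|].
  intros v; exact (taylor_bop Hf v (Rlt_le _ _ HM) H).
Qed.

Definition bop_cplx (X : CompleteNormedModule R_AbsRing) (f : bop X) :
    bop (complexification X) :=
  exist _ _ (is_linear_cplx (proj2_sig f)).

Inductive banach :=
  | RealBanach of CompleteNormedModule R_AbsRing
  | ComplexBanach of CompleteNormedModule C_AbsRing.

(* [opC] is the complex space in which Fourier coefficients are taken. *)
Record operators := Operators {
  op_space :> CompleteNormedModule R_AbsRing;
  op_id : op_space;
  op_comp : op_space -> op_space -> op_space;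
  opC : CompleteNormedModule C_AbsRing;
  op_incl : op_space -> opC
}.

Definition End (X : banach) : operators :=
  match X with
  | RealBanach X =>
      @Operators (End_space Rmult_comm X) (bop_id X) (@bop_comp _ X)
        (End_space Cmult_comm (complexification X)) (@bop_cplx X)
  | ComplexBanach X =>
      @Operators (realification (End_space Cmult_comm X)) (bop_id X) (@bop_comp _ X)
        (End_space Cmult_comm X) (fun f => f)
  end.

Definition vec (r : nat) : UniformSpace := fct_UniformSpace 'I_r R_UniformSpace.

Definition dot (r : nat) (alpha : 'I_r -> Z) (x : 'I_r -> R) : R :=
  \big[Rplus/0]_(i < r) (IZR (alpha i) * x i).

Definition abs1 (r : nat) (alpha : 'I_r -> Z) : R :=
  \big[Rplus/0]_(i < r) IZR (Z.abs (alpha i)).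

Definition diophantine (r : nat) (omega : 'I_r -> R) : Prop :=
  exists cD nu : R, 0 < cD /\ INR r - 1 <= nu /\
    forall alpha : 'I_r -> Z, (exists i, alpha i <> 0%Z) ->
      cD / Rpower (abs1 alpha) nu <= Rabs (dot alpha omega).

Definition vcons (r : nat) (t : R) (x : 'I_r -> R) : 'I_r.+1 -> R :=
  fun i => if unlift ord0 i is Some j then x j else t.

Fixpoint cube_integral (V : CompleteNormedModule R_AbsRing) (r : nat) :
    (('I_r -> R) -> V) -> V :=
  match r with
  | O => fun f => f (fun _ => 0)
  | S r' => fun f =>
      RInt (fun t => cube_integral (fun x : 'I_r' -> R => f (vcons t x))) 0 (2 * PI)
  end.

Definition fourier (V : CompleteNormedModule C_AbsRing) (r : nat)
    (f : ('I_r -> R) -> V) (alpha : 'I_r -> Z) : V :=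
  scal (RtoC (/ (2 * PI) ^ r) : C_AbsRing)
    (cube_integral (V := realification V) (fun theta =>
       scal ((cos (dot alpha theta), - sin (dot alpha theta)) : C_AbsRing) (f theta))).

Section Averaging.

Variable E : operators.

Definition wiener_norm (r : nat) (kappa : R) (f : ('I_r -> R) -> E) : Rbar :=
  Lub_Rbar (fun S => exists s : list ('I_r -> Z), List.NoDup s /\
    S = \big[Rplus/0]_(alpha <- s)
          (exp (kappa * abs1 alpha) * norm (fourier (fun x => op_incl (f x)) alpha))).

Definition in_T (r : nat) (kappa : R) (f : ('I_r -> R) -> E) : Prop :=
  (forall (x : 'I_r -> R) (k : 'I_r -> Z),
     f (fun i => x i + 2 * PI * IZR (k i)) = f x) /\
  (forall x, @continuous (vec r) E f x) /\
  is_finite (wiener_norm kappa f).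

Definition sup_norm (f : R -> E) : Rbar :=
  Lub_Rbar (fun v => exists t, 0 <= t /\ v = norm (f t)).

Definition exp_norm (f : R -> E) : Rbar :=
  Lub_Rbar (fun v => exists t, 0 <= t /\ v = exp t * norm (f t)).

Definition in_Eflat (f : R -> E) : Prop :=
  (forall t, 0 <= t ->
     filterlim f (within (fun s => 0 <= s) (locally t)) (locally (f t))) /\
  is_finite (exp_norm f).

(* [calN omega kappa f N]: [f] belongs to the sum of the two spaces and [N] is its
   norm there.  Maps on the half-line are represented by functions on [R] whose values
   at negative times are irrelevant. *)
Definition calN (r : nat) (omega : 'I_r -> R) (kappa : R) (f : R -> E) (N : R) : Prop :=
  exists (fs : ('I_r -> R) -> E) (ff : R -> E),
    in_T kappa fs /\ in_Eflat ff /\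
    (forall t, 0 <= t -> f t = plus (fs (fun i => omega i * t)) (ff t)) /\
    N = real (wiener_norm kappa fs) + real (exp_norm ff).

Definition is_average (f : R -> E) (l : E) : Prop :=
  (forall t, 0 <= t -> ex_RInt f 0 t) /\
  filterlim (fun t => scal (/ t) (RInt f 0 t)) (Rbar_locally p_infty) (locally l).

Definition average (f : R -> E) : E := iota (is_average f).

(* Derivative of a map on the half-line, one-sided at [0]. *)
Definition is_deriv (f : R -> E) (t : R) (l : E) : Prop :=
  filterdiff f (within (fun s => 0 <= s) (locally t)) (fun h : R => scal h l).

Definition deriv (f : R -> E) (t : R) : E := iota (is_deriv f t).

Definition comp_map (a phi : R -> E) (t : R) : E := op_comp (a t) (phi t).

Definition Lambda (a phi : R -> E) (t : R) : E :=
  minus (op_comp (a t) (phi t)) (op_comp (phi t) (average (comp_map a phi))).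

Definition primitive (f : R -> E) (t : R) : E := RInt f 0 t.

Fixpoint Phi (a : R -> E) (eps : R) (n : nat) : R -> E :=
  match n with
  | O => fun _ => op_id E
  | S m =>
      let I := primitive (Lambda a (Phi a eps m)) in
      fun t => minus (plus (op_id E) (scal eps (I t))) (scal eps (average I))
  end.

Definition An (a : R -> E) (eps : R) (n : nat) : E := average (comp_map a (Phi a eps n)).

Definition defect (a : R -> E) (eps : R) (n : nat) (t : R) : E :=
  minus (scal (/ eps) (deriv (Phi a eps n) t))
    (minus (op_comp (a t) (Phi a eps n t)) (op_comp (Phi a eps n t) (An a eps n))).

(* [average], [RInt] and [deriv] are total; this states that every average, integral
   and derivative involved in the construction up to order [n] genuinely exists. *)
Definition well_defined (a : R -> E) (eps : R) (n : nat) : Prop :=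
  (forall k, (k <= n)%N ->
     is_average (Phi a eps k) (op_id E) /\
     is_average (comp_map a (Phi a eps k)) (An a eps k)) /\
  (forall k, (k < n)%N ->
     (forall t, 0 <= t -> ex_RInt (Lambda a (Phi a eps k)) 0 t) /\
     is_average (primitive (Lambda a (Phi a eps k)))
       (average (primitive (Lambda a (Phi a eps k)))) /\
     forall t, 0 <= t ->
       is_deriv (Phi a eps k.+1) t (scal eps (Lambda a (Phi a eps k) t))).

End Averaging.

(* Main.v *)
Require Import Defs.
From Stdlib Require Import Reals Lra Lia ZArith FunctionalExtensionality Classical ClassicalEpsilon.
From HB Require Import structures.
From mathcomp Require Import all_boot zify ssrZ.
From Coquelicot Require Import Coquelicot.

(* Only the existence of [eps_n] is claimed, so no quantitative loss has to be tracked.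
   Let Q be the class of maps which are approximated at a geometric rate by trigonometric
   polynomials in [omega t] plus decaying maps (the union of the spaces E_kappa, kappa > 0).
   Q is an algebra, its members are bounded and have averages and, by the Diophantine
   condition, the primitive of a zero-mean member of Q is again in Q: the small divisors
   cost a power of the degree, which the geometric rate absorbs.  Hence [Phi a eps n] is a
   polynomial in [eps] with coefficients in Q.  Since Lambda{Phi^[n]} - Lambda{Phi^[n-1]}
   is linear, with coefficients in Q, in Phi^[n] - Phi^[n-1] and the average of
   a (Phi^[n] - Phi^[n-1]), and Phi^[n] - Phi^[n-1] is [eps] times the zero-mean primitive
   of the previous difference, this polynomial difference is divisible by [eps ^ n]; the
   integral of the defect is then bounded by a constant times [eps ^ n].
   That [a] belongs to Q amounts to Fourier inversion on the torus for operator-valued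
   maps: Fejer means converge by Korovkin's argument, and averaging over the summation
   index compares them with the truncated Fourier series. *)

(** The estimates must be uniform in [eps] and in time, and [average], [RInt] and [deriv] are total
    operators whose values mean something only once existence is proved. Both needs shape the
    notions below. A uniform error on a map becomes an error growing like [t] on its primitive, so a
    member of Q is not described by uniform approximation alone: the increments of the approximants
    are kept, and each of them is integrated exactly. An average is recorded together with a bounded
    primitive of the centered map, which yields existence, the value and the integral estimate at
    once. Uniformity in [eps] comes from coefficients that do not depend on it: the degree in [eps]
    grows with [n], but for fixed [n] only finitely many constants occur. The operators are treated
    as a real space, whereas Fourier coefficients live in a complex one. Modes are therefore real
    cosines with a free phase: product-to-sum formulas and the shift by [PI / 2] due to integration
    preserve this form, and pairing [alpha] with [- alpha] bounds the modes by the complex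
    coefficients. *)

Set Implicit Arguments.
Unset Strict Implicit.
Unset Printing Implicit Defensive.

Local Open Scope R_scope.

(** * Linear combinations *)

Section LinearCombinations.

Variable V : ModuleSpace R_Ring.

(** Syntax for a reflexive decision procedure: an identity between real linear combinations of
    vectors is reduced to one real identity per atom, which [ring] can treat. *)
Inductive lin_expr :=
  | LVar of nat | LZero | LPlus of lin_expr & lin_expr | LOpp of lin_expr
  | LScal of R & lin_expr.

Fixpoint lin_eval (env : seq V) (e : lin_expr) : V :=
  match e with
  | LVar n => nth zero env n
  | LZero => zero
  | LPlus e1 e2 => plus (lin_eval env e1) (lin_eval env e2)
  | LOpp e1 => opp (lin_eval env e1)
  | LScal k e1 => scal k (lin_eval env e1)
  end.

Fixpoint lin_coef (e : lin_expr) (n : nat) : R :=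
  match e with
  | LVar m => if m == n then 1 else 0
  | LZero => 0
  | LPlus e1 e2 => lin_coef e1 n + lin_coef e2 n
  | LOpp e1 => - lin_coef e1 n
  | LScal k e1 => k * lin_coef e1 n
  end.

Fixpoint lin_comb (env : seq V) (c : nat -> R) : V :=
  if env is v :: env' then plus (scal (c 0%N) v) (lin_comb env' (fun n => c n.+1))
  else zero.

(** Recursive rather than quantified over the index, so that for a concrete list of atoms it
    computes to a finite conjunction. *)
Fixpoint same_coefs (m : nat) (c d : nat -> R) : Prop :=
  if m is m'.+1 then c 0%N = d 0%N /\ same_coefs m' (fun n => c n.+1) (fun n => d n.+1)
  else True.

Lemma lin_comb_ext env c d : same_coefs (size env) c d -> lin_comb env c = lin_comb env d.
Proof. by elim: env c d => [|v env IH] c d //= [-> H]; rewrite (IH _ _ H). Qed.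

Lemma lin_comb_plus env c d :
  lin_comb env (fun n => c n + d n) = plus (lin_comb env c) (lin_comb env d).
Proof.
elim: env c d => [|v env IH] c d /=; first by rewrite plus_zero_l.
rewrite IH (scal_distr_r (c 0%N) (d 0%N) v) -!plus_assoc; f_equal.
by rewrite !plus_assoc; f_equal; exact: plus_comm.
Qed.

Lemma lin_comb_scal env (k : R) c :
  lin_comb env (fun n => k * c n) = scal k (lin_comb env c).
Proof.
elim: env c => [|v env IH] c /=; first by rewrite (scal_zero_r k).
by rewrite IH scal_distr_l scal_assoc.
Qed.

Lemma lin_comb_zero env : lin_comb env (fun=> 0) = zero.
Proof. by elim: env => [|v env IH] //=; rewrite IH (scal_zero_l v) plus_zero_l. Qed.

Lemma lin_evalE env e : lin_eval env e = lin_comb env (lin_coef e).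
Proof.
elim: e => [m| |e1 IH1 e2 IH2|e IH|k e IH] /=.
- elim: env m => [|v env IH] [|m] //=.
  + by rewrite lin_comb_zero plus_zero_r (scal_one v).
  + by rewrite IH (scal_zero_l v) plus_zero_l.
- by rewrite lin_comb_zero.
- by rewrite IH1 IH2 lin_comb_plus.
- rewrite IH -(scal_opp_one (lin_comb _ _)).
  rewrite -[LHS](lin_comb_scal env (-1)); apply: lin_comb_ext.
  by move: (size env) (lin_coef e) => n; elim: n => //= n IHn c; split => //; ring.
- by rewrite IH lin_comb_scal.
Qed.

Lemma lin_eval_eq env e1 e2 :
  same_coefs (size env) (lin_coef e1) (lin_coef e2) -> lin_eval env e1 = lin_eval env e2.
Proof. by rewrite !lin_evalE; exact: lin_comb_ext. Qed.

End LinearCombinations.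

Ltac lin_index x env :=
  lazymatch env with
  | x :: _ => constr:(0%N)
  | _ :: ?env' => let n := lin_index x env' in constr:(n.+1)
  end.

Ltac lin_add x env :=
  let rec mem l :=
    lazymatch l with
    | x :: _ => constr:(true)
    | _ :: ?l' => mem l'
    | _ => constr:(false)
    end in
  lazymatch mem env with true => env | false => constr:(x :: env) end.

Ltac lin_atoms t env :=
  lazymatch t with
  | zero => env
  | plus ?a ?b => let env := lin_atoms a env in lin_atoms b env
  | minus ?a ?b => let env := lin_atoms a env in lin_atoms b env
  | opp ?a => lin_atoms a env
  | scal _ ?a => lin_atoms a env
  | _ => lin_add t env
  end.

Ltac lin_reify t env :=
  lazymatch t with
  | zero => constr:(LZero)
  | plus ?a ?b =>
      let a := lin_reify a env in let b := lin_reify b env in constr:(LPlus a b)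
  | minus ?a ?b =>
      let a := lin_reify a env in let b := lin_reify b env in constr:(LPlus a (LOpp b))
  | opp ?a => let a := lin_reify a env in constr:(LOpp a)
  | scal ?k ?a => let a := lin_reify a env in constr:(LScal k a)
  | _ => let n := lin_index t env in constr:(LVar n)
  end.

(* The coefficient identities that [ring] does not prove are left as subgoals. *)
Ltac module_eq :=
  lazymatch goal with
  | |- @eq ?T ?a ?b =>
    let env := lin_atoms a (@nil T) in
    let env := lin_atoms b env in
    let ea := lin_reify a env in
    let eb := lin_reify b env in
    refine (@lin_eval_eq _ env ea eb _);
    rewrite /= /opp /plus /mult /scal /one /zero /= /mult /=; repeat split; try ring
  end.

(** * The algebra of operators *)

(** Interface through which real and complex Banach spaces are treated alike. The identity has norm
    at most 1 rather than equal to 1 because the null space is allowed. *)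
Record operator_laws (E : operators) : Prop := OperatorLaws {
  op_comp_plus_l : forall f g h : E,
    op_comp (plus f g) h = plus (op_comp f h) (op_comp g h);
  op_comp_plus_r : forall f g h : E,
    op_comp h (plus f g) = plus (op_comp h f) (op_comp h g);
  op_comp_scal_l : forall (k : R) (f g : E), op_comp (scal k f) g = scal k (op_comp f g);
  op_comp_scal_r : forall (k : R) (f g : E), op_comp f (scal k g) = scal k (op_comp f g);
  norm_op_comp : forall f g : E, norm (op_comp f g) <= norm f * norm g;
  op_comp_id_l : forall f : E, op_comp (op_id E) f = f;
  norm_op_id : norm (op_id E) <= 1;
  op_incl_plus : forall f g : E, op_incl (plus f g) = plus (op_incl f) (op_incl g);
  op_incl_scal : forall (k : R) (f : E),
    op_incl (scal k f) = scal (RtoC k : C_AbsRing) (op_incl f);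
  norm_op_incl : forall f : E, norm (op_incl f) = norm f
}.

Section EndLaws.

Variables (K : AbsRing) (K_comm : forall x y : K, mult x y = mult y x).
Variable X : CompleteNormedModule K.
Let EX := End_space K_comm X.

Lemma bop_comp_norm (f g : EX) : norm (bop_comp f g : EX) <= norm f * norm g.
Proof.
apply (opnorm_le (f := bop_comp f g)).
- apply Rmult_le_pos; apply: opnorm_ge0.
- move=> x /=; eapply Rle_trans; first exact: opnorm_le_apply.
  rewrite Rmult_assoc; apply Rmult_le_compat_l; first exact: opnorm_ge0.
  exact: opnorm_le_apply.
Qed.

Lemma bop_id_norm : norm (bop_id X : EX) <= 1.
Proof. by apply (opnorm_le (f := bop_id X)) => [|x /=]; lra. Qed.

Lemma bop_comp_scal_r (k : K) (f g : EX) :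
  bop_comp f (scal k g : EX) = scal k (bop_comp f g : EX) :> EX.
Proof. by apply: bop_eq => x; exact: (linear_scal _ (proj2_sig f)). Qed.

Lemma bop_comp_plus_r (f g h : EX) :
  bop_comp h (plus f g : EX) = plus (bop_comp h f : EX) (bop_comp h g : EX) :> EX.
Proof. by apply: bop_eq => x; exact: (linear_plus _ (proj2_sig h)). Qed.

End EndLaws.

Lemma taylor_norm_real (X : CompleteNormedModule R_AbsRing) (x : X) :
  taylor_norm (x, zero : X) = norm x.
Proof.
apply Rle_antisym; last exact: (taylor_norm_fst (x, zero)).
apply: taylor_norm_le => t /=.
rewrite (scal_zero_r (sin t)) plus_zero_r.
eapply Rle_trans; first exact: (norm_scal (cos t) x).
have := COS_bound t; have := norm_ge_0 x => h0 h1.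
have : Rabs (cos t) <= 1 by apply: Rabs_le.
rewrite /abs /=; nra.
Qed.

(** One inequality holds because [f] commutes with the rotated combinations that define the Taylor
    norm, the other because real vectors embed isometrically. *)
Lemma bop_cplx_norm (X : CompleteNormedModule R_AbsRing) (f : Defs.bop X) :
  opnorm (bop_cplx f) = opnorm f.
Proof.
apply Rle_antisym; apply: opnorm_le; try exact: opnorm_ge0.
- move=> v; apply: taylor_bop; [exact: (proj2_sig f)|exact: opnorm_ge0|].
  exact: opnorm_le_apply.
- move=> x.
  have := opnorm_le_apply (bop_cplx f) (x, zero : X); rewrite /=.
  rewrite (linear_zero _ (proj2_sig f)).
  rewrite /norm /=.
  rewrite -/(@taylor_norm X) (taylor_norm_real x) taylor_norm_real.
  by [].
Qed.

Lemma End_laws (X : banach) : operator_laws (End X).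
Proof.
case: X => X; split.
- by move=> f g h; apply: bop_eq.
- exact: bop_comp_plus_r.
- by move=> k f g; apply: bop_eq.
- exact: bop_comp_scal_r.
- exact: bop_comp_norm.
- by move=> f; apply: bop_eq.
- exact: bop_id_norm.
- by move=> f g; apply: bop_eq => -[p q].
- move=> k f; apply: bop_eq => -[p q]; apply: (f_equal2 pair) => /=.
  + rewrite (scal_zero_l (V := X)) /minus opp_zero plus_zero_r //.
  + rewrite (scal_zero_l (V := X)) plus_zero_r //.
- exact: bop_cplx_norm.
- by move=> f g h; apply: bop_eq.
- exact: bop_comp_plus_r.
- by move=> k f g; apply: bop_eq.
- move=> k f g; exact: bop_comp_scal_r.
- exact: bop_comp_norm.
- by move=> f; apply: bop_eq.
- exact: bop_id_norm.
- by [].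
- by [].
- by [].
Qed.

(** * Uniformly continuous maps on R^r and their integrals over the cube *)

Lemma continuous_normP (E : NormedModule R_AbsRing) (f : R -> E) (x : R) :
  (forall e, 0 < e -> exists d, 0 < d /\
     forall y, Rabs (y - x) < d -> norm (minus (f y) (f x)) <= e) ->
  continuous f x.
Proof.
move=> H; apply/filterlim_locally_ball_norm => e.
have [|d [hd Hd]] := H (e / 2); first by have := cond_pos e; lra.
exists (mkposreal d hd) => y hy.
rewrite /ball_norm; apply: Rle_lt_trans; first exact: Hd.
by have := cond_pos e; lra.
Qed.

Lemma cos_lipschitz (x y : R) : Rabs (cos x - cos y) <= Rabs (x - y).
Proof.
have [||c [_ ->]] := MVT_gen cos y x (fun t => - sin t).
- by move=> t _; auto_derive => //; ring.
- by move=> t _; exact: (derivable_continuous_pt _ _ (derivable_pt_cos t)).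
rewrite Rabs_mult -[X in _ <= X]Rmult_1_l; apply: Rmult_le_compat_r; first exact: Rabs_pos.
by rewrite Rabs_Ropp; apply: Rabs_le; exact: SIN_bound.
Qed.

HB.instance Definition _ := Monoid.isComLaw.Build R 0 Rplus
  (fun x y z => esym (Rplus_assoc x y z)) Rplus_comm Rplus_0_l.

Lemma Rsum_mulr (I : Type) (s : seq I) (P : pred I) (F : I -> R) (k : R) :
  \big[Rplus/0]_(i <- s | P i) (F i * k) = \big[Rplus/0]_(i <- s | P i) F i * k.
Proof.
apply: (big_rec2 (fun x y => x = y * k)) => [|i x y _ ->]; by rewrite ?Rmult_0_l //; ring.
Qed.

Lemma Rsum_le (I : Type) (s : seq I) (P : pred I) (F G : I -> R) :
  (forall i, P i -> F i <= G i) ->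
  \big[Rplus/0]_(i <- s | P i) F i <= \big[Rplus/0]_(i <- s | P i) G i.
Proof.
move=> H; apply: (big_ind2 Rle) => //; first exact: Rle_refl.
by move=> *; apply: Rplus_le_compat.
Qed.

Lemma Rsum_ge0 (I : Type) (s : seq I) (P : pred I) (F : I -> R) :
  (forall i, P i -> 0 <= F i) -> 0 <= \big[Rplus/0]_(i <- s | P i) F i.
Proof. by move=> H; apply: big_ind => //; [exact: Rle_refl|move=> x y *; lra]. Qed.

Lemma Rsum_const (I : finType) (A : {pred I}) (k : R) :
  \big[Rplus/0]_(i in A) k = INR #|A| * k.
Proof.
rewrite big_const; elim: #|A| => [|n IH] /=; first by rewrite Rmult_0_l.
by rewrite IH -/(INR n.+1) S_INR; ring.
Qed.

Lemma dot_plus r (al be : 'I_r -> Z) (x : 'I_r -> R) :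
  dot (fun i => (al i + be i)%Z) x = dot al x + dot be x.
Proof. by rewrite /dot -big_split; apply: eq_bigr => i _ /=; rewrite plus_IZR; ring. Qed.

Lemma dot_opp r (al : 'I_r -> Z) (x : 'I_r -> R) :
  dot (fun i => (- al i)%Z) x = - dot al x.
Proof.
rewrite -[RHS]Rmult_1_r Ropp_mult_distr_l_reverse Ropp_mult_distr_r -Rsum_mulr.
by apply: eq_bigr => i _; rewrite opp_IZR; ring.
Qed.

Lemma dot_scal r (al : 'I_r -> Z) (x : 'I_r -> R) (t : R) :
  dot al (fun i => x i * t) = dot al x * t.
Proof. by rewrite /dot -Rsum_mulr; apply: eq_bigr => i _; ring. Qed.

Lemma dot_minus_r r (al : 'I_r -> Z) (x y : 'I_r -> R) :
  dot al (fun i => x i - y i) = dot al x - dot al y.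
Proof.
rewrite /Rminus -[- dot al y]Rmult_1_r Ropp_mult_distr_l_reverse Ropp_mult_distr_r.
rewrite -Rsum_mulr /dot -big_split; apply: eq_bigr => i _ /=; ring.
Qed.

Lemma dot_vcons r (al : 'I_r.+1 -> Z) (t : R) (x : 'I_r -> R) :
  dot al (vcons t x) = IZR (al ord0) * t + dot (fun i => al (lift ord0 i)) x.
Proof.
rewrite /dot big_ord_recl /vcons unlift_none; f_equal.
by apply: eq_bigr => i _; rewrite liftK.
Qed.

Lemma dot_diff_le r (al : 'I_r -> Z) (x y : 'I_r -> R) (d : R) :
  (forall i, Rabs (x i - y i) < d) -> Rabs (dot al x - dot al y) <= abs1 al * d.
Proof.
move=> H; rewrite -dot_minus_r /dot /abs1 -Rsum_mulr.
apply: (big_ind2 (fun u v => Rabs u <= v)) => [|u v u' v' h h'|i _].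
- by rewrite Rabs_R0; lra.
- by apply: Rle_trans; [exact: Rabs_triang|lra].
- rewrite Rabs_mult abs_IZR; apply: Rmult_le_compat_l; last exact: Rlt_le.
  by rewrite ?abs_IZR; exact: Rabs_pos.
Qed.

Lemma abs1_ge0 r (al : 'I_r -> Z) : 0 <= abs1 al.
Proof. by apply: Rsum_ge0 => i _; rewrite ?abs_IZR; exact: Rabs_pos. Qed.

Section UniformlyContinuous.

Variable E : NormedModule R_AbsRing.

Definition buc r (f : ('I_r -> R) -> E) : Prop :=
  (exists B, 0 <= B /\ forall x, norm (f x) <= B) /\
  forall e, 0 < e -> exists d, 0 < d /\
    forall x y, (forall i, Rabs (x i - y i) < d) -> norm (minus (f x) (f y)) <= e.

Lemma buc_const r (v : E) : buc (fun _ : 'I_r -> R => v).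
Proof.
split; first by exists (norm v); split; [exact: norm_ge_0|move=> _; exact: Rle_refl].
move=> e he; exists 1; split; first lra.
by move=> x y _; rewrite minus_eq_zero norm_zero; lra.
Qed.

Lemma buc_plus r (f g : ('I_r -> R) -> E) :
  buc f -> buc g -> buc (fun x => plus (f x) (g x)).
Proof.
move=> [[B [hB HB]] Hf] [[C [hC HC]] Hg]; split.
  exists (B + C); split; first lra.
  move=> x; apply: Rle_trans; first exact: norm_triangle.
  by apply: Rplus_le_compat.
move=> e he; have [|d [hd Hd]] := Hf (e / 2); first lra.
have [|d' [hd' Hd']] := Hg (e / 2); first lra.
exists (Rmin d d'); split; first by apply: Rmin_pos.
move=> x y H.
replace (minus _ _) with (plus (minus (f x) (f y)) (minus (g x) (g y))) by module_eq.
apply: Rle_trans; first exact: norm_triangle.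
have h1 : norm (minus (f x) (f y)) <= e / 2.
  by apply: Hd => i; apply: Rlt_le_trans (H i) _; exact: Rmin_l.
have h2 : norm (minus (g x) (g y)) <= e / 2.
  by apply: Hd' => i; apply: Rlt_le_trans (H i) _; exact: Rmin_r.
lra.
Qed.

Lemma buc_slice r (f : ('I_r.+1 -> R) -> E) (t : R) :
  buc f -> buc (fun x => f (vcons t x)).
Proof.
move=> [[B [hB HB]] Hf]; split; first by exists B.
move=> e he; have [d [hd Hd]] := Hf e he; exists d; split => // x y H.
apply: Hd => i; rewrite /vcons; case: unliftP => [j _|_] //.
by rewrite Rminus_diag Rabs_R0.
Qed.

End UniformlyContinuous.

Lemma buc_lin (E F : NormedModule R_AbsRing) (L : E -> F) r (f : ('I_r -> R) -> E) :
  is_linear L -> buc f -> buc (fun x => L (f x)).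
Proof.
move=> HL [[B [hB HB]] Hf].
have [M [hM HM]] := linear_norm _ HL.
split.
  exists (M * B); split; first by apply: Rmult_le_pos; lra.
  by move=> x; apply: Rle_trans; [exact: HM|apply: Rmult_le_compat_l; [lra|exact: HB]].
move=> e he; have [|d [hd Hd]] := Hf (e / M); first by apply: Rdiv_lt_0_compat.
exists d; split => // x y H.
have -> : minus (L (f x)) (L (f y)) = L (minus (f x) (f y)).
  by rewrite /minus (linear_plus _ HL) (linear_opp _ _ HL).
apply: Rle_trans; first exact: HM.
replace e with (M * (e / M)) by (field; lra).
by apply: Rmult_le_compat_l; [lra|exact: Hd].
Qed.

Lemma buc_scal (E : NormedModule R_AbsRing) r (k : ('I_r -> R) -> R) (f : ('I_r -> R) -> E) :
  buc (E := R_NormedModule) k -> buc f -> buc (fun x => scal (k x) (f x)).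
Proof.
move=> [[B [hB HB]] Hk] [[C [hC HC]] Hf]; split.
  exists (B * C); split; first by apply: Rmult_le_pos.
  move=> x; apply: Rle_trans; first exact: norm_scal.
  by apply: Rmult_le_compat; [exact: Rabs_pos|exact: norm_ge_0|exact: HB|exact: HC].
move=> e he.
(* The added 1 keeps the divisors positive when one of the bounds is 0. *)
have [|d [hd Hd]] := Hk (e / (2 * (C + 1))); first by apply: Rdiv_lt_0_compat; lra.
have [|d' [hd' Hd']] := Hf (e / (2 * (B + 1))); first by apply: Rdiv_lt_0_compat; lra.
exists (Rmin d d'); split; first by apply: Rmin_pos.
move=> x y H.
replace (minus _ _) with (plus (scal (k x - k y) (f x)) (scal (k y) (minus (f x) (f y))))
  by module_eq.
apply: Rle_trans; first exact: norm_triangle.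
have h1 : Rabs (k x - k y) <= e / (2 * (C + 1)).
  by apply: Hd => i; apply: Rlt_le_trans (H i) _; exact: Rmin_l.
have h2 : norm (minus (f x) (f y)) <= e / (2 * (B + 1)).
  by apply: Hd' => i; apply: Rlt_le_trans (H i) _; exact: Rmin_r.
replace e with (e / (2 * (C + 1)) * (C + 1) + (B + 1) * (e / (2 * (B + 1)))) by (field; lra).
apply: Rplus_le_compat; (apply: Rle_trans; first exact: norm_scal).
- by apply: Rmult_le_compat => //; [exact: Rabs_pos|exact: norm_ge_0|have := HC x; lra].
- apply: Rmult_le_compat => //; [exact: Rabs_pos|exact: norm_ge_0|].
  by apply: Rle_trans; [exact: (HB y)|lra].
Qed.

Lemma buc_cos r (al : 'I_r -> Z) (phi : R) :
  buc (E := R_NormedModule) (fun x => cos (dot al x + phi)).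
Proof.
split.
  exists 1; split; first lra.
  by move=> x; apply: Rabs_le; exact: COS_bound.
move=> e he; have h0 := abs1_ge0 al.
exists (e / (abs1 al + 1)); split; first by apply: Rdiv_lt_0_compat; lra.
move=> x y /dot_diff_le H.
apply: Rle_trans; first exact: cos_lipschitz.
replace (_ - _) with (dot al x - dot al y) by ring.
apply: Rle_trans; first exact: H.
replace e with ((abs1 al + 1) * (e / (abs1 al + 1))) at 2 by (field; lra).
by apply: Rmult_le_compat_r; [apply: Rlt_le; apply: Rdiv_lt_0_compat|]; lra.
Qed.

HB.instance Definition _ (G : AbelianMonoid) := Monoid.isComLaw.Build G zero (@plus G)
  (@plus_assoc G) (@plus_comm G) (@plus_zero_l G).

Lemma buc_sum (E : NormedModule R_AbsRing) r (I : Type) (s : seq I)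
  (P : pred I) (F : I -> ('I_r -> R) -> E) :
  (forall i, buc (F i)) ->
  buc (fun x => \big[plus/zero]_(i <- s | P i) F i x).
Proof.
move=> H; elim: s => [|i s IH].
  by have := @buc_const E r zero; congr buc; apply: functional_extensionality => x; rewrite big_nil.
have : buc (fun x => if P i then plus (F i x) (\big[plus/zero]_(i <- s | P i) F i x)
                 else \big[plus/zero]_(i <- s | P i) F i x).
  by case: (P i) => //; apply: buc_plus.
by congr buc; apply: functional_extensionality => x; rewrite big_cons.
Qed.

Lemma norm_sum_le (E : NormedModule R_AbsRing) (I : Type) (s : seq I) (P : pred I)
  (F : I -> E) (G : I -> R) :
  (forall i, P i -> norm (F i) <= G i) ->
  norm (\big[plus/zero]_(i <- s | P i) F i) <= \big[Rplus/0]_(i <- s | P i) G i.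
Proof.
move=> H; apply: (big_ind2 (fun (u : E) v => norm u <= v)) => //.
- by rewrite norm_zero; exact: Rle_refl.
- move=> u v u' v' h h'; apply: Rle_trans; first exact: norm_triangle.
  exact: Rplus_le_compat.
Qed.

Lemma norm_scal_R (E : NormedModule R_AbsRing) (k : R) (x : E) :
  norm (scal k x) = Rabs k * norm x.
Proof.
apply: Rle_antisym; first exact: norm_scal.
case: (Req_dec k 0) => [->|hk].
  by rewrite Rabs_R0 Rmult_0_l; exact: norm_ge_0.
have hk' := Rabs_pos_lt k hk.
replace x with (scal (/ k) (scal k x)) at 1 by (module_eq; field; lra).
have := norm_scal (/ k) (scal k x); rewrite /abs /= Rabs_inv => h.
apply: Rle_trans; first exact: Rmult_le_compat_l (Rlt_le _ _ hk') h.
by right; field; lra.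
Qed.

Lemma norm_minus_sym (E : NormedModule R_AbsRing) (x y : E) :
  norm (minus x y) = norm (minus y x).
Proof. by rewrite -norm_opp opp_minus. Qed.

Lemma norm_minus_triangle (E : NormedModule R_AbsRing) (y x z : E) :
  norm (minus x z) <= norm (minus x y) + norm (minus y z).
Proof. by rewrite (minus_trans y x z); exact: norm_triangle. Qed.

(** * Iterated integrals over the cube *)

Section CubeIntegral.

Variable E : CompleteNormedModule R_AbsRing.

Lemma vcons_close r (s t d : R) (x : 'I_r -> R) :
  Rabs (s - t) < d -> forall i, Rabs (vcons s x i - vcons t x i) < d.
Proof.
move=> H i; rewrite /vcons; case: unliftP => // j _.
by rewrite Rminus_diag Rabs_R0; have := Rabs_pos (s - t); lra.
Qed.

(** Linearity and the norm bound have to be proved in one induction: in dimension [r] they give the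
    continuity of the integral of a slice, hence the integrability on which both rest in dimension
    [r.+1]. *)
Let cube_linear_at r := forall (f g : ('I_r -> R) -> E) (k : R), buc f -> buc g ->
  cube_integral (fun x => plus (f x) (scal k (g x)))
  = plus (cube_integral f) (scal k (cube_integral g)).

Let cube_bounded_at r := forall (f : ('I_r -> R) -> E) (B : R), buc f ->
  (forall x, norm (f x) <= B) -> norm (cube_integral f) <= (2 * PI) ^ r * B.

Let slice_continuous_at r : cube_linear_at r -> cube_bounded_at r ->
  forall (f : ('I_r.+1 -> R) -> E) (t : R), buc f ->
  continuous (fun t => cube_integral (fun x => f (vcons t x))) t.
Proof.
move=> HL HB f t Hf; apply: continuous_normP => e he.
have hP : 0 < (2 * PI) ^ r by apply: pow_lt; have := PI_RGT_0; lra.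
have [|d [hd Hd]] := Hf.2 (e / (2 * PI) ^ r); first exact: Rdiv_lt_0_compat.
exists d; split => // s hs.
have -> : minus (cube_integral (fun x => f (vcons s x))) (cube_integral (fun x => f (vcons t x)))
   = cube_integral (fun x => plus (f (vcons s x)) (scal (-1) (f (vcons t x)))).
  by rewrite HL; [module_eq|exact: buc_slice|exact: buc_slice].
replace e with ((2 * PI) ^ r * (e / (2 * PI) ^ r)) by (field; lra).
apply: HB.
  apply: buc_plus; first exact: buc_slice.
  by apply: buc_scal; [exact: buc_const|exact: buc_slice].
move=> x; replace (plus _ _) with (minus (f (vcons s x)) (f (vcons t x))) by module_eq.
by apply: Hd; apply: vcons_close.
Qed.

Let cube_props r : cube_linear_at r /\ cube_bounded_at r.
Proof.
elim: r => [|r [HL HB]].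
  by split => [f g k _ _|f B _ H] //=; rewrite Rmult_1_l.
have ex f : buc f ->
    ex_RInt (fun t => cube_integral (fun x : 'I_r -> R => f (vcons t x) : E)) 0 (2 * PI).
  by move=> Hf; apply: ex_RInt_continuous => z _; apply: slice_continuous_at.
split => [f g k Hf Hg|f B Hf H] /=.
  rewrite -RInt_scal; last exact: ex.
  rewrite -RInt_plus; [|exact: ex|exact: ex_RInt_scal (ex _ Hg)].
  by apply: RInt_ext => t _; apply: HL; apply: buc_slice.
have := PI_RGT_0 => hp.
replace (2 * PI * (2 * PI) ^ r * B) with ((2 * PI - 0) * ((2 * PI) ^ r * B)) by ring.
apply: (norm_RInt_le_const (fun t => cube_integral (fun x => f (vcons t x)))); first lra.
  by move=> t _; apply: HB => //; exact: buc_slice.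
exact: RInt_correct (ex _ Hf).
Qed.

Lemma cube_slice_continuous r (f : ('I_r.+1 -> R) -> E) (t : R) : buc f ->
  continuous (fun t => cube_integral (fun x => f (vcons t x))) t.
Proof. by case: (cube_props r) => HL HB; apply: slice_continuous_at. Qed.

Lemma ex_RInt_slice r (f : ('I_r.+1 -> R) -> E) (a b : R) : buc f ->
  ex_RInt (fun t => cube_integral (fun x => f (vcons t x))) a b.
Proof. by move=> Hf; apply: ex_RInt_continuous => z _; apply: cube_slice_continuous. Qed.

Lemma cube_const r (v : E) : cube_integral (fun _ : 'I_r -> R => v) = scal ((2 * PI) ^ r) v.
Proof.
elim: r => [|r IH] /=; first by rewrite (scal_one v).
rewrite IH RInt_const; module_eq.
Qed.

Lemma cube_scal r (k : R) (f : ('I_r -> R) -> E) : buc f ->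
  cube_integral (fun x => scal k (f x)) = scal k (cube_integral f).
Proof.
move=> Hf; transitivity (cube_integral (fun x => plus zero (scal k (f x)))).
  by congr cube_integral; apply: functional_extensionality => x; rewrite plus_zero_l.
have [HL _] := cube_props r; rewrite HL //; last exact: (buc_const r (zero : E)).
by rewrite cube_const; module_eq.
Qed.

Lemma cube_plus r (f g : ('I_r -> R) -> E) : buc f -> buc g ->
  cube_integral (fun x => plus (f x) (g x)) = plus (cube_integral f) (cube_integral g).
Proof.
move=> Hf Hg; transitivity (cube_integral (fun x => plus (f x) (scal 1 (g x)))).
  by congr cube_integral; apply: functional_extensionality => x; rewrite (scal_one (g x)).
by have [HL _] := cube_props r; rewrite HL // (scal_one (cube_integral g)).
Qed.

Lemma cube_sum r (I : Type) (s : seq I) (F : I -> ('I_r -> R) -> E) :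
  (forall i, buc (F i)) ->
  cube_integral (fun x => \big[plus/zero]_(i <- s) F i x)
  = \big[plus/zero]_(i <- s) cube_integral (F i).
Proof.
move=> H; elim: s => [|i s IH].
  rewrite big_nil; transitivity (cube_integral (fun _ : 'I_r -> R => zero : E)).
    by congr cube_integral; apply: functional_extensionality => x; rewrite big_nil.
  by rewrite cube_const; module_eq.
rewrite big_cons -IH -cube_plus //; last exact: (buc_sum s xpredT).
by congr cube_integral; apply: functional_extensionality => x; rewrite big_cons.
Qed.

End CubeIntegral.

Lemma norm_cube_le (E : CompleteNormedModule R_AbsRing) r (f : ('I_r -> R) -> E)
  (g : ('I_r -> R) -> R_CompleteNormedModule) :
  buc f -> buc g -> (forall x, norm (f x) <= g x) ->
  norm (cube_integral f) <= cube_integral g.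
Proof.
elim: r f g => [|r IH] f g Hf Hg H; first exact: H.
have := PI_RGT_0 => hp.
apply: (norm_RInt_le (fun t => cube_integral (fun x => f (vcons t x)))
  (fun t => cube_integral (fun x => g (vcons t x) : R_CompleteNormedModule)) 0 (2 * PI)).
- lra.
- by move=> t _; apply: IH => // ; exact: buc_slice.
- exact: RInt_correct (ex_RInt_slice _ _ Hf).
- exact: RInt_correct (ex_RInt_slice _ _ Hg).
Qed.

(** A linear map commutes with Riemann sums, and its continuity passes this to the limit. *)
Lemma is_RInt_linear (E F : NormedModule R_AbsRing) (L : E -> F) (f : R -> E)
  (a b : R) (l : E) :
  is_linear L -> is_RInt f a b l -> is_RInt (fun t => L (f t)) a b (L l).
Proof.
move=> HL Hf.
have E1 : forall s, Riemann_sum (fun t => L (f t)) s = L (Riemann_sum f s).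
  apply: SF_cons_ind => [x|h s IH]; first by rewrite /Riemann_sum /= (linear_zero _ HL).
  by rewrite !Riemann_sum_cons IH (linear_plus _ HL) (linear_scal _ HL).
apply: (filterlim_ext (fun s => L (scal (sign (b - a)) (Riemann_sum f s)))).
  by move=> s; rewrite E1 (linear_scal _ HL).
apply: filterlim_comp; first exact: Hf.
exact: (linear_cont _ _ HL).
Qed.

Lemma cube_linear (E F : CompleteNormedModule R_AbsRing) (L : E -> F) r
  (f : ('I_r -> R) -> E) :
  is_linear L -> buc f -> cube_integral (fun x => L (f x)) = L (cube_integral f).
Proof.
move=> HL; elim: r f => [|r IH] f Hf //=.
transitivity (RInt (fun t => L (cube_integral (fun x => f (vcons t x)))) 0 (2 * PI)).
  by apply: RInt_ext => t _; apply: IH; exact: buc_slice.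
apply: is_RInt_unique; apply: is_RInt_linear HL _.
exact: RInt_correct (ex_RInt_slice _ _ Hf).
Qed.

Definition is_zero_index r (al : 'I_r -> Z) : bool := [forall i, Z.eqb (al i) 0].

(** Orthogonality of the characters in real form. The phase makes the induction work: it absorbs the
    contribution of the coordinate not yet integrated. *)
Lemma cube_cos r (al : 'I_r -> Z) (phi : R) :
  cube_integral (fun x => cos (dot al x + phi) : R_CompleteNormedModule)
  = (if is_zero_index al then (2 * PI) ^ r * cos phi else 0).
Proof.
elim: r al phi => [|r IH] al phi /=.
  have -> : is_zero_index al by apply/forallP => -[].
  by rewrite /dot big_ord0 Rplus_0_l Rmult_1_l.
pose al' : 'I_r -> Z := fun i => al (lift ord0 i).
transitivity (RInt (fun t => if is_zero_index al'
     then scal ((2 * PI) ^ r) (cos (IZR (al ord0) * t + phi)) else 0) 0 (2 * PI)).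
  apply: RInt_ext => t _; rewrite -[RHS](IH al' (IZR (al ord0) * t + phi)).
  congr cube_integral; apply: functional_extensionality => x.
  have -> : dot al (vcons t x) = IZR (al ord0) * t + dot al' x by exact: dot_vcons.
  by f_equal; ring.
have -> : is_zero_index al = Z.eqb (al ord0) 0 && is_zero_index al'.
  apply/forallP/andP => [H|[h0 /forallP H] i]; first by split; [exact: H|apply/forallP => i; exact: H].
  by case: (unliftP ord0 i) => [j|] -> //; exact: H.
case: (is_zero_index al'); last first.
  by rewrite andbF RInt_const /scal /= /mult /= Rmult_0_r.
rewrite andbT; case: (Z.eqb_spec (al ord0) 0) => [->|h0].
  rewrite (RInt_ext _ (fun _ => (2 * PI) ^ r * cos phi)) => [|t _].
    by rewrite RInt_const /scal /= /mult /=; ring.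
  by rewrite Rmult_0_l Rplus_0_l.
have hk : IZR (al ord0) <> 0 by move=> /eq_IZR.
apply: is_RInt_unique.
set k := IZR _ in hk *.
have HI := @is_RInt_derive R_CompleteNormedModule
   (fun t => (2 * PI) ^ r * sin (k * t + phi) / k)
   (fun t => scal ((2 * PI) ^ r) (cos (k * t + phi))) 0 (2 * PI).
(* The frequency is an integer, so the primitive agrees at both ends. As [sin_period] counts periods
   by a natural number, a negative frequency is handled by adding the periods to the other side. *)
have E0 : minus ((2 * PI) ^ r * sin (k * (2 * PI) + phi) / k)
                ((2 * PI) ^ r * sin (k * 0 + phi) / k) = 0 :> R.
  have -> : sin (k * (2 * PI) + phi) = sin (k * 0 + phi); last exact: minus_eq_zero.
    rewrite Rmult_0_r Rplus_0_l /k.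
    have -> : IZR (al ord0) * (2 * PI) + phi = phi + 2 * IZR (al ord0) * PI by ring.
    case: (Z_le_gt_dec 0 (al ord0)) => hz.
      by rewrite -[al ord0]Z2Nat.id // -INR_IZR_INZ sin_period.
    rewrite -(sin_period _ (Z.to_nat (- al ord0))) INR_IZR_INZ Z2Nat.id; last lia.
    by rewrite opp_IZR; f_equal; ring.
rewrite E0 in HI; apply: HI => t _.
  by auto_derive => //; rewrite /scal /= /mult /=; field.
apply: continuous_scal; first exact: continuous_const.
apply: (continuous_comp (fun t => k * t + phi)); last exact: continuous_cos.
apply: (continuous_plus (fun t => k * t)); last exact: continuous_const.
by apply: (continuous_scal (fun _ => k)); [exact: continuous_const|exact: continuous_id].
Qed.

(** * Compactness of the torus *)

(** The compactness theorem for boxes is stated for nested tuples; this and [tn_of_fun] translate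
    between them and vectors indexed by ['I_r]. *)
Fixpoint fun_of_tn r : Compactness.Tn r R -> 'I_r -> R :=
  match r with
  | 0 => fun _ _ => 0
  | r'.+1 => fun p => vcons (fst p) (@fun_of_tn r' (snd p))
  end.

Fixpoint tn_of_fun r : ('I_r -> R) -> Compactness.Tn r R :=
  match r with
  | 0 => fun _ => tt
  | r'.+1 => fun x => (x ord0, @tn_of_fun r' (fun i => x (lift ord0 i)))
  end.

Lemma tn_of_funK r (x : 'I_r -> R) : fun_of_tn (tn_of_fun x) = x.
Proof.
apply: functional_extensionality; elim: r x => [|r IH] x i /=; first by case: i.
by rewrite /vcons; case: (unliftP ord0 i) => [j|] -> //; rewrite IH.
Qed.

Lemma bounded_tn_of_fun r (a b x : 'I_r -> R) : (forall i, a i <= x i <= b i) ->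
  bounded_n r (tn_of_fun a) (tn_of_fun b) (tn_of_fun x).
Proof. by elim: r a b x => [|r IH] a b x H //=; split; [exact: H|apply: IH => i; exact: H]. Qed.

Lemma close_fun_of_tn r (d : R) (x t : Compactness.Tn r R) : close_n r d x t ->
  forall i, Rabs (fun_of_tn x i - fun_of_tn t i) < d.
Proof.
elim: r x t => [|r IH] x t; first by move=> _ [].
case: x t => x1 x2 [t1 t2] /= [h1 h2] i; rewrite /vcons.
by case: (unliftP ord0 i) => [j|] _ //; exact: IH.
Qed.

Lemma period_shift (a y : R) : exists k : Z, a <= y + 2 * PI * IZR k <= a + 2 * PI.
Proof.
have hp := PI_RGT_0.
have [h1 h2] := archimed ((a - y) / (2 * PI)).
exists (up ((a - y) / (2 * PI))).
set k := IZR _ in h1 h2 *.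
have E1 : a - y = 2 * PI * ((a - y) / (2 * PI)) by field; lra.
split.
- by have := Rmult_lt_compat_l (2 * PI) _ _ _ h1; lra.
- by have := Rmult_le_compat_l (2 * PI) _ _ _ h2; lra.
Qed.

Definition periodic (E : Type) r (f : ('I_r -> R) -> E) : Prop :=
  forall (x : 'I_r -> R) (k : 'I_r -> Z), f (fun i => x i + 2 * PI * IZR (k i)) = f x.

Lemma period_shift_vec r (x : 'I_r -> R) :
  exists k : 'I_r -> Z, forall i, 0 <= x i + 2 * PI * IZR (k i) <= 2 * PI.
Proof.
apply: (choice (fun i k => 0 <= x i + 2 * PI * IZR k <= 2 * PI)) => i.
by have [k] := period_shift 0 (x i); rewrite Rplus_0_l; exists k.
Qed.

(** Heine's theorem on the cube. Periodicity moves [x] into the cube, and [y] is moved by the same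
    shift; it may leave the cube, which does no harm since only [x] enters the compactness argument.
    Boundedness follows by walking from the origin in finitely many short steps. *)
Lemma continuous_periodic_buc (E : NormedModule R_AbsRing) r (f : ('I_r -> R) -> E) :
  (forall x, @continuous (vec r) E f x) -> periodic f -> buc f.
Proof.
move=> Hf Hper; have hp := PI_RGT_0.
have UC : forall e, 0 < e -> exists d, 0 < d /\
    forall x y, (forall i, Rabs (x i - y i) < d) -> norm (minus (f x) (f y)) <= e.
  move=> e he.
  have loc : forall t : 'I_r -> R, exists d : posreal,
      forall y, (forall i, Rabs (y i - t i) < d) -> norm (minus (f y) (f t)) <= e / 2.
    move=> t; have he2 : 0 < e / 2 by lra.
    have [d Hd] := proj1 (filterlim_locally_ball_norm f (f t)) (Hf t) (mkposreal _ he2).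
    by exists d => y hy; apply: Rlt_le; exact: Hd.
  have [delta Hdelta] := choice _ loc.
  (* Half radii: if [x] is within half the radius of [t] and [y] within half the radius of [x], both
     lie in the ball where the local modulus at [t] applies. *)
  have hh (t : Compactness.Tn r R) : 0 < delta (fun_of_tn t) / 2.
    by have := cond_pos (delta (fun_of_tn t)); lra.
  have [d Hd] := compactness_value r (tn_of_fun (fun=> 0)) (tn_of_fun (fun=> 2 * PI))
     (fun t => mkposreal _ (hh t)).
  have UC0 x y : (forall i, 0 <= x i <= 2 * PI) -> (forall i, Rabs (x i - y i) < d) ->
      norm (minus (f x) (f y)) <= e.
    move=> hx hxy.
    have /NNPP [t [_ [ht1 ht2]]] := Hd (tn_of_fun x) (bounded_tn_of_fun hx).
    move: ht1 => /close_fun_of_tn; rewrite tn_of_funK /= => ht1.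
    move: ht2 => /=; set D := delta (fun_of_tn t) in ht1 * => ht2.
    have h1 : norm (minus (f x) (f (fun_of_tn t))) <= e / 2.
      by apply: Hdelta => i; apply: Rlt_trans (ht1 i) _; rewrite -/D; have := cond_pos D; lra.
    have h2 : norm (minus (f y) (f (fun_of_tn t))) <= e / 2.
      apply: Hdelta => i; rewrite -/D.
      have := ht1 i; have := hxy i; rewrite Rabs_minus_sym => h3 h4.
      have := Rabs_triang (y i - x i) (x i - fun_of_tn t i).
      replace (y i - x i + _) with (y i - fun_of_tn t i) by ring. lra.
    replace (minus (f x) (f y)) with
      (plus (minus (f x) (f (fun_of_tn t))) (opp (minus (f y) (f (fun_of_tn t))))) by module_eq.
    apply: Rle_trans; first exact: norm_triangle.
    by rewrite norm_opp; lra.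
  exists d; split; first exact: cond_pos.
  move=> x y hxy; have [k Hk] := period_shift_vec x.
  rewrite -(Hper x k) -(Hper y k); apply: UC0 => // i.
  by replace (_ - _) with (x i - y i) by ring.
split => //.
have [d [hd Hd]] := UC 1 Rlt_0_1.
(* With [N.+1] steps each coordinate moves by less than [d] at a time, so the norm grows by at most
   1 per step. *)
have [N hN] := nfloor_ex (2 * PI / d) (Rlt_le _ _ (Rdiv_lt_0_compat _ _ (Rmult_lt_0_compat _ _ Rlt_0_2 hp) hd)).
have hN1 : 0 < INR N.+1 by apply: lt_0_INR; lia.
exists (norm (f (fun=> 0)) + INR N.+1); split; first by have := norm_ge_0 (f (fun=> 0)); lra.
move=> x; have [k Hk] := period_shift_vec x.
rewrite -(Hper x k); set y := fun i => _.
have step (j : nat) : norm (f (fun i => INR j / INR N.+1 * y i)) <= norm (f (fun=> 0)) + INR j.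
  elim: j => [|j IH].
    rewrite /= Rplus_0_r; right; congr (norm (f _)).
    by apply: functional_extensionality => i; rewrite /Rdiv !Rmult_0_l.
  set u := fun i => _; set v := fun i => INR j / _ * _ in IH.
  replace (f u) with (plus (minus (f u) (f v)) (f v)) by module_eq.
  apply: Rle_trans; first exact: norm_triangle.
  rewrite S_INR.
  suff : norm (minus (f u) (f v)) <= 1 by lra.
  apply: Hd => i; rewrite /u /v S_INR.
  replace (_ - _) with (y i / INR N.+1) by (field; lra).
  have [h1 h2] := Hk i.
  rewrite Rabs_pos_eq; last by apply: Rmult_le_pos => //; apply: Rlt_le; exact: Rinv_0_lt_compat.
  apply: (Rmult_lt_reg_r (INR N.+1)) => //.
  replace (y i / INR N.+1 * INR N.+1) with (y i) by (field; lra).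
  rewrite S_INR; have h3 : 2 * PI < d * (INR N + 1).
    replace (2 * PI) with (d * (2 * PI / d)) by (field; lra).
    apply: Rmult_lt_compat_l => //. lra.
  by rewrite /y; lra.
have := step N.+1.
have -> // : (fun i => INR N.+1 / INR N.+1 * y i) = y.
by apply: functional_extensionality => i; field; lra.
Qed.

(** * Fejer means and Fourier expansions *)

Section LatticeSums.

Variable r : nat.
Notation index := {ffun 'I_r -> Z}.

Definition index_diff N (J L : {ffun 'I_r -> 'I_N}) : index :=
  [ffun i => (Z.of_nat (J i) - Z.of_nat (L i))%Z].

Definition in_box (n : nat) (al : index) : bool := [forall i, Z.leb (Z.abs (al i)) (Z.of_nat n)].

(** Listing the box as [n - L], with [L] in a finite function type, makes it an injective image of
    an enumeration, like the rows of differences [J - L] with which it is compared. *)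
Definition box (n : nat) : seq index :=
  [seq [ffun i => (Z.of_nat n - Z.of_nat (L i))%Z] | L : {ffun 'I_r -> 'I_(2 * n).+1}].

Lemma in_boxP n (al : index) :
  reflect (forall i, (- Z.of_nat n <= al i <= Z.of_nat n)%Z) (in_box n al).
Proof.
apply: (iffP forallP) => H i; have := H i; first by move=> /Z.leb_le; lia.
by move=> h; apply/Z.leb_le; lia.
Qed.

Lemma uniq_index_diff N (J : {ffun 'I_r -> 'I_N}) :
  uniq [seq index_diff J L | L : {ffun 'I_r -> 'I_N}].
Proof.
rewrite map_inj_uniq ?enum_uniq // => L L' /ffunP H; apply/ffunP => i; apply: val_inj => /=.
by have := H i; rewrite !ffunE; lia.
Qed.

Lemma uniq_box n : uniq (box n).
Proof.
rewrite map_inj_uniq ?enum_uniq // => L L' /ffunP H; apply/ffunP => i; apply: val_inj => /=.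
by have := H i; rewrite !ffunE; lia.
Qed.

Lemma mem_box n al : (al \in box n) = in_box n al.
Proof.
apply/idP/in_boxP => [/mapP [L _ -> i]|H].
  by rewrite ffunE; move: (nat_of_ord (L i)) (ltn_ord (L i)) => l; lia.
have Hi i : (Z.to_nat (Z.of_nat n - al i) < (2 * n).+1)%N by move: (al i) (H i) => z; lia.
apply/mapP; exists [ffun i => Ordinal (Hi i)]; first by rewrite mem_enum.
by apply/ffunP => i; rewrite !ffunE /= Z2Nat.id; move: (al i) (H i) => z; lia.
Qed.

Definition interior N (n : nat) : pred 'I_N := [pred j : 'I_N | n <= j < N - n]%N.

Lemma card_interior N n : (2 * n <= N)%N -> (N - 2 * n <= #|@interior N n|)%N.
Proof.
move=> hN.
have Hf (j : 'I_(N - 2 * n)) : (n + j < N)%N.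
  by have := ltn_ord j; lia.
pose f j := Ordinal (Hf j).
have finj : injective f by move=> j j' /(congr1 val) /= /addnI /val_inj.
rewrite -[X in (X <= _)%N]card_ord -(card_codom finj); apply: subset_leq_card.
apply/subsetP => _ /codomP [j ->]; rewrite inE /= leq_addr /=.
by have := ltn_ord j; lia.
Qed.

Lemma box_sub_index_diff N n (J : {ffun 'I_r -> 'I_N}) al :
  J \in ffun_on (@interior N n) -> in_box n al ->
  al \in [seq index_diff J L | L : {ffun 'I_r -> 'I_N}].
Proof.
move=> /ffun_onP HJ /in_boxP Hal.
have Hi i : (Z.to_nat (Z.of_nat (J i) - al i) < N)%N.
  by have := HJ i; rewrite inE; move: (nat_of_ord (J i)) (al i) (Hal i) => l z; lia.
apply/mapP; exists [ffun i => Ordinal (Hi i)]; first by rewrite mem_enum.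
by apply/ffunP => i; rewrite !ffunE /= Z2Nat.id; have := HJ i; rewrite inE;
  move: (nat_of_ord (J i)) (al i) (Hal i) => l z; lia.
Qed.

Lemma bernoulli_le (x : R) (m : nat) : 0 <= x <= 1 -> 1 - INR m * x <= (1 - x) ^ m.
Proof.
move=> hx; elim: m => [|m IH]; first by rewrite /=; lra.
rewrite S_INR -tech_pow_Rmult; have h0 := pos_INR m.
apply: (Rle_trans _ ((1 - x) * (1 - INR m * x))); first by nra.
by apply: Rmult_le_compat_l; lra.
Qed.

Section Averages.

Variables (E : NormedModule R_AbsRing) (A : index -> E) (w : index -> R) (W : R).
Hypothesis norm_A : forall al, norm (A al) <= w al.
Hypothesis sum_w : forall s, uniq s -> \big[Rplus/0]_(al <- s) w al <= W.

(* If every coordinate of [J] is at distance at least [n] from both ends of the range,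
   the differences [J - L] cover the box of radius [n]; such [J] are in overwhelming
   majority as [N] grows. *)
Lemma lattice_average (n N : nat) (tau : R) : (0 < N)%N -> (2 * n <= N)%N ->
  (forall s, uniq s -> {in s, forall al, ~~ in_box n al} -> \big[Rplus/0]_(al <- s) w al <= tau) ->
  norm (minus (\big[plus/zero]_(J : {ffun 'I_r -> 'I_N}) \big[plus/zero]_(L : {ffun 'I_r -> 'I_N})
                A (index_diff J L))
              (scal (INR N ^ r) (\big[plus/zero]_(al <- box n) A al)))
  <= INR N ^ r * (tau + 2 * W * (INR r * (2 * INR n / INR N))).
Proof.
move=> hN0 hN Htau.
have hNR : 0 < INR N by apply: lt_0_INR; apply/ltP.
have w0 al : 0 <= w al by apply: Rle_trans (norm_A al); exact: norm_ge_0.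
have W0 : 0 <= W by have := sum_w (s := [::]) isT; rewrite big_nil.
have tau0 : 0 <= tau by have := Htau [::] isT; rewrite big_nil => H; exact: H.
set F := \big[plus/zero]_(al <- box n) A al.
have normF s : uniq s -> norm (\big[plus/zero]_(al <- s) A al) <= W.
  by move=> hs; apply: Rle_trans; [exact: norm_sum_le|exact: sum_w].
(* For an interior [J] the row of differences contains the whole box, so only indices outside the
   box remain; any other row is bounded trivially by [W] against [W]. *)
have inner (J : {ffun 'I_r -> 'I_N}) :
  norm (minus (\big[plus/zero]_(L : {ffun 'I_r -> 'I_N}) A (index_diff J L)) F)
  <= tau + (if J \in ffun_on (@interior N n) then 0 else 2 * W).
  have -> : \big[plus/zero]_(L : {ffun 'I_r -> 'I_N}) A (index_diff J L)
    = \big[plus/zero]_(al <- [seq index_diff J L | L : {ffun 'I_r -> 'I_N}]) A al.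
    by rewrite big_map big_enum.
  set s := [seq _ | L : _].
  have us : uniq s by exact: uniq_index_diff.
  case: ifP => [HJ|_]; last first.
    apply: Rle_trans; first exact: norm_triangle.
    apply: (Rle_trans _ (W + W)); last by lra.
    by rewrite norm_opp; apply: Rplus_le_compat; apply: normF => //; exact: uniq_box.
  rewrite (bigID (in_box n)) /=.
  have -> : \big[plus/zero]_(al <- s | in_box n al) A al = F.
    rewrite -big_filter; apply: perm_big; apply: uniq_perm; rewrite ?filter_uniq ?uniq_box //.
    move=> al; rewrite mem_filter mem_box andbC; case: (boolP (in_box n al)) => h.
      by rewrite (box_sub_index_diff HJ h).
    by rewrite andbF.
  set T := \big[plus/zero]_(al <- s | ~~ in_box n al) A al.
  replace (minus (plus F T) F) with T by module_eq.
  rewrite Rplus_0_r /T -big_filter; apply: Rle_trans; first exact: norm_sum_le.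
  by apply: Htau; [exact: filter_uniq|move=> al; rewrite mem_filter => /andP []].
have cardJ : INR #|{ffun 'I_r -> 'I_N}| = INR N ^ r.
  by rewrite card_ffun !card_ord; elim: r => [|m IH] //=; rewrite expnS mult_INR IH.
have -> : scal (INR N ^ r) F = \big[plus/zero]_(J : {ffun 'I_r -> 'I_N}) F.
  rewrite -cardJ big_const; elim: #|_| => [|m IH]; first by rewrite /= (scal_zero_l F).
  by rewrite iterS -IH S_INR; module_eq.
have -> : forall (G H : {ffun 'I_r -> 'I_N} -> E),
    minus (\big[plus/zero]_J G J) (\big[plus/zero]_J H J) = \big[plus/zero]_J minus (G J) (H J).
  move=> G H; rewrite /minus (big_morph (@opp E) (@opp_plus E) (@opp_zero E)).
  by rewrite big_split.
apply: Rle_trans; first by apply: norm_sum_le => J _; exact: inner.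
rewrite big_split /= Rsum_const cardJ.
set S := ffun_on (@interior N n) : {pred {ffun 'I_r -> 'I_N}}.
have Hsum : \big[Rplus/0]_(J : {ffun 'I_r -> 'I_N}) (if J \in S then 0 else 2 * W)
   + INR #|S| * (2 * W) = INR N ^ r * (2 * W).
  rewrite -cardJ -Rsum_const [X in _ + X]big_mkcond -big_split -Rsum_const /=.
  by apply: eq_bigr => J _; case: ifP => _ /=; ring.
(* There are at least [(N - 2 n) ^ r] interior [J], and Bernoulli's inequality bounds this
   proportion from below. *)
have cardS : INR N ^ r * (1 - INR r * (2 * INR n / INR N)) <= INR #|S|.
  have h2n : 0 <= 2 * INR n / INR N <= 1.
    have h0 := pos_INR n.
    split; first by apply: Rmult_le_pos; [lra|apply: Rlt_le; exact: Rinv_0_lt_compat].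
    apply: (Rmult_le_reg_r (INR N)) => //.
    replace (2 * INR n / INR N * INR N) with (2 * INR n) by (field; lra).
    by have := le_INR (2 * n) N; rewrite mult_INR /= => H; have := H ltac:(lia); lra.
  apply: Rle_trans.
    by apply: Rmult_le_compat_l (bernoulli_le r h2n); apply: pow_le; lra.
  rewrite -Rpow_mult_distr /S card_ffun_on card_ord.
  have -> : INR N * (1 - 2 * INR n / INR N) = INR (N - 2 * n).
    by rewrite minus_INR; [rewrite mult_INR /=; field; lra|lia].
  have -> : forall m k : nat, INR (m ^ k)%N = INR m ^ k.
    by move=> m; elim=> [|k IH] //=; rewrite expnS mult_INR IH.
  by apply: pow_incr; split; [exact: pos_INR|apply: le_INR; apply/leP; exact: card_interior].
have : (INR N ^ r * (1 - INR r * (2 * INR n / INR N))) * (2 * W) <= INR #|S| * (2 * W).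
  by apply: Rmult_le_compat_r => //; lra.
set T := \big[Rplus/0]_J (if _ then _ else _) in Hsum *.
by set u := INR r * _; lra.
Qed.

End Averages.
End LatticeSums.

(** * The Fejer kernel and its moments *)

Section FejerKernel.

Variable r : nat.
Notation index := {ffun 'I_r -> Z}.

(* Up to the factor [N ^ r] this is the Fejer kernel: it equals [|sum_J exp (i J.y)|^2],
   which is why it is nonnegative. *)
Definition fejer N (y : 'I_r -> R) : R :=
  \big[Rplus/0]_(J : {ffun 'I_r -> 'I_N}) \big[Rplus/0]_(L : {ffun 'I_r -> 'I_N})
    cos (dot (index_diff J L) y).

Lemma dot_index_diff N (J L : {ffun 'I_r -> 'I_N}) (y : 'I_r -> R) :
  dot (index_diff J L) y = dot (fun i => Z.of_nat (J i)) y - dot (fun i => Z.of_nat (L i)) y.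
Proof.
rewrite /Rminus -dot_opp -dot_plus; apply: eq_bigr => i _; rewrite ffunE.
by rewrite Z.add_opp_r.
Qed.

Lemma fejer_ge0 N (y : 'I_r -> R) : 0 <= fejer N y.
Proof.
set u := fun J : {ffun 'I_r -> 'I_N} => dot (fun i => Z.of_nat (J i)) y.
have -> : fejer N y = (\big[Rplus/0]_J cos (u J)) * (\big[Rplus/0]_J cos (u J))
    + (\big[Rplus/0]_J sin (u J)) * (\big[Rplus/0]_J sin (u J)).
  rewrite -!Rsum_mulr -big_split; apply: eq_bigr => J _ /=.
  rewrite !(Rmult_comm _ (\big[_/_]_J _)) -!Rsum_mulr -big_split; apply: eq_bigr => L _ /=.
  by rewrite dot_index_diff cos_minus -/(u J) -/(u L); ring.
set A := bigop _ _ _; set B := \big[Rplus/0]_J _; nra.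
Qed.

Lemma buc_cos_minus (al : 'I_r -> Z) (phi : R) :
  buc (E := R_NormedModule) (fun x => cos (phi - dot al x)).
Proof.
have := buc_cos (fun i => - al i)%Z phi; congr buc.
by apply: functional_extensionality => x; rewrite dot_opp; f_equal; ring.
Qed.

Lemma fejerE N (th x : 'I_r -> R) : fejer N (fun i => th i - x i) =
  \big[Rplus/0]_(J : {ffun 'I_r -> 'I_N}) \big[Rplus/0]_(L : {ffun 'I_r -> 'I_N})
    cos (dot (index_diff J L) th - dot (index_diff J L) x).
Proof. by apply: eq_bigr => J _; apply: eq_bigr => L _; rewrite dot_minus_r. Qed.

Lemma buc_fejer N (th : 'I_r -> R) :
  buc (E := R_NormedModule) (fun x => fejer N (fun i => th i - x i)).
Proof.
have : buc (E := R_NormedModule) (fun x => \big[plus/zero]_(J : {ffun 'I_r -> 'I_N})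
   \big[plus/zero]_(L : {ffun 'I_r -> 'I_N})
    (cos (dot (index_diff J L) th - dot (index_diff J L) x) : R_NormedModule)).
  by apply: buc_sum => J; apply: buc_sum => L; exact: buc_cos_minus.
by congr buc; apply: functional_extensionality => x; rewrite fejerE.
Qed.

Lemma scal_sum_l (E : ModuleSpace R_Ring) (I : finType) (F : I -> R) (v : E) :
  scal (\big[Rplus/0]_i F i) v = \big[plus/zero]_i scal (F i) v.
Proof.
apply: (big_morph (fun k : R => scal k v)) => [x y|]; first exact: scal_distr_r.
exact: scal_zero_l.
Qed.

Lemma cube_fejer (E : CompleteNormedModule R_AbsRing) N (th : 'I_r -> R) (f : ('I_r -> R) -> E) :
  buc f ->
  cube_integral (fun x => scal (fejer N (fun i => th i - x i)) (f x)) =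
  \big[plus/zero]_(J : {ffun 'I_r -> 'I_N}) \big[plus/zero]_(L : {ffun 'I_r -> 'I_N})
    cube_integral (fun x => scal (cos (dot (index_diff J L) th - dot (index_diff J L) x)) (f x)).
Proof.
move=> Hf.
have H J L : buc (fun x => scal (cos (dot (@index_diff r N J L) th - dot (index_diff J L) x)) (f x)).
  by apply: buc_scal => //; exact: buc_cos_minus.
transitivity (cube_integral (fun x => \big[plus/zero]_(J : {ffun 'I_r -> 'I_N})
  \big[plus/zero]_(L : {ffun 'I_r -> 'I_N})
     scal (cos (dot (index_diff J L) th - dot (index_diff J L) x)) (f x))).
  congr cube_integral; apply: functional_extensionality => x.
  by rewrite fejerE scal_sum_l; apply: eq_bigr => J _; rewrite scal_sum_l.
rewrite cube_sum; last by move=> J; apply: buc_sum.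
by apply: eq_bigr => J _; rewrite cube_sum.
Qed.

Lemma cube_cos_minus (al : 'I_r -> Z) (phi : R) :
  cube_integral (fun x => cos (phi - dot al x) : R_CompleteNormedModule)
  = (if is_zero_index al then (2 * PI) ^ r * cos phi else 0).
Proof.
have -> : is_zero_index al = is_zero_index (fun i => - al i)%Z.
  by apply: eq_forallb => i; lia.
rewrite -cube_cos; congr cube_integral; apply: functional_extensionality => x.
by rewrite dot_opp; f_equal; ring.
Qed.

(** Only the diagonal pairs [J = L] survive the integration, and there are [N ^ r] of them. *)
Lemma cube_fejer1 N (th : 'I_r -> R) :
  cube_integral (fun x => fejer N (fun i => th i - x i) : R_CompleteNormedModule)
  = INR N ^ r * (2 * PI) ^ r.
Proof.
transitivity (cube_integral (fun x : 'I_r -> R =>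
    scal (fejer N (fun i => th i - x i)) (1 : R_CompleteNormedModule))).
  by congr cube_integral; apply: functional_extensionality => x; rewrite /scal /= /mult /= Rmult_1_r.
rewrite cube_fejer; last exact: buc_const.
transitivity (\big[Rplus/0]_(J : {ffun 'I_r -> 'I_N}) (2 * PI) ^ r).
  apply: eq_bigr => J _.
  transitivity (\big[Rplus/0]_(L : {ffun 'I_r -> 'I_N}) (if L == J then (2 * PI) ^ r else 0)).
    apply: eq_bigr => L _.
    transitivity (cube_integral (fun x =>
       cos (dot (index_diff J L) th - dot (index_diff J L) x) : R_CompleteNormedModule)).
      by congr cube_integral; apply: functional_extensionality => x; rewrite /scal /= /mult /= Rmult_1_r.
    rewrite cube_cos_minus.
    have -> : is_zero_index (index_diff J L) = (L == J).
      apply/forallP/eqP => [H|-> i]; last by rewrite ffunE Z.sub_diag.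
      apply/ffunP => i; apply: val_inj => /=.
      by have := H i; rewrite ffunE; move: (nat_of_ord (J i)) (nat_of_ord (L i)) => k l; lia.
    case: eqP => [->|] //.
    suff -> : dot (index_diff J J) th = 0 by rewrite cos_0 Rmult_1_r.
    by rewrite dot_index_diff Rminus_diag.
  by rewrite -big_mkcond big_pred1_eq.
rewrite Rsum_const card_ffun !card_ord; congr (_ * _).
by elim: r => [|m IH] //=; rewrite expnS mult_INR IH.
Qed.

Definition unit_index (z : Z) (i : 'I_r) : index := [ffun j => if j == i then z else 0%Z].

Lemma dot_unit_index z i (x : 'I_r -> R) : dot (unit_index z i) x = IZR z * x i.
Proof.
rewrite /dot (bigD1 i) //= ffunE eqxx big1 ?Rplus_0_r // => j /negbTE h.
by rewrite ffunE h Rmult_0_l.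
Qed.

(** By the product formula for cosines, the mean over the cube of the cosine of [al.(th - x)] times
    the cosine of [x i - th i] is the sum of these weights for [be] equal to plus and minus the
    [i]-th unit index. *)
Let half_at (be al : index) : R := if al == be then 1 / 2 else 0.

Lemma buc_cos_half z i (al : index) (th : 'I_r -> R) :
  buc (E := R_NormedModule)
    (fun x => 1 / 2 * cos ((dot al th - IZR z * th i) - (dot al x - IZR z * x i))).
Proof.
have := buc_scal (buc_const r (1 / 2 : R_NormedModule))
  (buc_cos_minus (fun j => al j + - unit_index z i j)%Z (dot al th - IZR z * th i)).
by congr buc; apply: functional_extensionality => x; rewrite dot_plus dot_opp dot_unit_index.
Qed.

Lemma cube_cos_half z i (al : index) (th : 'I_r -> R) :
  cube_integral (fun x => 1 / 2 * cos ((dot al th - IZR z * th i) - (dot al x - IZR z * x i))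
    : R_CompleteNormedModule)
  = (2 * PI) ^ r * half_at (unit_index z i) al.
Proof.
transitivity (1 / 2 * cube_integral (fun x =>
    cos ((dot al th - IZR z * th i) - dot (fun j => al j + - unit_index z i j)%Z x)
    : R_CompleteNormedModule)).
  set g := fun x => cos _; transitivity (cube_integral (fun x => scal (1 / 2) (g x)
     : R_CompleteNormedModule)); last by apply: cube_scal; exact: buc_cos_minus.
  congr cube_integral; apply: functional_extensionality => x.
  by rewrite /g dot_plus dot_opp dot_unit_index.
rewrite cube_cos_minus /half_at.
have -> : is_zero_index (fun j => al j + - unit_index z i j)%Z = (al == unit_index z i).
  apply/forallP/eqP => [H|-> j]; last by rewrite Z.add_opp_diag_r.
  by apply/ffunP => j; have /Z.eqb_eq := H j; move: (al j) (unit_index z i j) => u v; lia.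
case: eqP => [->|_]; last by rewrite !Rmult_0_r.
by rewrite dot_unit_index Rminus_diag cos_0 Rmult_1_r Rmult_comm.
Qed.

Lemma sum_half_at (be : index) s : uniq s ->
  \big[Rplus/0]_(al <- s) half_at be al = if be \in s then 1 / 2 else 0.
Proof.
move=> us; case: ifP => h.
  rewrite (bigD1_seq be) //= /half_at eqxx big1 ?Rplus_0_r // => al /negbTE ->//.
rewrite big_seq big1 // => al hal; rewrite /half_at; case: eqP => // E.
by rewrite -E hal in h.
Qed.

(** The trigonometric moment in Korovkin's argument. It counts, with weight one half, the pairs
    whose difference is plus or minus a unit index; instead of an exact count, the comparison of
    lattice averages is applied to the weights themselves. *)
Lemma cube_fejer_cos N (th : 'I_r -> R) (i : 'I_r) : (2 <= N)%N ->
  INR N ^ r * (2 * PI) ^ r * (1 - 4 * INR r / INR N) <=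
  cube_integral (fun x => fejer N (fun j => th j - x j) * cos (x i - th i)
     : R_CompleteNormedModule).
Proof.
move=> hN; have hNR : 0 < INR N by apply: lt_0_INR; lia.
have hP : 0 < (2 * PI) ^ r by apply: pow_lt; have := PI_RGT_0; lra.
pose c (al : index) : R := half_at (unit_index 1 i) al + half_at (unit_index (-1) i) al.
have bc : buc (E := R_NormedModule) (fun x : 'I_r -> R => cos (x i - th i)).
  have := buc_cos (unit_index 1 i) (- th i); congr buc.
  by apply: functional_extensionality => x; rewrite dot_unit_index; f_equal; ring.
have -> : cube_integral (fun x => fejer N (fun j => th j - x j) * cos (x i - th i)
     : R_CompleteNormedModule) = (2 * PI) ^ r *
   \big[plus/zero]_(J : {ffun 'I_r -> 'I_N}) \big[plus/zero]_(L : {ffun 'I_r -> 'I_N})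
      (c (index_diff J L) : R_NormedModule).
  transitivity (cube_integral (fun x => scal (fejer N (fun j => th j - x j))
     (cos (x i - th i) : R_CompleteNormedModule))) => //.
  rewrite cube_fejer // Rmult_comm -[in RHS]Rsum_mulr; apply: eq_bigr => J _.
  rewrite -Rsum_mulr; apply: eq_bigr => L _; set al := index_diff J L.
  rewrite /c Rmult_plus_distr_r !(Rmult_comm (half_at _ _)) -!(cube_cos_half _ _ _ th).
  set g1 := fun x => 1 / 2 * _; set g2 := fun x => 1 / 2 * cos (_ - -1 * _ - _).
  transitivity (cube_integral (fun x => plus (g1 x) (g2 x) : R_CompleteNormedModule));
    last by apply: cube_plus; exact: buc_cos_half.
  congr cube_integral; apply: functional_extensionality => x.
  rewrite /g1 /g2 /scal /plus /= /mult /=.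
  replace (dot al th - 1 * th i - (dot al x - 1 * x i)) with
      ((dot al th - dot al x) + (x i - th i)) by ring.
  replace (dot al th - -1 * th i - (dot al x - -1 * x i)) with
      ((dot al th - dot al x) - (x i - th i)) by ring.
  by move: (_ - dot al x) (x i - th i) => u v; rewrite cos_plus cos_minus; field.
have w0 al : norm (c al : R_NormedModule) <= c al.
  right; apply: Rabs_pos_eq; rewrite /c /half_at.
  by case: eqP => _; case: eqP => _; lra.
have sumc s : uniq s -> \big[Rplus/0]_(al <- s) c al <= 1.
  move=> us; rewrite big_split /= !sum_half_at //.
  by case: ifP => _; case: ifP => _; lra.
have Hb z : (Z.abs z <= 1)%Z -> in_box 1 (unit_index z i).
  by move=> hz; apply/in_boxP => j; rewrite ffunE; case: eqP => _; lia.
(* The weights have total mass 1 and live in the box of radius 1, so the tail is 0 and the error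
   [2 W r (2 n / N)] becomes [4 r / N]. *)
have := @lattice_average r R_NormedModule c c 1 w0 sumc 1 N 0 _ _ _.
have -> : \big[plus/zero]_(al <- box r 1) (c al : R_NormedModule) = 1.
  rewrite -[LHS]/(\big[Rplus/0]_(al <- box r 1) c al).
  rewrite big_split /= !sum_half_at ?uniq_box // !mem_box !Hb //; by lra.
set S := \big[plus/zero]_J _.
move=> H; have {}H := H ltac:(lia) ltac:(lia).
have {}H : Rabs (S - INR N ^ r * 1) <= INR N ^ r * (0 + 2 * 1 * (INR r * (2 * INR 1 / INR N))).
  apply: H => s us hs; rewrite big_split /= !sum_half_at //.
  have h0 z : (Z.abs z <= 1)%Z -> unit_index z i \in s = false.
    by move=> hz; apply/negP => /hs; rewrite Hb.
  by rewrite !h0 //; lra.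
have h1 : INR N ^ r * (1 - 4 * INR r / INR N) <= S.
  have := Rle_abs (- (S - INR N ^ r * 1)); rewrite Rabs_Ropp.
  replace (INR N ^ r * (1 - 4 * INR r / INR N)) with
    (INR N ^ r * 1 - INR N ^ r * (0 + 2 * 1 * (INR r * (2 * INR 1 / INR N))))
    by (rewrite /=; field; lra).
  by move: H; lra.
replace (INR N ^ r * (2 * PI) ^ r * (1 - 4 * INR r / INR N)) with
  ((2 * PI) ^ r * (INR N ^ r * (1 - 4 * INR r / INR N))) by ring.
by apply: Rmult_le_compat_l => //; lra.
Qed.

End FejerKernel.

(** * Convergence of Fejer means *)

(** If all coordinates of [x - th] are, up to periods, below the modulus [d], uniform continuity
    gives [e]. Otherwise one term of the sum is at least [1 - cos d], and [C] is chosen so that this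
    term alone pays for the trivial bound [2 B]. *)
Lemma korovkin_bound (E : NormedModule R_AbsRing) r (f : ('I_r -> R) -> E) (e : R) :
  buc f -> periodic f -> 0 < e -> exists C, 0 <= C /\ forall x th,
    norm (minus (f x) (f th)) <= e + C * \big[Rplus/0]_(i < r) (1 - cos (x i - th i)).
Proof.
move=> [[B [hB HB]] Hf] Hper he; have hp := PI_RGT_0; have hp2 := PI2_3_2.
have [d0 [hd0 Hd0]] := Hf e he.
(* Capping by 1 keeps [d] below [PI], in the range where the cosine decreases. *)
pose d := Rmin d0 1.
have hd : 0 < d by apply: Rmin_pos; lra.
have hd1 : d <= 1 by exact: Rmin_r.
have hcos : cos d < 1 by rewrite -cos_0; apply: cos_decreasing_1; lra.
exists (2 * B / (1 - cos d)); split; first by apply: Rmult_le_pos; [lra|apply: Rlt_le; apply: Rinv_0_lt_compat; lra].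
move=> x th.
have shift : forall i, exists k : Z, - PI <= x i - th i + 2 * PI * IZR k <= PI.
  by move=> i; have [k] := period_shift (- PI) (x i - th i); exists k; lra.
have [k Hk] := choice _ shift.
have cosk i : cos (x i - th i) = cos (Rabs (x i - th i + 2 * PI * IZR (k i))).
  have -> : cos (x i - th i) = cos (x i - th i + 2 * PI * IZR (k i)).
    have [n [hn|hn]] : exists n : nat, (k i = Z.of_nat n \/ k i = - Z.of_nat n)%Z.
      by exists (Z.abs_nat (k i)); lia.
    - rewrite hn -INR_IZR_INZ -[LHS](cos_period _ n); f_equal; ring.
    - rewrite hn opp_IZR -INR_IZR_INZ -[RHS](cos_period _ n); f_equal; ring.
  by rewrite /Rabs; case: Rcase_abs => // _; rewrite cos_neg.
have sum0 : 0 <= \big[Rplus/0]_(i < r) (1 - cos (x i - th i)).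
  by apply: Rsum_ge0 => i _; have := COS_bound (x i - th i); lra.
have [small|/not_all_ex_not [i /Rnot_lt_le big]] :=
  classic (forall i, Rabs (x i - th i + 2 * PI * IZR (k i)) < d).
  have : norm (minus (f x) (f th)) <= e.
    rewrite -(Hper x k); apply: Hd0 => i.
    replace (_ - _) with (x i - th i + 2 * PI * IZR (k i)) by ring.
    by apply: Rlt_le_trans (small i) _; exact: Rmin_l.
  suff : 0 <= 2 * B / (1 - cos d) * \big[Rplus/0]_(i < r) (1 - cos (x i - th i)) by lra.
  apply: Rmult_le_pos => //.
  by apply: Rmult_le_pos; [lra|apply: Rlt_le; apply: Rinv_0_lt_compat; lra].
have hi : 1 - cos d <= 1 - cos (x i - th i).
  rewrite cosk; suff : cos (Rabs (x i - th i + 2 * PI * IZR (k i))) <= cos d by lra.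
  have : Rabs (x i - th i + 2 * PI * IZR (k i)) <= PI by apply: Rabs_le; exact: Hk.
  by move=> h; apply: cos_decr_1; lra.
have hs : 1 - cos d <= \big[Rplus/0]_(i < r) (1 - cos (x i - th i)).
  rewrite (bigD1 i) //=.
  apply: (Rle_trans _ (1 - cos (x i - th i) + 0)); first by lra.
  apply: Rplus_le_compat_l; apply: Rsum_ge0 => j _.
  by have := COS_bound (x j - th j); lra.
apply: (Rle_trans _ (2 * B)).
  by apply: Rle_trans; [exact: norm_triangle|rewrite norm_opp; have := HB x; have := HB th; lra].
set S := \big[Rplus/0]_(i < r) _ in hs *.
suff : 2 * B <= 2 * B / (1 - cos d) * S by lra.
apply: (Rle_trans _ (2 * B / (1 - cos d) * (1 - cos d))); first by right; field; lra.
apply: Rmult_le_compat_l => //.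
by apply: Rmult_le_pos; [lra|apply: Rlt_le; apply: Rinv_0_lt_compat; lra].
Qed.

Section FourierExpansion.

Variables (E : CompleteNormedModule R_AbsRing) (r : nat) (f : ('I_r -> R) -> E).
Hypotheses (f_buc : buc f) (f_per : periodic f).
Notation index := {ffun 'I_r -> Z}.

(** At [phi = dot al th] this is half the sum of the Fourier modes of [f] of indices [al] and [- al]
    at [th], written without complex scalars. Summed over a symmetric box it therefore gives the
    ordinary partial Fourier sum. *)
Definition trig_coef (al : 'I_r -> Z) (phi : R) : E :=
  scal (/ (2 * PI) ^ r) (cube_integral (fun x => scal (cos (phi - dot al x)) (f x))).

Lemma trig_coef_cos_sin (al : 'I_r -> Z) (phi : R) :
  trig_coef al phi = plus (scal (cos phi) (trig_coef al 0)) (scal (sin phi) (trig_coef al (PI / 2))).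
Proof.
have H psi : buc (fun x => scal (cos (psi - dot al x)) (f x)).
  by apply: buc_scal => //; exact: buc_cos_minus.
rewrite /trig_coef.
have -> : (fun x => scal (cos (phi - dot al x)) (f x)) =
   (fun x => plus (scal (cos phi) (scal (cos (0 - dot al x)) (f x)))
                  (scal (sin phi) (scal (cos (PI / 2 - dot al x)) (f x)))).
  apply: functional_extensionality => x.
  rewrite cos_shift Rminus_0_l cos_neg cos_minus; module_eq.
have Hs k psi : buc (fun x => scal k (scal (cos (psi - dot al x)) (f x))).
  by apply: buc_scal => //; exact: (buc_const r (k : R_NormedModule)).
rewrite cube_plus // !cube_scal //; module_eq.
Qed.

(** The double sum is [N ^ r] times the Fejer mean. Its deviation is the integral of [f x - f th]
    against a nonnegative kernel of known mass, to which [korovkin_bound] applies. *)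
Lemma fejer_limit (th : 'I_r -> R) (eta : R) : 0 < eta ->
  exists N0, forall N, (N0 <= N)%N ->
  norm (minus (\big[plus/zero]_(J : {ffun 'I_r -> 'I_N}) \big[plus/zero]_(L : {ffun 'I_r -> 'I_N})
                 trig_coef (index_diff J L) (dot (index_diff J L) th))
              (scal (INR N ^ r) (f th))) <= INR N ^ r * eta.
Proof.
move=> heta; have hp := PI_RGT_0.
have [|C [hC HC]] := korovkin_bound (e := eta / 2) f_buc f_per; first by lra.
have h0 : 0 <= C * INR r * (4 * INR r) by have := pos_INR r => h; repeat apply: Rmult_le_pos; lra.
have [N0 hN0] := nfloor_ex (C * INR r * (4 * INR r) / (eta / 2)) ltac:(apply: Rmult_le_pos; [lra|apply: Rlt_le; apply: Rinv_0_lt_compat; lra]).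
(* One unit passes from the floor to a strict upper bound, and [N >= 2] is required by
   [cube_fejer_cos]. *)
exists (N0.+2) => N hN.
have hNR : 0 < INR N by apply: lt_0_INR; lia.
have hNr : 0 < INR N ^ r by exact: pow_lt.
have hP : 0 < (2 * PI) ^ r by apply: pow_lt; lra.
have hCN : C * INR r * (4 * INR r) / INR N <= eta / 2.
  apply: (Rmult_le_reg_r (INR N)) => //.
  replace (C * INR r * (4 * INR r) / INR N * INR N) with
    (C * INR r * (4 * INR r) / (eta / 2) * (eta / 2)) by (field; lra).
  rewrite [X in _ <= X]Rmult_comm; apply: Rmult_le_compat_r; first lra.
  have : INR N0.+1 <= INR N by apply: le_INR; lia.
  by rewrite S_INR; lra.
pose K x := fejer N (fun i => th i - x i).
have bK : buc (E := R_NormedModule) K by exact: buc_fejer.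
have EK : cube_integral (K : _ -> R_CompleteNormedModule) = INR N ^ r * (2 * PI) ^ r.
  exact: cube_fejer1.
set S := bigop _ _ _.
have ES : S = scal (/ (2 * PI) ^ r) (cube_integral (fun x => scal (K x) (f x))).
  rewrite cube_fejer // (big_morph (scal (/ (2 * PI) ^ r) : E -> E)
    (@scal_distr_l _ E (/ (2 * PI) ^ r)) (@scal_zero_r _ E (/ (2 * PI) ^ r))).
  apply: eq_bigr => J _; rewrite (big_morph (scal (/ (2 * PI) ^ r) : E -> E)
    (@scal_distr_l _ E (/ (2 * PI) ^ r)) (@scal_zero_r _ E (/ (2 * PI) ^ r))).
  by [].
have Econst : cube_integral (fun x => scal (K x) (f th)) = scal (INR N ^ r * (2 * PI) ^ r) (f th).
  rewrite -(cube_fejer1 N th).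
  apply: (cube_linear (E := R_CompleteNormedModule) (L := fun k : R => scal k (f th))) => //.
  exact: is_linear_scal_l.
have bKf : buc (fun x => scal (K x) (f x)) by exact: buc_scal.
have bKc : buc (fun x => scal (K x) (f th)) by apply: buc_scal => //; exact: buc_const.
have -> : minus S (scal (INR N ^ r) (f th)) = scal (/ (2 * PI) ^ r)
   (cube_integral (fun x => scal (K x) (minus (f x) (f th)))).
  have -> : (fun x => scal (K x) (minus (f x) (f th))) =
     (fun x => plus (scal (K x) (f x)) (scal (-1) (scal (K x) (f th)))).
    by apply: functional_extensionality => x; module_eq.
  rewrite cube_plus //; last by apply: buc_scal => //; exact: (buc_const r (-1 : R_NormedModule)).
  rewrite cube_scal // Econst ES; module_eq; field; lra.
(* Korovkin's majorant: its integral against the kernel involves only the mass and the cosine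
   moments. *)
pose g x : R := eta / 2 + C * \big[Rplus/0]_(i < r) (1 - cos (x i - th i)).
pose h i x : R_NormedModule := plus (K x) (scal (-1) (K x * cos (x i - th i))).
have bKcos i : buc (E := R_NormedModule) (fun x => K x * cos (x i - th i)).
  apply: (buc_scal (E := R_NormedModule) bK).
  have := buc_cos (unit_index 1 i) (- th i); congr buc.
  by apply: functional_extensionality => x; rewrite dot_unit_index; f_equal; ring.
have bh i : buc (h i).
  by apply: buc_plus => //; apply: buc_scal => //; exact: (buc_const r (-1 : R_NormedModule)).
have bhs : buc (fun x => \big[plus/zero]_(i < r) h i x) by apply: buc_sum.
have bs (k : R) (u : ('I_r -> R) -> R_NormedModule) : buc u -> buc (fun x => scal k (u x)).
  by move=> bu; apply: buc_scal => //; exact: (buc_const r (k : R_NormedModule)).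
have Kg : (fun x => K x * g x : R_NormedModule) =
   (fun x => plus (scal (eta / 2) (K x : R_NormedModule))
                  (scal C (\big[plus/zero]_(i < r) h i x))).
  apply: functional_extensionality => x.
  have -> : \big[plus/zero]_(i < r) h i x = \big[Rplus/0]_(i < r) (1 - cos (x i - th i)) * K x.
    by rewrite -Rsum_mulr; apply: eq_bigr => i _; rewrite /h /plus /scal /= /mult /=; ring.
  by rewrite /g /plus /scal /= /mult /=; ring.
have bKg : buc (E := R_NormedModule) (fun x => K x * g x).
  by rewrite Kg; apply: buc_plus; exact: bs.
have Hnorm : norm (cube_integral (fun x => scal (K x) (minus (f x) (f th)))) <=
    cube_integral (fun x => K x * g x : R_CompleteNormedModule).
  apply: norm_cube_le.
  - by apply: buc_scal => //; exact: buc_plus f_buc (buc_const r (opp (f th))).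
  - exact: bKg.
  - move=> x; apply: Rle_trans; first exact: norm_scal.
    rewrite /abs /= Rabs_pos_eq; last exact: fejer_ge0.
    by apply: Rmult_le_compat_l; [exact: fejer_ge0|exact: HC].
have Hint : cube_integral (fun x => K x * g x : R_CompleteNormedModule) <=
  INR N ^ r * (2 * PI) ^ r * eta.
  rewrite Kg cube_plus; [|exact: bs|exact: bs].
  rewrite !cube_scal // EK cube_sum //.
  have : \big[Rplus/0]_(i < r) (cube_integral (h i) : R_CompleteNormedModule) <=
     INR r * (INR N ^ r * (2 * PI) ^ r * (4 * INR r / INR N)).
    rewrite -[X in INR X]card_ord -Rsum_const; apply: Rsum_le => i _.
    rewrite card_ord /h cube_plus //; last exact: bs.
    rewrite cube_scal // EK.
    have := @cube_fejer_cos r N th i ltac:(lia).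
    rewrite -/K; set I := cube_integral _ => hI; rewrite /plus /scal /= /mult /=.
    by lra.
  rewrite -[\big[Rplus/0]_(i < r) _]/(\big[plus/zero]_(i < r) (cube_integral (h i))).
  set T := \big[plus/zero]_(i < r) _; rewrite /plus /scal /= /mult /=.
  move=> /(Rmult_le_compat_l C _ _ hC) hT.
  have := Rmult_le_compat_l (INR N ^ r * (2 * PI) ^ r) _ _ ltac:(nra) hCN.
  set Q := INR N ^ r * (2 * PI) ^ r in hT *.
  replace (C * (INR r * (Q * (4 * INR r / INR N)))) with (Q * (C * INR r * (4 * INR r) / INR N))
    in hT by (field; lra).
  by lra.
apply: Rle_trans; first exact: norm_scal.
rewrite /abs /= Rabs_pos_eq; last by apply: Rlt_le; exact: Rinv_0_lt_compat.
apply: (Rmult_le_reg_l ((2 * PI) ^ r)) => //.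
rewrite -Rmult_assoc Rinv_r ?Rmult_1_l; last lra.
by apply: Rle_trans; [exact: Hnorm|lra].
Qed.

End FourierExpansion.

Section FourierExpansionBound.

Variables (E : CompleteNormedModule R_AbsRing) (r : nat) (f : ('I_r -> R) -> E).
Hypotheses (f_buc : buc f) (f_per : periodic f).
Variables (w : {ffun 'I_r -> Z} -> R) (W : R).
Hypothesis coef_le : forall (al : {ffun 'I_r -> Z}) phi, norm (trig_coef f al phi) <= w al.
Hypothesis sum_w : forall s, uniq s -> \big[Rplus/0]_(al <- s) w al <= W.

(** Every row of the Fejer double sum runs over distinct indices, hence has norm at most [W]; so
    have the Fejer means, and so has their limit. *)
Lemma fourier_sup_le (th : 'I_r -> R) : norm (f th) <= W.
Proof.
apply: le_epsilon => eta heta.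
have [N0 H] := fejer_limit f_buc f_per th heta.
pose N := N0.+1; have {}H := H N (leqnSn N0).
have hNr : 0 < INR N ^ r by apply: pow_lt; apply: lt_0_INR; lia.
set S := bigop _ _ _ in H.
have hS : norm S <= INR N ^ r * W.
  apply: (Rle_trans _ (\big[Rplus/0]_(J : {ffun 'I_r -> 'I_N}) W)).
    apply: norm_sum_le => J _; apply: Rle_trans; first by apply: norm_sum_le => L _; exact: coef_le.
    by have := sum_w (uniq_index_diff J); rewrite big_map big_enum.
  rewrite Rsum_const card_ffun !card_ord; right; congr (_ * _).
  by elim: r => [|m IH] //=; rewrite expnS mult_INR IH.
apply: (Rmult_le_reg_l (INR N ^ r)) => //.
have -> : INR N ^ r * norm (f th) = norm (scal (INR N ^ r) (f th)).
  by rewrite norm_scal_R Rabs_pos_eq; lra.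
replace (scal (INR N ^ r) (f th)) with (plus S (opp (minus S (scal (INR N ^ r) (f th)))))
  by module_eq.
apply: Rle_trans; first exact: norm_triangle.
by rewrite norm_opp; lra.
Qed.

(** For large [N] one and the same double sum, divided by [N ^ r], is close to [f th] by
    [fejer_limit] and within nearly [tau] of the truncated series by [lattice_average]. *)
Lemma fourier_truncation (n : nat) (tau : R) (th : 'I_r -> R) :
  (forall s, uniq s -> {in s, forall al, ~~ in_box n al} -> \big[Rplus/0]_(al <- s) w al <= tau) ->
  norm (minus (f th) (\big[plus/zero]_(al <- box r n) trig_coef f al (dot al th))) <= tau.
Proof.
move=> Htau; apply: le_epsilon => eta heta.
have W0 : 0 <= W by have := sum_w (s := [::]) isT; rewrite big_nil.
have [|N0 H] := @fejer_limit E r f f_buc f_per th (eta / 2); first lra.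
set B := 2 * W * (INR r * (2 * INR n)).
have hB : 0 <= B by have h1 := pos_INR r; have h2 := pos_INR n; repeat apply: Rmult_le_pos; lra.
have [N1 hN1] := nfloor_ex (B / (eta / 2)) ltac:(apply: Rmult_le_pos; [lra|apply: Rlt_le; apply: Rinv_0_lt_compat; lra]).
(* The three summands serve the convergence of Fejer means, the covering of the box and the
   smallness of the boundary term. *)
pose N := (N0 + 2 * n + N1.+1)%N.
have hNR : 0 < INR N by apply: lt_0_INR; rewrite /N; lia.
have hNr : 0 < INR N ^ r by exact: pow_lt.
have {}H := H N ltac:(rewrite /N; lia).
have H2 := @lattice_average r E (fun al => trig_coef f al (dot al th)) w W
  (fun al => coef_le al _) sum_w n N tau ltac:(rewrite /N; lia) ltac:(rewrite /N; lia) Htau.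
have hBN : 2 * W * (INR r * (2 * INR n / INR N)) <= eta / 2.
  apply: (Rmult_le_reg_r (INR N)) => //.
  replace (2 * W * (INR r * (2 * INR n / INR N)) * INR N) with (B / (eta / 2) * (eta / 2))
    by (rewrite /B; field; lra).
  rewrite [X in _ <= X]Rmult_comm; apply: Rmult_le_compat_r; first lra.
  have : INR N1.+1 <= INR N by apply: le_INR; rewrite /N; lia.
  by rewrite S_INR; lra.
set S := bigop _ _ _ in H H2; set F := bigop _ _ _ in H2 *.
apply: (Rmult_le_reg_l (INR N ^ r)) => //.
have -> : INR N ^ r * norm (minus (f th) F) = norm (scal (INR N ^ r) (minus (f th) F)).
  by rewrite norm_scal_R Rabs_pos_eq; lra.
replace (scal (INR N ^ r) (minus (f th) F)) with
  (plus (minus S (scal (INR N ^ r) F)) (opp (minus S (scal (INR N ^ r) (f th))))) by module_eq.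
apply: Rle_trans; first exact: norm_triangle.
rewrite norm_opp; apply: Rle_trans; first exact: Rplus_le_compat H2 H.
have := Rmult_le_compat_l (INR N ^ r) _ _ ltac:(lra) hBN.
by set X := 2 * W * _; lra.
Qed.

End FourierExpansionBound.

(** * Real modes compared with complex Fourier coefficients *)

Section FourierCoefficients.

Variables (E : operators) (E_laws : operator_laws E).
Let V := realification (opC E).
Let incl (v : E) : V := op_incl v.
Let mulI (v : V) : V := scal (Ci : C_AbsRing) (v : opC E).

Lemma is_linear_incl : is_linear incl.
Proof.
split; [exact: op_incl_plus|exact: op_incl_scal|].
by exists 1; split; [lra|move=> x; rewrite Rmult_1_l; right; exact: norm_op_incl].
Qed.

Lemma is_linear_mulI : is_linear mulI.
Proof.
split.
- by move=> x y; exact: (scal_distr_l (Ci : C_AbsRing) (x : opC E) (y : opC E)).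
- move=> k x; transitivity (scal (mult (Ci : C_AbsRing) (RtoC k)) (x : opC E)).
    exact: (scal_assoc (Ci : C_AbsRing) (RtoC k : C_AbsRing) (x : opC E)).
  transitivity (scal (mult (RtoC k : C_AbsRing) (Ci : C_AbsRing)) (x : opC E)).
    by apply: (f_equal (fun z : C_AbsRing => scal z (x : opC E))); exact: Cmult_comm.
  by symmetry; exact: (scal_assoc (RtoC k : C_AbsRing) (Ci : C_AbsRing) (x : opC E)).
- exists 1; split; first lra.
  move=> x; apply: Rle_trans; first exact: (norm_scal (Ci : C_AbsRing) (x : opC E)).
  apply: Rmult_le_compat_r; first exact: norm_ge_0.
  right; rewrite /abs /= /Cmod /=; replace (_ + _) with 1 by ring; exact: sqrt_1.
Qed.

Lemma mulIK (v : V) : mulI (mulI v) = opp v.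
Proof.
transitivity (scal (mult (Ci : C_AbsRing) Ci) (v : opC E)).
  exact: (scal_assoc (Ci : C_AbsRing) (Ci : C_AbsRing) (v : opC E)).
transitivity (scal (opp one : C_AbsRing) (v : opC E)); last exact: (scal_opp_one (v : opC E)).
apply: (f_equal (fun z : C_AbsRing => scal z (v : opC E))).
  by apply: injective_projections; rewrite /mult /opp /one /=; ring.
Qed.

Lemma Cscal_real_imag (a b : R) (v : V) :
  scal ((a, b) : C_AbsRing) (v : opC E) = plus (scal a v) (scal b (mulI v)) :> V.
Proof.
transitivity (scal (plus (RtoC a : C_AbsRing) (mult (RtoC b : C_AbsRing) (Ci : C_AbsRing))) (v : opC E)).
  apply: (f_equal (fun z : C_AbsRing => scal z (v : opC E))).
  by apply: injective_projections; rewrite /plus /mult /=; ring.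
transitivity (plus (scal (RtoC a : C_AbsRing) (v : opC E))
   (scal (mult (RtoC b : C_AbsRing) (Ci : C_AbsRing)) (v : opC E))).
  exact: (scal_distr_r (RtoC a : C_AbsRing) (mult (RtoC b : C_AbsRing) (Ci : C_AbsRing)) (v : opC E)).
apply: (f_equal (fun u : V => plus (scal a v) u)); symmetry.
exact: (scal_assoc (RtoC b : C_AbsRing) (Ci : C_AbsRing) (v : opC E)).
Qed.

Variables (r : nat) (f : ('I_r -> R) -> E) (f_buc : buc f).
Let fhat (al : 'I_r -> Z) : V := fourier (fun x => op_incl (f x)) al.

(** The kernel is the cosine minus [i] times the sine of [al.x], and the sine is the cosine of
    [PI / 2 - al.x]. Inclusion and multiplication by [i] are real linear, so they commute with the
    integral. *)
Lemma fourier_trig_coef (al : 'I_r -> Z) :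
  fhat al = minus (incl (trig_coef f al 0)) (mulI (incl (trig_coef f al (PI / 2)))).
Proof.
have HL := is_linear_incl; have HI := is_linear_mulI.
have b phi : buc (fun x => scal (cos (phi - dot al x)) (f x)).
  by apply: buc_scal => //; exact: buc_cos_minus.
have bi phi : buc (fun x => incl (scal (cos (phi - dot al x)) (f x))) by exact: (buc_lin HL).
have bmi phi : buc (fun x => mulI (incl (scal (cos (phi - dot al x)) (f x)))).
  exact: (buc_lin HI).
rewrite /trig_coef !(linear_scal _ HL) (linear_scal _ HI).
rewrite -!(cube_linear HL) // -(cube_linear HI) //.
set g := fun x => mulI _ in bmi *.
transitivity (scal (/ (2 * PI) ^ r) (cube_integral (fun x : 'I_r -> R =>
   plus (incl (scal (cos (0 - dot al x)) (f x))) (scal (-1) (g x))))).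
  apply: (f_equal (fun v : V => scal (/ (2 * PI) ^ r) v)).
  congr cube_integral; apply: functional_extensionality => x.
  rewrite Cscal_real_imag /g cos_shift Rminus_0_l cos_neg !(linear_scal _ HL) (linear_scal _ HI).
  rewrite -/(incl (f x)); module_eq.
rewrite cube_plus //; last by apply: buc_scal; [exact: (buc_const r (-1 : R_NormedModule))|exact: bmi].
rewrite cube_scal; last exact: bmi.
module_eq.
Qed.

Lemma trig_coef_opp (al : 'I_r -> Z) (phi : R) :
  trig_coef f (fun i => - al i)%Z phi = trig_coef f al (- phi).
Proof.
rewrite /trig_coef; congr scal; congr cube_integral; apply: functional_extensionality => x.
by rewrite dot_opp -[in RHS]cos_neg; congr (scal (cos _) _); ring.
Qed.

(** Twice the real mode is the sum of the Fourier coefficients at [al] and [- al] multiplied by the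
    conjugate unimodular numbers of angle [phi] and [- phi]; the inclusion is isometric. *)
Lemma norm_trig_coef_le (al : 'I_r -> Z) (phi : R) :
  norm (trig_coef f al phi)
  <= 1 / 2 * (norm (fourier (fun x => op_incl (f x)) al)
              + norm (fourier (fun x => op_incl (f x)) (fun i => - al i)%Z)).
Proof.
have HL := is_linear_incl; have HI := is_linear_mulI.
set p := trig_coef f al 0; set q := trig_coef f al (PI / 2).
have E1 : scal 2 (incl (trig_coef f al phi)) =
   plus (scal ((cos phi, sin phi) : C_AbsRing) (fhat al : opC E) : V)
        (scal ((cos phi, - sin phi) : C_AbsRing) (fhat (fun i => - al i)%Z : opC E) : V).
  rewrite !Cscal_real_imag !fourier_trig_coef !trig_coef_opp Ropp_0.
  have -> : trig_coef f al (- (PI / 2)) = opp q.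
    rewrite trig_coef_cos_sin // cos_neg sin_neg cos_PI2 sin_PI2 -/p -/q; module_eq.
  rewrite trig_coef_cos_sin // -/p -/q; clearbody p q.
  rewrite !(linear_plus _ HL) !(linear_scal _ HL) (linear_opp _ _ HL) /minus.
  rewrite !(linear_plus _ HI) !(linear_opp _ _ HI) mulIK; module_eq.
have hC u : abs ((cos phi, u) : C_AbsRing) = 1 -> forall v : opC E,
    norm (scal ((cos phi, u) : C_AbsRing) v) <= norm v.
  by move=> hu v; apply: Rle_trans; [exact: norm_scal|rewrite hu; lra].
have hcs : abs ((cos phi, sin phi) : C_AbsRing) = 1.
  rewrite /abs /= /Cmod /=; replace (_ + _) with 1; first exact: sqrt_1.
  by have := sin2_cos2 phi; rewrite /Rsqr; lra.
have hcs' : abs ((cos phi, - sin phi) : C_AbsRing) = 1.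
  rewrite /abs /= /Cmod /=; replace (_ + _) with 1; first exact: sqrt_1.
  by have := sin2_cos2 phi; rewrite /Rsqr; lra.
have h2 : 2 * norm (trig_coef f al phi) = norm (scal 2 (incl (trig_coef f al phi))).
  rewrite [RHS]norm_scal_R Rabs_pos_eq; last lra.
  by congr (_ * _); symmetry; exact: norm_op_incl.
have h3 := norm_triangle (scal ((cos phi, sin phi) : C_AbsRing) (fhat al : opC E))
  (scal ((cos phi, - sin phi) : C_AbsRing) (fhat (fun i => - al i)%Z : opC E)).
have h4 := hC _ hcs (fhat al).
have h5 := hC _ hcs' (fhat (fun i => - al i)%Z).
suff : 2 * norm (trig_coef f al phi) <= norm (fhat al : opC E) + norm (fhat (fun i => - al i)%Z : opC E).
  move=> h; apply: (Rmult_le_reg_l 2); first by lra.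
  by rewrite -Rmult_assoc; replace (2 * (1 / 2)) with 1 by field; rewrite Rmult_1_l; exact: h.
rewrite h2 E1; apply: Rle_trans; first exact: h3.
exact: Rplus_le_compat.
Qed.

End FourierCoefficients.

(** * Quasi-periodic maps with decaying perturbation *)

Section HalfLine.

Variable E : CompleteNormedModule R_AbsRing.

(** Continuity on the half-line, encoded through the extension by the value at 0. Two-sided results
    then apply, and arbitrary values at negative times have no influence. *)
Definition half_cont (f : R -> E) : Prop := forall t, continuous (fun s => f (Rmax 0 s)) t.

Lemma half_cont_ext (f g : R -> E) :
  (forall t, 0 <= t -> f t = g t) -> half_cont f -> half_cont g.
Proof.
move=> H Hf t; apply: continuous_ext (Hf t) => s /=; apply: H; exact: Rmax_l.
Qed.

Lemma continuous_Rmax0 (t : R) : continuous (fun s => Rmax 0 s) t.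
Proof.
apply: (continuous_normP (E := R_NormedModule)) => e he; exists e; split => // y hy.
apply: Rle_trans (Rlt_le _ _ hy); rewrite /norm /= /abs /minus /plus /opp /= -/(Rminus _ _).
have h1 := Rle_abs (y - t); have h2 := Rle_abs (- (y - t)); rewrite Rabs_Ropp in h2.
by apply: Rabs_le; rewrite /Rmax; case: Rle_dec => ?; case: Rle_dec => ?; lra.
Qed.

Lemma half_cont_continuous (f : R -> E) : (forall t, continuous f t) -> half_cont f.
Proof. by move=> H t; apply: (continuous_comp (Rmax 0) f); [exact: continuous_Rmax0|exact: H]. Qed.

Lemma half_cont_const (v : E) : half_cont (fun _ => v).
Proof. by move=> t; exact: continuous_const. Qed.

Lemma half_cont_plus (f g : R -> E) :
  half_cont f -> half_cont g -> half_cont (fun t => plus (f t) (g t)).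
Proof. by move=> Hf Hg t; exact: continuous_plus (Hf t) (Hg t). Qed.

Lemma half_cont_scal (k : R) (f : R -> E) : half_cont f -> half_cont (fun t => scal k (f t)).
Proof. by move=> Hf t; apply: (continuous_scal (fun=> k)); [exact: continuous_const|exact: Hf]. Qed.

Lemma half_cont_minus (f g : R -> E) :
  half_cont f -> half_cont g -> half_cont (fun t => minus (f t) (g t)).
Proof. by move=> Hf Hg t; exact: continuous_minus (Hf t) (Hg t). Qed.

Lemma half_cont_ex_RInt (f : R -> E) (s t : R) : half_cont f -> 0 <= s -> 0 <= t ->
  ex_RInt f s t.
Proof.
move=> Hf hs ht; apply: (ex_RInt_ext (fun u => f (Rmax 0 u))); last first.
  by apply: ex_RInt_continuous => u _; exact: Hf.
move=> u [hu _]; congr f; apply: Rmax_right.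
by apply: Rlt_le; apply: Rle_lt_trans hu; exact: Rmin_glb.
Qed.

Lemma RInt_Rmax0 (f : R -> E) (t : R) : 0 <= t ->
  RInt f 0 t = RInt (fun u => f (Rmax 0 u)) 0 t.
Proof.
move=> ht; apply: RInt_ext => u [hu _]; rewrite Rmin_left // in hu.
by rewrite Rmax_right //; exact: Rlt_le.
Qed.

Lemma is_derive_RInt_Rmax0 (f : R -> E) (t : R) : half_cont f ->
  is_derive (RInt (fun u => f (Rmax 0 u)) 0) t (f (Rmax 0 t)).
Proof.
move=> Hf; apply: (is_derive_RInt (fun u => f (Rmax 0 u)) _ 0); last exact: Hf.
apply: filter_forall => b; apply: RInt_correct; apply: ex_RInt_continuous => u _; exact: Hf.
Qed.

Lemma half_cont_RInt (f : R -> E) : half_cont f -> half_cont (fun t => RInt f 0 t).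
Proof.
move=> Hf; have H : half_cont (RInt (fun u => f (Rmax 0 u)) 0).
  apply: half_cont_continuous => t; apply: ex_derive_continuous.
  by eexists; exact: is_derive_RInt_Rmax0.
by apply: (half_cont_ext _ H) => t ht; rewrite (RInt_Rmax0 f ht).
Qed.

Lemma norm_RInt_half_le (f : R -> E) (B t : R) : half_cont f -> 0 <= t ->
  (forall u, 0 <= u -> norm (f u) <= B) -> norm (RInt f 0 t) <= t * B.
Proof.
move=> Hf ht H; replace t with (t - 0) at 2 by ring.
apply: (norm_RInt_le_const f) => //; first by move=> u [hu _]; exact: H.
by apply: RInt_correct; apply: half_cont_ex_RInt => //; lra.
Qed.

Lemma RInt_half_plus (f g : R -> E) (t : R) : half_cont f -> half_cont g -> 0 <= t ->
  RInt (fun u => plus (f u) (g u)) 0 t = plus (RInt f 0 t) (RInt g 0 t).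
Proof. by move=> Hf Hg ht; apply: RInt_plus; apply: half_cont_ex_RInt => //; lra. Qed.

Lemma RInt_half_scal (k : R) (f : R -> E) (t : R) : half_cont f -> 0 <= t ->
  RInt (fun u => scal k (f u)) 0 t = scal k (RInt f 0 t).
Proof. by move=> Hf ht; apply: RInt_scal; apply: half_cont_ex_RInt => //; lra. Qed.

Lemma RInt_half_minus (f g : R -> E) (t : R) : half_cont f -> half_cont g -> 0 <= t ->
  RInt (fun u => minus (f u) (g u)) 0 t = minus (RInt f 0 t) (RInt g 0 t).
Proof. by move=> Hf Hg ht; apply: RInt_minus; apply: half_cont_ex_RInt => //; lra. Qed.

Lemma RInt_half_ext (f g : R -> E) (t : R) : 0 <= t -> (forall u, 0 <= u -> f u = g u) ->
  RInt f 0 t = RInt g 0 t.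
Proof.
move=> ht H; apply: RInt_ext => u; rewrite Rmin_left // => -[hu _].
by apply: H; exact: Rlt_le.
Qed.

Lemma geometric_dist (u : nat -> E) (C rho : R) : 0 <= C -> 0 < rho < 1 ->
  (forall k, norm (minus (u k.+1) (u k)) <= C * rho ^ k) ->
  forall k j, norm (minus (u (k + j)%N) (u k)) <= C / (1 - rho) * rho ^ k.
Proof.
move=> hC hr H k j.
(* Keeping the exact geometric partial sum makes the induction on [j] go through. *)
suff : norm (minus (u (k + j)%N) (u k)) <= C / (1 - rho) * (rho ^ k - rho ^ (k + j)).
  have : 0 <= C / (1 - rho) * rho ^ (k + j).
    apply: Rmult_le_pos; last by apply: pow_le; lra.
    by apply: Rmult_le_pos => //; apply: Rlt_le; apply: Rinv_0_lt_compat; lra.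
  by lra.
elim: j => [|j IH].
  by rewrite addn0 minus_eq_zero norm_zero Rminus_diag Rmult_0_r; exact: Rle_refl.
rewrite addnS.
replace (minus (u (k + j).+1) (u k)) with
  (plus (minus (u (k + j).+1) (u (k + j)%N)) (minus (u (k + j)%N) (u k))) by module_eq.
apply: Rle_trans; first exact: norm_triangle.
have := H (k + j)%N; rewrite -[rho ^ (k + j).+1]/(rho * rho ^ (k + j)) => h.
replace (C / (1 - rho) * (rho ^ k - rho * rho ^ (k + j))) with
  (C * rho ^ (k + j) + C / (1 - rho) * (rho ^ k - rho ^ (k + j))) by (field; lra).
exact: Rplus_le_compat.
Qed.

Lemma pow_small (C rho e : R) : 0 <= C -> 0 < rho < 1 -> 0 < e ->
  exists N, forall n, (N <= n)%N -> C * rho ^ n <= e.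
Proof.
move=> hC hr he.
have [N HN] := pow_lt_1_zero rho ltac:(rewrite Rabs_pos_eq; lra) (e / (C + 1)) ltac:(apply: Rdiv_lt_0_compat; lra).
exists N => n hn; have := HN n ltac:(lia).
rewrite Rabs_pos_eq; last by apply: pow_le; lra.
move=> h; apply: (Rle_trans _ ((C + 1) * (e / (C + 1)))); last by right; field; lra.
by apply: Rmult_le_compat; [lra|apply: pow_le|lra|]; lra.
Qed.

Lemma geometric_limit (u : nat -> E) (C rho : R) : 0 <= C -> 0 < rho < 1 ->
  (forall k, norm (minus (u k.+1) (u k)) <= C * rho ^ k) ->
  exists l, forall k, norm (minus l (u k)) <= C / (1 - rho) * rho ^ k.
Proof.
move=> hC hr H; have D := geometric_dist hC hr H.
have hC1 : 0 <= C / (1 - rho).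
  by apply: Rmult_le_pos => //; apply: Rlt_le; apply: Rinv_0_lt_compat; lra.
have [l Hl] : exists l, filterlim u eventually (locally l).
  apply/filterlim_locally_cauchy => eps.
  have [N HN] := pow_small hC1 hr (e := eps / 3) ltac:(have := cond_pos eps; lra).
  exists (fun n => (N <= n)%N); split; first by exists N => n hn; apply/leP.
  move=> n m hn hm; apply: norm_compat1.
  apply: Rle_lt_trans; first exact: (norm_minus_triangle (u N)).
  rewrite (norm_minus_sym (u N)).
  apply: (Rle_lt_trans _ (eps / 3 + eps / 3)); last by have := cond_pos eps; lra.
  have h := HN N (leqnn N).
  apply: Rplus_le_compat; apply: Rle_trans h.
  - by have := D N (m - N)%N; rewrite subnKC.
  - by have := D N (n - N)%N; rewrite subnKC.
exists l => k; apply: le_epsilon => e he.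
have [N HN] := proj1 (filterlim_locally_ball_norm u l) Hl (mkposreal e he).
have := HN (k + N)%coq_nat ltac:(lia); rewrite /ball_norm /= => h.
apply: Rle_trans; first exact: (norm_minus_triangle (u (k + N)%coq_nat)).
rewrite (norm_minus_sym l) Rplus_comm; apply: Rplus_le_compat; first exact: D.
exact: Rlt_le.
Qed.

End HalfLine.

(** * Small divisors *)

Lemma abs1_ge1 r (al : 'I_r -> Z) : (exists i, al i <> 0%Z) -> 1 <= abs1 al.
Proof.
move=> [i hi]; rewrite /abs1 (bigD1 i) //=.
apply: (Rle_trans _ (IZR (Z.abs (al i)) + 0)).
  by rewrite Rplus_0_r; apply: IZR_le; lia.
by apply: Rplus_le_compat_l; apply: Rsum_ge0 => j _; rewrite abs_IZR; exact: Rabs_pos.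
Qed.

Lemma abs1_add_le r (al be : 'I_r -> Z) :
  abs1 (fun i => (al i + be i)%Z) <= abs1 al + abs1 be.
Proof.
rewrite /abs1 -big_split; apply: Rsum_le => i _ /=; rewrite -plus_IZR; apply: IZR_le; lia.
Qed.

Lemma abs1_opp r (al : 'I_r -> Z) : abs1 (fun i => (- al i)%Z) = abs1 al.
Proof. by apply: eq_bigr => i _; rewrite Z.abs_opp. Qed.

(** Replaces the real exponent [nu] by a natural number and the size of the index by an upper bound
    [D], so that one polynomial in the degree controls all divisors of a trigonometric
    polynomial. *)
Lemma small_divisor r (omega : 'I_r -> R) : diophantine omega ->
  exists cD p, 0 < cD /\ forall (al : 'I_r -> Z) D, (exists i, al i <> 0%Z) -> abs1 al <= D ->
    dot al omega <> 0 /\ / Rabs (dot al omega) <= (1 + D) ^ p / cD.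
Proof.
move=> [cD [nu [hcD [_ H]]]].
have [p hp] : exists p : nat, nu <= INR p.
  have [p hp] := nfloor_ex (Rmax 0 nu) (Rmax_l _ _).
  by exists p.+1; rewrite S_INR; have := Rmax_r 0 nu; lra.
exists cD, p; split => // al D hal hD.
have h1 := abs1_ge1 hal.
have hpow : Rpower (abs1 al) nu <= (1 + D) ^ p.
  apply: (Rle_trans _ (Rpower (abs1 al) (INR p))).
    case: h1 => [h1|<-]; first exact: Rle_Rpower (Rlt_le _ _ h1) hp.
    by rewrite /Rpower ln_1 !Rmult_0_r; exact: Rle_refl.
  by rewrite Rpower_pow; [apply: pow_incr; lra|lra].
have h0 : 0 < Rpower (abs1 al) nu by exact: exp_pos.
have h2 := H al hal.
have h3 : 0 < cD / Rpower (abs1 al) nu by exact: Rdiv_lt_0_compat.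
split; first by move=> E0; rewrite E0 Rabs_R0 in h2; lra.
apply: (Rle_trans _ (/ (cD / Rpower (abs1 al) nu))); first exact: Rinv_le_contravar.
have -> : / (cD / Rpower (abs1 al) nu) = Rpower (abs1 al) nu / cD by field; lra.
by apply: Rmult_le_compat_r => //; apply: Rlt_le; exact: Rinv_0_lt_compat.
Qed.

(** Each factor [1 + d (k + 2)] is absorbed by moving the rate halfway towards 1, and there are only
    [p] of them. The shift [k.+2] is that of the degree of increments in [approximable]. *)
Lemma poly_geometric (d rho : R) (p : nat) : 0 <= d -> 0 < rho < 1 ->
  exists C sigma, 0 < C /\ rho <= sigma < 1 /\
    forall k, (1 + d * INR k.+2) ^ p * rho ^ k <= C * sigma ^ k.
Proof.
move=> hd; elim: p rho => [|p IH] rho hr.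
  by exists 1, rho; split; [lra|split; [lra|move=> k; rewrite /= !Rmult_1_l; exact: Rle_refl]].
pose tau := (rho + 1) / 2.
have [C [sigma [hC [hs H]]]] := IH tau ltac:(rewrite /tau; lra).
(* Bernoulli: [(tau / rho) ^ k >= 1 + k h] with [h = tau / rho - 1]. *)
pose h := tau / rho - 1.
have hh : 0 < h.
  suff : 1 < tau / rho by rewrite /h; lra.
  apply: (Rmult_lt_reg_r rho); first lra.
  by replace (tau / rho * rho) with tau by (field; lra); rewrite /tau; lra.
have bern k : 1 + INR k * h <= (tau / rho) ^ k.
  elim: k => [|k IHk]; first by rewrite /=; lra.
  rewrite S_INR -tech_pow_Rmult; have hk := pos_INR k.
  have -> : tau / rho = 1 + h by rewrite /h; ring.
  have -> : (1 + h) ^ k = (tau / rho) ^ k by congr pow; rewrite /h; ring.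
  by nra.
(* Chosen so that [1 + d (k + 2) <= C1 (1 + k h)]: the part [d / h] pays for [d k], the rest for the
   constant terms. *)
pose C1 := 1 + 2 * d + d / h.
have hC1 : 0 < C1.
  have : 0 <= d / h by apply: Rmult_le_pos => //; apply: Rlt_le; exact: Rinv_0_lt_compat.
  by rewrite /C1; lra.
exists (C1 * C), sigma; split; first exact: Rmult_lt_0_compat.
split; first by rewrite /tau in hs; lra.
move=> k.
have step : (1 + d * INR k.+2) * rho ^ k <= C1 * tau ^ k.
  have -> : tau ^ k = (tau / rho) ^ k * rho ^ k.
    by rewrite -Rpow_mult_distr; congr pow; field; lra.
  rewrite -Rmult_assoc; apply: Rmult_le_compat_r; first by apply: pow_le; lra.
  apply: (Rle_trans _ (C1 * (1 + INR k * h))); last by apply: Rmult_le_compat_l; [lra|exact: bern].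
  rewrite !S_INR; have hk := pos_INR k.
  have e1 : d / h * h = d by field; lra.
  have e2 : 0 <= d / h by apply: Rmult_le_pos => //; apply: Rlt_le; exact: Rinv_0_lt_compat.
  rewrite /C1; replace ((1 + 2 * d + d / h) * (1 + INR k * h)) with
    (1 + 2 * d + d / h + (1 + 2 * d) * (INR k * h) + INR k * (d / h * h)) by ring.
  rewrite e1; have : 0 <= (1 + 2 * d) * (INR k * h).
    by apply: Rmult_le_pos; [lra|apply: Rmult_le_pos; lra].
  by lra.
have hpos : 0 <= (1 + d * INR k.+2) ^ p.
  by apply: pow_le; have := Rmult_le_pos _ _ hd (pos_INR k.+2); lra.
rewrite -tech_pow_Rmult.
have h1 := Rmult_le_compat_l _ _ _ hpos step.
have h2 := Rmult_le_compat_l C1 _ _ (Rlt_le _ _ hC1) (H k).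
by move: h1 h2; set X := (1 + _) ^ p; lra.
Qed.

(** * Trigonometric polynomials with a decaying part *)

Section TrigFlat.

Variables (E : CompleteNormedModule R_AbsRing) (r : nat) (omega : 'I_r -> R).

(* On the half-line, [T] is a trigonometric polynomial of degree at most [D] with
   frequencies in [Z^r . omega] plus an exponentially decaying map, of total size at
   most [s]. *)
Inductive trig_flat (D : R) : R -> (R -> E) -> Prop :=
  | trig_flat_mode al phi P : abs1 al <= D ->
      trig_flat D (norm P) (fun t => scal (cos (dot al omega * t + phi)) P)
  | trig_flat_decay s b : half_cont b -> (forall t, 0 <= t -> norm (b t) <= s * exp (- t)) ->
      trig_flat D s b
  | trig_flat_plus s1 s2 T1 T2 : trig_flat D s1 T1 -> trig_flat D s2 T2 ->
      trig_flat D (s1 + s2) (fun t => plus (T1 t) (T2 t))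
  | trig_flat_weaken s1 s2 T1 T2 : trig_flat D s1 T1 -> s1 <= s2 ->
      (forall t, 0 <= t -> T1 t = T2 t) -> trig_flat D s2 T2.

Lemma trig_flat_ge0 D s T : trig_flat D s T -> 0 <= s.
Proof.
elim=> {s T} [al phi P _|s b _ H|s1 s2 T1 T2 _ h1 _ h2|s1 s2 T1 T2 _ h1 h2 _]; try lra.
- exact: norm_ge_0.
- have := H 0 (Rle_refl 0); rewrite Ropp_0 exp_0 Rmult_1_r.
  by have := norm_ge_0 (b 0); lra.
Qed.

Lemma trig_flat_degree D D' s T : D <= D' -> trig_flat D s T -> trig_flat D' s T.
Proof.
move=> hD; elim=> {s T} [al phi P h|s b hb H|s1 s2 T1 T2 _ h1 _ h2|s1 s2 T1 T2 _ h1 h2 H].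
- by apply: trig_flat_mode; lra.
- exact: trig_flat_decay.
- exact: trig_flat_plus.
- exact: trig_flat_weaken h1 h2 H.
Qed.

Lemma exp_opp_le1 (t : R) : 0 <= t -> exp (- t) <= 1.
Proof.
move=> ht; rewrite -exp_0; case: ht => [ht|<-]; last by rewrite Ropp_0; exact: Rle_refl.
by apply: Rlt_le; apply: exp_increasing; lra.
Qed.

Lemma trig_flat_bound D s T : trig_flat D s T -> forall t, 0 <= t -> norm (T t) <= s.
Proof.
elim=> {s T} [al phi P _|s b hb H|s1 s2 T1 T2 _ h1 _ h2|s1 s2 T1 T2 _ h1 h2 H] t ht.
- apply: Rle_trans; first exact: norm_scal.
  rewrite -[X in _ <= X]Rmult_1_l; apply: Rmult_le_compat_r; first exact: norm_ge_0.
  by apply: Rabs_le; exact: COS_bound.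
- apply: Rle_trans; first exact: H.
  have hs := trig_flat_ge0 (trig_flat_decay D hb H).
  by rewrite -[X in _ <= X]Rmult_1_r; apply: Rmult_le_compat_l => //; exact: exp_opp_le1.
- apply: Rle_trans; first exact: norm_triangle.
  by apply: Rplus_le_compat; [exact: h1|exact: h2].
- by rewrite -H //; apply: Rle_trans h2; exact: h1.
Qed.

Lemma continuous_cos_lin (a b t : R) :
  continuous (fun t => cos (a * t + b) : R_NormedModule) t.
Proof.
apply: (continuous_comp (fun t => a * t + b)); last exact: continuous_cos.
apply: (continuous_plus (fun t => a * t)); last exact: continuous_const.
by apply: (continuous_scal (fun _ => a)); [exact: continuous_const|exact: continuous_id].
Qed.

Lemma trig_flat_cont D s T : trig_flat D s T -> half_cont T.
Proof.
elim=> {s T} [al phi P _|s b hb H|s1 s2 T1 T2 _ h1 _ h2|s1 s2 T1 T2 _ h1 h2 H] //.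
- apply: half_cont_continuous => t.
  by apply: (continuous_scal (fun t => cos (_ * t + _))); [exact: continuous_cos_lin|exact: continuous_const].
- exact: half_cont_plus.
- exact: half_cont_ext H h1.
Qed.

Lemma trig_flat_const D (v : E) : 0 <= D -> trig_flat D (norm v) (fun _ => v).
Proof.
move=> hD; apply: (trig_flat_weaken (trig_flat_mode (al := fun=> 0%Z) 0 v _) (Rle_refl _)).
- by rewrite /abs1 big1.
- move=> t _; rewrite (_ : dot _ omega = 0); last by rewrite /dot big1 // => i _; ring.
  by rewrite Rmult_0_l Rplus_0_l cos_0; exact: (scal_one v).
Qed.

End TrigFlat.

Section OperatorMaps.

Variables (E : operators) (E_laws : operator_laws E).

Lemma op_comp_minus_l (f g h : E) :
  op_comp (minus f g) h = minus (op_comp f h) (op_comp g h).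
Proof.
replace (minus f g) with (plus f (scal (-1) g)) by module_eq.
rewrite (op_comp_plus_l E_laws) (op_comp_scal_l E_laws); module_eq.
Qed.

Lemma op_comp_minus_r (f g h : E) :
  op_comp h (minus f g) = minus (op_comp h f) (op_comp h g).
Proof.
replace (minus f g) with (plus f (scal (-1) g)) by module_eq.
rewrite (op_comp_plus_r E_laws) (op_comp_scal_r E_laws); module_eq.
Qed.

Lemma half_cont_comp (f g : R -> E) :
  half_cont f -> half_cont g -> half_cont (fun t => op_comp (f t) (g t)).
Proof.
move=> Hf Hg t; set f1 := fun s => f (Rmax 0 s); set g1 := fun s => g (Rmax 0 s).
have {}Hf : continuous f1 t by exact: Hf.
have {}Hg : continuous g1 t by exact: Hg.
apply/filterlim_locally_ball_norm => eps.
set A := norm (f1 t) + norm (g1 t) + 1.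
have hA : 0 < A by have := norm_ge_0 (f1 t); have := norm_ge_0 (g1 t); rewrite /A; lra.
(* The cap by 1 bounds [g1 s] by [1 + norm (g1 t)], and [A] collects the two factors left in front
   of [d]. *)
have hd : 0 < Rmin 1 (eps / A).
  by apply: Rmin_pos; [lra|apply: Rdiv_lt_0_compat => //; exact: cond_pos].
have h1 := proj1 (filterlim_locally_ball_norm (F := locally t) f1 (f1 t)) Hf (mkposreal _ hd).
have h2 := proj1 (filterlim_locally_ball_norm (F := locally t) g1 (g1 t)) Hg (mkposreal _ hd).
generalize (filter_and (F := locally t) _ _ (h1 _) (h2 _)); apply filter_imp => s; rewrite /ball_norm /= -/(f1 s) -/(g1 s).
move=> [k1 k2]; set d := Rmin 1 (eps / A) in k1 k2; have hd' : 0 < d by exact: hd.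
have d1 : d <= 1 by exact: Rmin_l.
have d2 : d * A <= eps.
  have h : d <= eps / A by exact: Rmin_r.
  apply: Rle_trans; first exact: Rmult_le_compat_r (Rlt_le _ _ hA) h.
  by right; field; lra.
have -> : minus (op_comp (f1 s) (g1 s)) (op_comp (f1 t) (g1 t)) =
  plus (op_comp (minus (f1 s) (f1 t)) (plus (minus (g1 s) (g1 t)) (g1 t)))
       (op_comp (f1 t) (minus (g1 s) (g1 t))).
  have -> : plus (minus (g1 s) (g1 t)) (g1 t) = g1 s by module_eq.
  by rewrite op_comp_minus_l op_comp_minus_r; module_eq.
have n1 := norm_op_comp E_laws (minus (f1 s) (f1 t)) (plus (minus (g1 s) (g1 t)) (g1 t)).
have n2 := norm_op_comp E_laws (f1 t) (minus (g1 s) (g1 t)).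
have n3 := norm_triangle (minus (g1 s) (g1 t)) (g1 t).
apply: Rle_lt_trans; first exact: norm_triangle.
apply: Rle_lt_trans; first exact: Rplus_le_compat n1 n2.
move: (norm_ge_0 (minus (f1 s) (f1 t))) (norm_ge_0 (minus (g1 s) (g1 t))) => p1 p2.
move: (norm_ge_0 (f1 t)) (norm_ge_0 (g1 t)) => p3 p4.
have m1 : norm (minus (f1 s) (f1 t)) * norm (plus (minus (g1 s) (g1 t)) (g1 t)) <=
  norm (minus (f1 s) (f1 t)) * (1 + norm (g1 t)).
  by apply: Rmult_le_compat_l => //; apply: Rle_trans n3 _; apply: Rplus_le_compat_r; apply: Rlt_le; apply: Rlt_le_trans k2 d1.
have m2 : norm (minus (f1 s) (f1 t)) * (1 + norm (g1 t)) < d * (1 + norm (g1 t)).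
  by apply: Rmult_lt_compat_r => //; lra.
have m3 : norm (f1 t) * norm (minus (g1 s) (g1 t)) <= norm (f1 t) * d.
  by apply: Rmult_le_compat_l => //; exact: Rlt_le.
by apply: Rlt_le_trans d2; rewrite /A; lra.
Qed.

Variables (r : nat) (omega : 'I_r -> R).
Notation trig_flat := (trig_flat omega).

(** Product-to-sum formula: two modes give the modes of indices [al + be] and [al - be], each with
    half the amplitude, so degrees add and sizes multiply. A mode times a decaying map decays at the
    same rate. *)
Lemma trig_flat_mode_comp D D' al phi P s T : abs1 al <= D -> trig_flat D' s T ->
  trig_flat (D + D') (norm P * s)
    (fun t => op_comp (scal (cos (dot al omega * t + phi)) P : E) (T t)).
Proof.
move=> hal; elim=> {s T} [be psi Q h|s b hb H|s1 s2 T1 T2 _ h1 _ h2|s1 s2 T1 T2 _ h1 h2 H].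
- have nPQ := norm_op_comp E_laws P Q.
  have a1 : abs1 (fun i => (al i + be i)%Z) <= D + D'.
    by apply: Rle_trans; [exact: abs1_add_le|lra].
  have a2 : abs1 (fun i => (al i + - be i)%Z) <= D + D'.
    by apply: Rle_trans; [exact: abs1_add_le|rewrite abs1_opp; lra].
  apply: (trig_flat_weaken (trig_flat_plus
    (trig_flat_mode omega (phi + psi) (scal (1 / 2) (op_comp P Q)) a1)
    (trig_flat_mode omega (phi - psi) (scal (1 / 2) (op_comp P Q)) a2))).
  + by rewrite norm_scal_R Rabs_pos_eq; lra.
  + move=> t _; rewrite (op_comp_scal_l E_laws) (op_comp_scal_r E_laws) !dot_plus dot_opp.
    have -> : (dot al omega + dot be omega) * t + (phi + psi) =
      (dot al omega * t + phi) + (dot be omega * t + psi) by ring.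
    have -> : (dot al omega + - dot be omega) * t + (phi - psi) =
      (dot al omega * t + phi) - (dot be omega * t + psi) by ring.
    by rewrite cos_plus cos_minus; module_eq; field.
- apply: trig_flat_decay.
    by apply: half_cont_comp => //; exact: trig_flat_cont (trig_flat_mode omega phi P hal).
  move=> t ht; apply: Rle_trans; first exact: norm_op_comp.
  rewrite Rmult_assoc; apply: Rmult_le_compat; [exact: norm_ge_0|exact: norm_ge_0| |exact: H].
  exact: (trig_flat_bound (trig_flat_mode omega phi P hal) ht).
- apply: (trig_flat_weaken (trig_flat_plus h1 h2)); first by right; ring.
  by move=> t _; rewrite (op_comp_plus_r E_laws).
- apply: (trig_flat_weaken h1); first by apply: Rmult_le_compat_l => //; exact: norm_ge_0.
  by move=> t ht; rewrite H.
Qed.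

Lemma trig_flat_comp D D' s s' (T T' : R -> E) : trig_flat D s T -> trig_flat D' s' T' ->
  trig_flat (D + D') (s * s') (fun t => op_comp (T t) (T' t)).
Proof.
move=> hT hT'; have s0' := trig_flat_ge0 hT'.
elim: hT => {s T} [al phi P h|s b hb H|s1 s2 T1 T2 _ h1 _ h2|s1 s2 T1 T2 _ h1 h2 H].
- exact: trig_flat_mode_comp.
- apply: trig_flat_decay; first by apply: half_cont_comp => //; exact: trig_flat_cont hT'.
  move=> t ht; apply: Rle_trans; first exact: norm_op_comp.
  replace (s * s' * exp (- t)) with (s * exp (- t) * s') by ring.
  apply: Rmult_le_compat; [exact: norm_ge_0|exact: norm_ge_0|exact: H|].
  exact: trig_flat_bound hT' _ ht.
- apply: (trig_flat_weaken (trig_flat_plus h1 h2)); first by right; ring.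
  by move=> t _; rewrite (op_comp_plus_l E_laws).
- apply: (trig_flat_weaken h1); first exact: Rmult_le_compat_r.
  by move=> t ht; rewrite H.
Qed.

End OperatorMaps.

(** * Primitives of zero-mean maps *)

Section Primitive.

Variable E : CompleteNormedModule R_AbsRing.

Lemma norm_RInt_decay (b : R -> E) (s x y : R) : half_cont b ->
  (forall t, 0 <= t -> norm (b t) <= s * exp (- t)) -> 0 <= x <= y ->
  norm (minus (RInt b 0 y) (RInt b 0 x)) <= s * exp (- x) - s * exp (- y).
Proof.
move=> hb H hxy.
have ex u v : 0 <= u -> 0 <= v -> ex_RInt b u v by exact: half_cont_ex_RInt.
have -> : minus (RInt b 0 y) (RInt b 0 x) = RInt b x y.
  rewrite -(RInt_Chasles b 0 x y); [module_eq|apply: ex; lra|apply: ex; lra].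
apply: (norm_RInt_le b (fun t => s * exp (- t)) x y); first lra.
- by move=> t ht; apply: H; lra.
- by apply: RInt_correct; apply: ex; lra.
- have -> : s * exp (- x) - s * exp (- y) = minus (- s * exp (- y)) (- s * exp (- x)).
    by rewrite /minus /plus /opp /=; ring.
  apply: (is_RInt_derive (fun t => - s * exp (- t)) (fun t => s * exp (- t))) => t _.
    by auto_derive => //; ring.
  apply: (continuous_scal (fun _ => s) (fun t => exp (- t))); first exact: continuous_const.
  apply: (continuous_comp Ropp exp); last exact: continuous_exp.
  exact: (continuous_opp (fun t : R => t : R_NormedModule)).
Qed.

(** The limit is taken along the integers, where the increments are geometric of ratio [exp (-1)].
    Comparing with a far integer then recovers the constant [s] itself. *)
Lemma RInt_decay (b : R -> E) (s : R) : half_cont b ->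
  (forall t, 0 <= t -> norm (b t) <= s * exp (- t)) ->
  exists l, forall t, 0 <= t -> norm (minus (RInt b 0 t) l) <= s * exp (- t).
Proof.
move=> hb H.
have s0 : 0 <= s.
  have := H 0 (Rle_refl 0); rewrite Ropp_0 exp_0 Rmult_1_r.
  by have := norm_ge_0 (b 0); lra.
have he : 0 < exp (-1) < 1.
  by split; [exact: exp_pos|rewrite -[X in _ < X]exp_0; apply: exp_increasing; lra].
have expn k : exp (- INR k) = exp (-1) ^ k.
  elim: k => [|k IH]; first by rewrite Ropp_0 exp_0.
  by rewrite S_INR -tech_pow_Rmult -IH -exp_plus; congr exp; ring.
have [|l Hl] := geometric_limit (u := fun k => RInt b 0 (INR k)) s0 he.
  move=> k; apply: Rle_trans.
    apply: norm_RInt_decay hb H _; rewrite S_INR; have := pos_INR k; lra.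
  by rewrite -expn; have := Rmult_le_pos _ _ s0 (Rlt_le _ _ (exp_pos (- INR k.+1))); lra.
exists l => t ht; apply: le_epsilon => e h.
have hC : 0 <= s / (1 - exp (-1)).
  by apply: Rmult_le_pos => //; apply: Rlt_le; apply: Rinv_0_lt_compat; lra.
have [N HN] := pow_small hC he h.
have [n0 hn0] := nfloor_ex t ht.
pose n := (N + n0.+1)%N.
have hn : t <= INR n.
  have : INR n0.+1 <= INR n by apply: le_INR; rewrite /n; lia.
  by rewrite S_INR; lra.
apply: Rle_trans; first exact: (norm_minus_triangle (RInt b 0 (INR n))).
apply: Rplus_le_compat.
  rewrite norm_minus_sym; apply: Rle_trans; first exact: norm_RInt_decay hb H _.
  by have := Rmult_le_pos _ _ s0 (Rlt_le _ _ (exp_pos (- INR n))); lra.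
rewrite norm_minus_sym; apply: Rle_trans; first exact: (Hl n).
by apply: HN; rewrite /n leq_addr.
Qed.

Lemma RInt_mode (lam phi t : R) (P : E) : lam <> 0 ->
  RInt (fun u => scal (cos (lam * u + phi)) P) 0 t =
  scal ((sin (lam * t + phi) - sin phi) / lam) P.
Proof.
move=> hl; apply: is_RInt_unique.
have -> : scal ((sin (lam * t + phi) - sin phi) / lam) P =
  minus (scal (sin (lam * t + phi) / lam) P) (scal (sin (lam * 0 + phi) / lam) P).
  by rewrite Rmult_0_r Rplus_0_l; module_eq; field.
apply: (is_RInt_derive (fun u => scal (sin (lam * u + phi) / lam) P)) => u _.
  apply: (is_derive_scal_l (fun u => sin (lam * u + phi) / lam)).
  by auto_derive => //; field.
apply: (continuous_scal (fun u => cos (lam * u + phi))); last exact: continuous_const.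
exact: continuous_cos_lin.
Qed.

Variables (r : nat) (omega : 'I_r -> R) (cD : R) (p : nat).
Hypothesis cD_gt0 : 0 < cD.
Hypothesis small_div : forall (al : 'I_r -> Z) D, (exists i, al i <> 0%Z) -> abs1 al <= D ->
    dot al omega <> 0 /\ / Rabs (dot al omega) <= (1 + D) ^ p / cD.

(* The factor lost on the size by integration, because of the small divisors; being
   polynomial in the degree it is absorbed by a geometric rate. *)
Definition loss (D : R) : R := 2 + 2 * ((1 + D) ^ p / cD).

Lemma loss_ge2 (D : R) : 0 <= D -> 2 <= loss D.
Proof.
move=> hD; rewrite /loss.
have : 0 <= (1 + D) ^ p / cD.
  by apply: Rmult_le_pos; [apply: pow_le; lra|apply: Rlt_le; exact: Rinv_0_lt_compat].
by lra.
Qed.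

(** The constant [c] is the mean of [T], found along the derivation: only the mode of index 0
    contributes to it. In [loss], the summand 2 pays for decaying maps and the other one for
    oscillating modes. *)
Lemma trig_flat_primitive D s (T : R -> E) : 0 <= D -> trig_flat omega D s T ->
  exists c, norm c <= s /\
    trig_flat omega D (loss D * s) (fun t => RInt (fun u => minus (T u) c) 0 t).
Proof.
move=> hD hT; have h2 := loss_ge2 hD; have hL : 0 <= loss D by lra.
elim: hT => {s T} [al phi P h|s b hb H|s1 s2 T1 T2 k1 h1 k2 h2'|s1 s2 T1 T2 k1 h1 hs H].
(* A zero frequency occurs only for the zero index, and such a mode is a constant, removed by [c].
   Any other mode integrates to a mode delayed by [PI / 2] plus a constant, each of size at most
   [norm P / Rabs lam]. *)
- have [[i hi]|/not_ex_all_not al0] := classic (exists i, al i <> 0%Z); last first.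
    have E0 : dot al omega = 0.
      by rewrite /dot big1 // => i _; have /NNPP -> := al0 i; ring.
    exists (scal (cos phi) P); split.
      rewrite norm_scal_R -[X in _ <= X]Rmult_1_l; apply: Rmult_le_compat_r; first exact: norm_ge_0.
      by apply: Rabs_le; exact: COS_bound.
    apply: (trig_flat_weaken (trig_flat_const omega (zero : E) hD)).
      by rewrite norm_zero; apply: Rmult_le_pos => //; exact: norm_ge_0.
    move=> t ht; rewrite (RInt_ext _ (fun _ => zero)).
      by rewrite RInt_const; module_eq.
    by move=> u _; rewrite E0 Rmult_0_l Rplus_0_l; module_eq.
  have [hl hinv] := small_div (ex_intro _ i hi) h.
  set lam := dot al omega in hl hinv *.
  exists zero; split; first by rewrite norm_zero; exact: norm_ge_0.
  apply: (trig_flat_weaken (trig_flat_plus (trig_flat_mode omega (phi - PI / 2) (scal (/ lam) P) h)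
    (trig_flat_const omega (scal (- sin phi / lam) P) hD))).
    rewrite !norm_scal_R /Rdiv Rabs_mult Rabs_inv Rabs_Ropp.
    have hp := norm_ge_0 P.
    have hi0 : 0 <= / Rabs lam by apply: Rlt_le; apply: Rinv_0_lt_compat; exact: Rabs_pos_lt.
    have hs : Rabs (sin phi) <= 1 by apply: Rabs_le; exact: SIN_bound.
    apply: (Rle_trans _ (2 * / Rabs lam * norm P)).
      rewrite -Rmult_plus_distr_r; apply: Rmult_le_compat_r => //.
      by have := Rmult_le_compat_r _ _ _ hi0 hs; lra.
    apply: Rmult_le_compat_r => //; rewrite /loss; lra.
  move=> t ht; rewrite (RInt_ext _ (fun u => scal (cos (lam * u + phi)) P)).
    rewrite RInt_mode // -/lam.
    have -> : cos (lam * t + (phi - PI / 2)) = sin (lam * t + phi).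
      by rewrite -cos_shift -cos_neg; congr cos; ring.
    by module_eq; field.
  by move=> u _; module_eq.
(* The primitive of a decaying map is its limit plus a remainder decaying at the same rate; each
   part has size at most [s]. *)
- have [l Hl] := RInt_decay hb H.
  have s0 := trig_flat_ge0 (trig_flat_decay omega D hb H).
  exists zero; split; first by rewrite norm_zero.
  have nl : norm l <= s.
    have := Hl 0 (Rle_refl 0); rewrite RInt_point Ropp_0 exp_0 Rmult_1_r norm_minus_sym.
    by rewrite minus_zero_r.
  apply: (trig_flat_weaken (trig_flat_plus (trig_flat_const omega l hD)
    (trig_flat_decay (b := fun t => minus (RInt b 0 t) l) (s := s) omega D _ Hl))).
  + by apply: half_cont_minus; [exact: half_cont_RInt|exact: half_cont_const].
  + by have := Rmult_le_compat_r _ _ _ s0 h2; lra.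
  + move=> t ht; rewrite (RInt_ext _ b); first by module_eq.
    by move=> u _; module_eq.
- have [c1 [n1 t1]] := h1; have [c2 [n2 t2]] := h2'.
  exists (plus c1 c2); split.
    by apply: Rle_trans; [exact: norm_triangle|exact: Rplus_le_compat].
  apply: (trig_flat_weaken (trig_flat_plus t1 t2)); first by right; ring.
  move=> t ht; rewrite -RInt_half_plus //.
  + by apply: RInt_ext => u _; module_eq.
  + by apply: half_cont_minus; [exact: trig_flat_cont k1|exact: half_cont_const].
  + by apply: half_cont_minus; [exact: trig_flat_cont k2|exact: half_cont_const].
- have [c [n t]] := h1; exists c; split; first lra.
  apply: (trig_flat_weaken t); first exact: Rmult_le_compat_l.
  by move=> x hx; apply: RInt_half_ext => // u hu; rewrite H.
Qed.

End Primitive.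

Section QuasiPeriodic.

Variables (E : operators) (E_laws : operator_laws E) (r : nat) (omega : 'I_r -> R).

(** The increments are recorded besides the approximants because the loss due to integration must be
    compared with [rho ^ k] on each increment separately. Indices are shifted so that [F k] has
    degree at most [d (k + 1)]. *)
Definition approximable (f : R -> E) (C rho d : R) (F : nat -> R -> E) : Prop :=
  trig_flat omega (d * INR 1) C (F 0%N) /\
  (forall k, trig_flat omega (d * INR k.+2) (C * rho ^ k) (fun t => minus (F k.+1 t) (F k t))) /\
  forall k t, 0 <= t -> norm (minus (f t) (F k t)) <= C * rho ^ k.

(* Maps which are approximated at a geometric rate, with increments of linearly growing
   degree, by trigonometric polynomials plus decaying maps: this is the union of the
   spaces E_kappa, kappa > 0, of the paper. *)
Definition quasi_periodic (f : R -> E) : Prop :=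
  half_cont f /\ exists C rho d F, 0 < C /\ 0 < rho < 1 /\ 0 <= d /\ approximable f C rho d F.

Lemma approximable_weaken f C rho d F C' rho' d' :
  0 <= C -> 0 < rho -> C <= C' -> rho <= rho' -> d <= d' ->
  approximable f C rho d F -> approximable f C' rho' d' F.
Proof.
move=> hC hr hC' hr' hd [H0 [H1 H2]].
have hk k : C * rho ^ k <= C' * rho' ^ k.
  by apply: Rmult_le_compat => //; [apply: pow_le; lra|apply: pow_incr; lra].
split; [|split].
- apply: (trig_flat_degree (D := d * INR 1)); first by apply: Rmult_le_compat_r => //; exact: pos_INR.
  exact: trig_flat_weaken H0 hC' (fun _ _ => erefl).
- move=> k; apply: (trig_flat_degree (D := d * INR k.+2)).
    by apply: Rmult_le_compat_r => //; exact: pos_INR.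
  exact: trig_flat_weaken (H1 k) (hk k) (fun _ _ => erefl).
- by move=> k t ht; apply: Rle_trans (hk k); exact: H2.
Qed.

Lemma approximable_common f g : quasi_periodic f -> quasi_periodic g ->
  exists C rho d F G, 0 < C /\ 0 < rho < 1 /\ 0 <= d /\
    approximable f C rho d F /\ approximable g C rho d G.
Proof.
move=> [_ [C [rho [d [F [hC [hr [hd HF]]]]]]]] [_ [C' [rho' [d' [G [hC' [hr' [hd' HG]]]]]]]].
exists (Rmax C C'), (Rmax rho rho'), (Rmax d d'), F, G.
have h1 := Rmax_l C C'; have h2 := Rmax_l rho rho'; have h3 := Rmax_l d d'.
have h1' := Rmax_r C C'; have h2' := Rmax_r rho rho'; have h3' := Rmax_r d d'.
split; first lra; split; first by split; [lra|apply: Rmax_lub_lt; lra].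
split; first lra.
by split; [apply: approximable_weaken HF|apply: approximable_weaken HG]; lra.
Qed.

Lemma approximable_partial f C rho d F : 0 < C -> 0 < rho < 1 -> 0 <= d ->
  approximable f C rho d F -> forall k, trig_flat omega (d * INR k.+1) (C + C / (1 - rho)) (F k).
Proof.
move=> hC hr hd [H0 [H1 _]] k.
suff : trig_flat omega (d * INR k.+1) (C + C / (1 - rho) * (1 - rho ^ k)) (F k).
  move=> H; apply: (trig_flat_weaken H) => //; apply: Rplus_le_compat_l.
  rewrite -[X in _ <= X]Rmult_1_r; apply: Rmult_le_compat_l.
    by apply: Rmult_le_pos; [lra|apply: Rlt_le; apply: Rinv_0_lt_compat; lra].
  by have := pow_le rho k ltac:(lra); lra.
elim: k => [|k IH].
  by apply: (trig_flat_weaken H0) => //; rewrite /= Rminus_diag Rmult_0_r Rplus_0_r; exact: Rle_refl.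
have hD : d * INR k.+1 <= d * INR k.+2.
  by apply: Rmult_le_compat_l => //; apply: le_INR; lia.
apply: (trig_flat_weaken (trig_flat_plus (trig_flat_degree hD IH) (H1 k))).
  by right; rewrite -tech_pow_Rmult; field; lra.
by move=> t _; module_eq.
Qed.

Lemma approximable_bound f C rho d F : 0 < C -> 0 < rho < 1 ->
  approximable f C rho d F -> forall t, 0 <= t -> norm (f t) <= 2 * C.
Proof.
move=> hC hr [H0 [_ H2]] t ht.
have h1 := trig_flat_bound H0 ht; have h2 := H2 0%N t ht; rewrite Rmult_1_r in h2.
replace (f t) with (plus (minus (f t) (F 0%N t)) (F 0%N t)) by module_eq.
by apply: Rle_trans; [exact: norm_triangle|apply: (Rle_trans _ (C + C)); [exact: Rplus_le_compat|lra]].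
Qed.

Lemma quasi_periodic_bound f : quasi_periodic f ->
  exists B, 0 < B /\ forall t, 0 <= t -> norm (f t) <= B.
Proof.
move=> [_ [C [rho [d [F [hC [hr [hd HF]]]]]]]]; exists (2 * C); split; first lra.
exact: approximable_bound HF.
Qed.

Lemma quasi_periodic_ext f g : (forall t, 0 <= t -> f t = g t) ->
  quasi_periodic f -> quasi_periodic g.
Proof.
move=> H [hf [C [rho [d [F [hC [hr [hd [H0 [H1 H2]]]]]]]]]].
split; first exact: half_cont_ext H hf.
by exists C, rho, d, F; repeat split => //; move=> k t ht; rewrite -H //; exact: H2.
Qed.

Lemma trig_flat_quasi_periodic D s T : trig_flat omega D s T -> quasi_periodic T.
Proof.
move=> H; split; first exact: trig_flat_cont H.
have hs := trig_flat_ge0 H.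
exists (s + 1), (1 / 2), (Rmax 0 D), (fun _ => T).
have hD := Rmax_l 0 D; have hD' := Rmax_r 0 D.
split; first lra; split; first lra; split => //; split; [|split].
- apply: (trig_flat_degree (D := D)); first by rewrite /= Rmult_1_r.
  by apply: (trig_flat_weaken H) => //; lra.
- move=> k; apply: (trig_flat_weaken (trig_flat_const omega (zero : E) (D := Rmax 0 D * INR k.+2) _)).
  + by apply: Rmult_le_pos => //; exact: pos_INR.
  + by rewrite norm_zero; apply: Rmult_le_pos; [lra|apply: pow_le; lra].
  + by move=> t _; module_eq.
- move=> k t _; rewrite minus_eq_zero norm_zero.
  by apply: Rmult_le_pos; [lra|apply: pow_le; lra].
Qed.

Lemma quasi_periodic_const (v : E) : quasi_periodic (fun _ => v).
Proof. exact: trig_flat_quasi_periodic (trig_flat_const omega v (Rle_refl 0)). Qed.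

Lemma quasi_periodic_plus f g : quasi_periodic f -> quasi_periodic g ->
  quasi_periodic (fun t => plus (f t) (g t)).
Proof.
move=> Hf Hg; split; first by apply: half_cont_plus; [case: Hf|case: Hg].
have [C [rho [d [F [G [hC [hr [hd [[F0 [F1 F2]] [G0 [G1 G2]]]]]]]]]]] := approximable_common Hf Hg.
exists (2 * C), rho, d, (fun k t => plus (F k t) (G k t)).
split; first lra; split => //; split => //; split; [|split].
- by apply: (trig_flat_weaken (trig_flat_plus F0 G0)) => //; lra.
- move=> k; apply: (trig_flat_weaken (trig_flat_plus (F1 k) (G1 k))); first by right; ring.
  by move=> t _; module_eq.
- move=> k t ht.
  replace (minus _ _) with (plus (minus (f t) (F k t)) (minus (g t) (G k t))) by module_eq.
  apply: Rle_trans; first exact: norm_triangle.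
  replace (2 * C * rho ^ k) with (C * rho ^ k + C * rho ^ k) by ring.
  by apply: Rplus_le_compat; [exact: F2|exact: G2].
Qed.

(** Increments of the product of the approximants telescope as an increment of [F] times [G k.+1]
    plus [F k] times an increment of [G]. Hence the rate is kept and only the slope [d] of the
    degrees doubles. *)
Lemma quasi_periodic_comp f g : quasi_periodic f -> quasi_periodic g ->
  quasi_periodic (fun t => op_comp (f t) (g t)).
Proof.
move=> Hf Hg; split; first by apply: half_cont_comp => //; [case: Hf|case: Hg].
have [C [rho [d [F [G [hC [hr [hd [HF HG]]]]]]]]] := approximable_common Hf Hg.
have PF := approximable_partial hC hr hd HF; have PG := approximable_partial hC hr hd HG.
have Bg := approximable_bound hC hr HG.
case: HF => F0 [F1 F2]; case: HG => G0 [G1 G2].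
set S := C + C / (1 - rho) in PF PG.
have hS : C <= S.
  have : 0 <= C / (1 - rho) by apply: Rmult_le_pos; [lra|apply: Rlt_le; apply: Rinv_0_lt_compat; lra].
  by rewrite /S; lra.
(* Large enough for the three requirements [C * C], [2 * C * S] and [2 * C * C + S * C] of the first
   term, the increments and the error. *)
exists (2 * C * (S + 1) + S * C), rho, (2 * d), (fun k t => op_comp (F k t) (G k t)).
have hrk k : 0 <= rho ^ k by apply: pow_le; lra.
have pos1 : 0 < 2 * C * (S + 1) by apply: Rmult_lt_0_compat; lra.
have pos2 : 0 < S * C by apply: Rmult_lt_0_compat; lra.
split; first lra; split => //; split; first lra; split; [|split].
- apply: (trig_flat_degree (D := d * INR 1 + d * INR 1)); first by right; ring.
  apply: (trig_flat_weaken (trig_flat_comp E_laws F0 G0)) => //.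
  by have := Rmult_le_compat_r C C S ltac:(lra) hS; lra.
- move=> k; apply: (trig_flat_degree (D := d * INR k.+2 + d * INR k.+2)); first by right; ring.
  have hD : d * INR k.+1 + d * INR k.+2 <= d * INR k.+2 + d * INR k.+2.
    by apply: Rplus_le_compat_r; apply: Rmult_le_compat_l => //; apply: le_INR; lia.
  apply: (trig_flat_weaken (trig_flat_plus (trig_flat_comp E_laws (F1 k) (PG k.+1))
     (trig_flat_degree hD (trig_flat_comp E_laws (PF k) (G1 k))))).
    replace (C * rho ^ k * S + S * (C * rho ^ k)) with (2 * C * S * rho ^ k) by ring.
    by apply: Rmult_le_compat_r => //; lra.
  by move=> t _; rewrite (op_comp_minus_l E_laws) (op_comp_minus_r E_laws); module_eq.
- move=> k t ht.
  have -> : minus (op_comp (f t) (g t)) (op_comp (F k t) (G k t)) =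
    plus (op_comp (minus (f t) (F k t)) (g t)) (op_comp (F k t) (minus (g t) (G k t))).
    by rewrite (op_comp_minus_l E_laws) (op_comp_minus_r E_laws); module_eq.
  apply: Rle_trans; first exact: norm_triangle.
  apply: (Rle_trans _ (C * rho ^ k * (2 * C) + S * (C * rho ^ k))).
    apply: Rplus_le_compat; (apply: Rle_trans; first exact: norm_op_comp).
      by apply: Rmult_le_compat; [exact: norm_ge_0|exact: norm_ge_0|exact: F2|exact: Bg].
    by apply: Rmult_le_compat; [exact: norm_ge_0|exact: norm_ge_0|exact: trig_flat_bound (PF k) _ ht|exact: G2].
  replace (C * rho ^ k * (2 * C) + S * (C * rho ^ k)) with ((2 * C * C + S * C) * rho ^ k) by ring.
  apply: Rmult_le_compat_r => //.
  by have := Rmult_le_compat_l (2 * C) C (S + 1) ltac:(lra) ltac:(lra); lra.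
Qed.

Hypothesis omega_dioph : diophantine omega.

(** Each increment is integrated after removal of its own mean, at the price of a factor polynomial
    in [k], which a slower rate [sigma] absorbs. The means sum up to [c], at the original rate
    [rho]. *)
Lemma quasi_periodic_primitive f : quasi_periodic f ->
  exists c, quasi_periodic (fun t => RInt (fun u => minus (f u) c) 0 t).
Proof.
move=> [hf [C [rho [d [F [hC [hr [hd HF]]]]]]]].
have PF := approximable_partial hC hr hd HF.
case: HF => F0 [F1 F2].
have [cD [p [hcD small]]] := small_divisor omega_dioph.
have dn k : 0 <= d * INR k by apply: Rmult_le_pos => //; exact: pos_INR.
have [c0 [nc0 G0]] := trig_flat_primitive hcD small (dn 1%N) F0.
have [e He] := choice _ (fun k => trig_flat_primitive hcD small (dn k.+2) (F1 k)).
(* Mean of [F k], accumulated from the means of the increments so that the centered primitives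
   telescope too. *)
pose cc := fix cc k : E := if k is k'.+1 then plus (cc k') (e k') else c0.
have hC0 : 0 <= C by lra.
have [c Hc] := geometric_limit (u := cc) hC0 hr (fun k =>
  ltac:(rewrite /=; replace (minus (plus (cc k) (e k)) (cc k)) with (e k) by module_eq; exact: (He k).1)).
exists c.
have hfc : half_cont (fun u => minus (f u) c) by apply: half_cont_minus; [|exact: half_cont_const].
split; first exact: half_cont_RInt.
have hF k : half_cont (F k) by exact: trig_flat_cont (PF k).
pose G k t := RInt (fun u => minus (F k u) (cc k)) 0 t.
have hFc k : half_cont (fun u => minus (F k u) (cc k)).
  by apply: half_cont_minus; [|exact: half_cont_const].
have [C1 [sigma [hC1 [hs Hs]]]] := poly_geometric p hd hr.
pose C2 := loss cD p (d * INR 1) * C + (2 + 2 * C1 / cD) * C.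
have hC2 : 0 < (2 + 2 * C1 / cD) * C.
  apply: Rmult_lt_0_compat => //.
  have : 0 < C1 / cD by exact: Rdiv_lt_0_compat.
  by lra.
have hl0 : 0 <= loss cD p (d * INR 1) * C.
  by apply: Rmult_le_pos => //; have := loss_ge2 p hcD (dn 1%N); lra.
have hrs k : rho ^ k <= sigma ^ k by apply: pow_incr; lra.
have hloss k : loss cD p (d * INR k.+2) * (C * rho ^ k) <= (2 + 2 * C1 / cD) * C * sigma ^ k.
  rewrite /loss; replace (_ * (C * rho ^ k)) with
    (C * (2 * rho ^ k + 2 * / cD * ((1 + d * INR k.+2) ^ p * rho ^ k))) by (field; lra).
  replace ((2 + 2 * C1 / cD) * C * sigma ^ k) with
    (C * (2 * sigma ^ k + 2 * / cD * (C1 * sigma ^ k))) by (field; lra).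
  apply: Rmult_le_compat_l => //; apply: Rplus_le_compat; first by have := hrs k; lra.
  apply: Rmult_le_compat_l; last exact: Hs.
  by have := Rinv_0_lt_compat _ hcD; lra.
have G1 k : trig_flat omega (d * INR k.+2) ((2 + 2 * C1 / cD) * C * sigma ^ k)
    (fun t => minus (G k.+1 t) (G k t)).
  apply: (trig_flat_weaken (He k).2 (hloss k)) => t ht.
  rewrite /G -RInt_half_minus //; apply: RInt_ext => u _ /=; module_eq.
have step k t : 0 <= t -> norm (minus (G k.+1 t) (G k t)) <= (2 + 2 * C1 / cD) * C * sigma ^ k.
  by move=> ht; exact: (trig_flat_bound (G1 k) ht).
have hsig : 0 < sigma < 1 by lra.
pose C3 := (2 + 2 * C1 / cD) * C / (1 - sigma).
have hC3 : 0 <= C3 by apply: Rmult_le_pos; [lra|apply: Rlt_le; apply: Rinv_0_lt_compat; lra].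
have hsk k : 0 <= sigma ^ k by apply: pow_le; lra.
exists (C2 + C3), sigma, d, G; split; first by rewrite /C2; lra.
split => //; split => //; split; [|split].
- by apply: (trig_flat_weaken G0) => //; rewrite /C2; lra.
- move=> k; apply: (trig_flat_weaken (G1 k)) => //.
  by apply: Rmult_le_compat_r => //; rewrite /C2; lra.
(* The direct error of a primitive grows like [t]. At fixed [t] it is made smaller than [eta] by
   going to the approximant [k + N]; from there back to [k] the increments give a bound independent
   of [t] and of [N]. *)
- move=> k t ht; apply: (Rle_trans _ (C3 * sigma ^ k)); last by apply: Rmult_le_compat_r => //; rewrite /C2; lra.
  apply: le_epsilon => eta heta.
  have hA : 0 <= t * (C + C / (1 - rho)).
    apply: Rmult_le_pos => //; have : 0 <= C / (1 - rho); last lra.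
    by apply: Rmult_le_pos; [lra|apply: Rlt_le; apply: Rinv_0_lt_compat; lra].
  have [N HN] := pow_small hA hr heta.
  apply: Rle_trans; first exact: (norm_minus_triangle (G (k + N)%N t)).
  rewrite Rplus_comm; apply: Rplus_le_compat.
    by apply: (geometric_dist (u := fun k => G k t)); [lra|lra|move=> j; exact: step].
  rewrite /G -RInt_half_minus //.
  apply: Rle_trans; last exact: (HN (k + N)%N (leq_addl _ _)).
  rewrite Rmult_assoc; apply: norm_RInt_half_le => //; first exact: half_cont_minus.
  move=> u hu.
  replace (minus _ _) with (plus (minus (f u) (F (k + N)%N u)) (opp (minus c (cc (k + N)%N)))) by module_eq.
  apply: Rle_trans; first exact: norm_triangle.
  rewrite norm_opp Rmult_plus_distr_r; apply: Rplus_le_compat; first exact: F2.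
  exact: Hc.
Qed.

End QuasiPeriodic.

(** * Maps with summable weighted Fourier coefficients belong to the class *)

Lemma in_box_abs1_le r n (al : {ffun 'I_r -> Z}) : in_box n al -> abs1 al <= INR r * INR n.
Proof.
move=> /in_boxP H; rewrite -[X in INR X * _](card_ord r) -Rsum_const.
apply: Rsum_le => i _; rewrite INR_IZR_INZ; apply: IZR_le.
by move: (al i) (H i) => z; lia.
Qed.

Lemma notin_box_abs1_ge r n (al : {ffun 'I_r -> Z}) : ~~ in_box n al -> INR n.+1 <= abs1 al.
Proof.
rewrite negb_forall => /existsP [i hi]; rewrite /abs1 (bigD1 i) //=.
apply: (Rle_trans _ (IZR (Z.abs (al i)) + 0)).
  rewrite Rplus_0_r -/(INR n.+1) INR_IZR_INZ; apply: IZR_le.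
  by move: (al i) hi => z; lia.
by apply: Rplus_le_compat_l; apply: Rsum_ge0 => j _; rewrite abs_IZR; exact: Rabs_pos.
Qed.

Lemma finite_Lub_ub (P : R -> Prop) (x : R) :
  is_finite (Lub_Rbar P) -> P x -> x <= real (Lub_Rbar P).
Proof. by move=> /= hf hx; have [H _] := Lub_Rbar_correct P; have := H x hx; rewrite -hf. Qed.

Lemma trig_flat_sum (E : CompleteNormedModule R_AbsRing) r (omega : 'I_r -> R) D
  (I : eqType) (s : seq I) (g : I -> R) (T : I -> R -> E) : 0 <= D ->
  (forall i, i \in s -> trig_flat omega D (g i) (T i)) ->
  trig_flat omega D (\big[Rplus/0]_(i <- s) g i) (fun t => \big[plus/zero]_(i <- s) T i t).
Proof.
move=> hD; elim: s => [|i s IH] H.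
  apply: (trig_flat_weaken (trig_flat_const omega (zero : E) hD)).
    by rewrite big_nil norm_zero; exact: Rle_refl.
  by move=> t _; rewrite big_nil.
apply: (trig_flat_weaken (trig_flat_plus (H i (mem_head _ _)) (IH _))).
- by move=> j hj; apply: H; rewrite inE hj orbT.
- by rewrite big_cons; exact: Rle_refl.
- by move=> t _; rewrite big_cons.
Qed.

Section Membership.

Variables (E : operators) (E_laws : operator_laws E) (r : nat) (omega : 'I_r -> R) (mu : R).
Hypothesis mu_gt0 : 0 < mu.
Variable f : ('I_r -> R) -> E.
Hypothesis f_in_T : in_T mu f.
Notation index := {ffun 'I_r -> Z}.

Let W := real (wiener_norm mu f).
Let fhat (al : 'I_r -> Z) := norm (fourier (fun x => op_incl (f x)) al).
(** Symmetrised because a real mode of index [al] involves the complex coefficients at [al] and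
    [- al]. *)
Let w (al : index) := 1 / 2 * (fhat al + fhat (fun i => - al i)%Z).

Let f_per : periodic f. Proof. by case: f_in_T. Qed.

Let f_buc : buc f.
Proof. by case: f_in_T => [hp [hc _]]; exact: continuous_periodic_buc. Qed.

(** The map [u] stands for the inclusion of indices or for the change of sign: both halves of [w]
    are then covered by one statement. *)
Let wiener_ub (s : seq index) (u : index -> 'I_r -> Z) : injective u -> uniq s ->
  \big[Rplus/0]_(al <- s) (exp (mu * abs1 (u al)) * fhat (u al)) <= W.
Proof.
move=> hu us; apply: finite_Lub_ub; first by case: f_in_T => _ [].
exists (map u s); split; last by rewrite big_map.
elim: s us => [|al s IH] /=; first by constructor.
move=> /andP [hal us]; constructor; last exact: IH.
move=> /List.in_map_iff [be [/hu -> hbe]]; move/negP: hal; apply.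
elim: s {IH us} hbe => [|x s IH] //= [->|h]; rewrite inE ?eqxx //.
by rewrite IH // orbT.
Qed.

Let weighted_sum (s : seq index) : uniq s ->
  \big[Rplus/0]_(al <- s) (exp (mu * abs1 al) * w al) <= W.
Proof.
move=> us.
have h1 := @wiener_ub s (fun al i => al i) _ us.
have h2 := @wiener_ub s (fun al i => (- al i)%Z) _ us.
have -> : \big[Rplus/0]_(al <- s) (exp (mu * abs1 al) * w al) =
  \big[Rplus/0]_(al <- s) (exp (mu * abs1 al) * fhat al) * (1 / 2) +
  \big[Rplus/0]_(al <- s) (exp (mu * abs1 (fun i => - al i)%Z) * fhat (fun i => - al i)%Z) * (1 / 2).
  rewrite -!Rsum_mulr -big_split; apply: eq_bigr => al _ /=.
  by rewrite abs1_opp /w; ring.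
have {}h1 := h1 ltac:(move=> al be H; apply/ffunP => i; exact: (f_equal (fun g => g i) H)).
have {}h2 := h2 ltac:(move=> al be H; apply/ffunP => i; have := f_equal (fun g => g i) H;
   move: (al i) (be i) => x y /= h; lia).
set A := \big[_/_]_(al <- s) _; set B := \big[_/_]_(al <- s) _.
have k1 : A <= W by exact: h1.
have k2 : B <= W by exact: h2.
by lra.
Qed.

Let w_ge0 al : 0 <= w al.
Proof. by rewrite /w /fhat; apply: Rmult_le_pos; [lra|apply: Rplus_le_le_0_compat; exact: norm_ge_0]. Qed.

(** Markov's inequality: on such indices the weight in the Wiener norm is at least [exp (mu * n)].
    This is the origin of the geometric rate. *)
Let tail_sum (n : R) (s : seq index) : uniq s -> (forall al, al \in s -> n <= abs1 al) ->
  \big[Rplus/0]_(al <- s) w al <= exp (- (mu * n)) * W.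
Proof.
move=> us hs.
apply: (Rle_trans _ (exp (- (mu * n)) * \big[Rplus/0]_(al <- s) (exp (mu * abs1 al) * w al))).
  rewrite Rmult_comm -Rsum_mulr big_seq [X in _ <= X]big_seq; apply: Rsum_le => al hal.
  set u := mu * abs1 _.
  apply: (Rle_trans _ (exp (u + - (mu * n)) * w al)); last by right; rewrite exp_plus; ring.
  rewrite -[X in X <= _]Rmult_1_l; apply: Rmult_le_compat_r; first exact: w_ge0.
  rewrite -exp_0.
  have : 0 <= u + - (mu * n).
    by have := Rmult_le_compat_l mu _ _ (Rlt_le _ _ mu_gt0) (hs al hal); rewrite -/u; lra.
  by case=> [h|<-]; [apply: Rlt_le; exact: exp_increasing|exact: Rle_refl].
by apply: Rmult_le_compat_l; [exact: Rlt_le (exp_pos _)|exact: weighted_sum].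
Qed.

Let coef_le (al : index) phi : norm (trig_coef f al phi) <= w al.
Proof. exact: norm_trig_coef_le. Qed.

Let sum_w (s : seq index) : uniq s -> \big[Rplus/0]_(al <- s) w al <= W.
Proof.
move=> us; have := tail_sum (n := 0) us (fun al _ => abs1_ge0 _).
by rewrite Rmult_0_r Ropp_0 exp_0 Rmult_1_l.
Qed.

Lemma in_T_sup_le (th : 'I_r -> R) : norm (f th) <= W.
Proof. exact: (fourier_sup_le f_buc f_per coef_le sum_w). Qed.

Let mode (al : index) (t : R) : E := trig_coef f al (dot al (fun i => omega i * t)).

Let trig_flat_mode_f D (al : index) : abs1 al <= D -> trig_flat omega D (w al * 2) (mode al).
Proof.
move=> hD; apply: (trig_flat_weaken (trig_flat_plus
  (trig_flat_mode omega 0 (trig_coef f al 0) hD)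
  (trig_flat_mode omega (- (PI / 2)) (trig_coef f al (PI / 2)) hD))).
- by have := coef_le al 0; have := coef_le al (PI / 2); lra.
- move=> t _; rewrite /mode dot_scal [RHS]trig_coef_cos_sin //.
  by rewrite Rplus_0_r -(cos_shift (dot al omega * t)) -(cos_neg (PI / 2 - _)) Ropp_minus_distr.
Qed.

Lemma in_T_quasi_periodic : quasi_periodic omega (fun t => f (fun i => omega i * t)).
Proof.
have W0 : 0 <= W by have := sum_w (s := [::]) isT; rewrite big_nil.
split.
  apply: half_cont_continuous => t; apply: continuous_normP => e he.
  have [d [hd Hd]] := f_buc.2 e he.
  set S := \big[Rplus/0]_(i < r) Rabs (omega i).
  have S0 : 0 <= S by apply: Rsum_ge0 => i _; exact: Rabs_pos.
  exists (d / (S + 1)); split; first by apply: Rdiv_lt_0_compat; lra.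
  move=> y hy; apply: Hd => i; rewrite -Rmult_minus_distr_l Rabs_mult.
  have hi : Rabs (omega i) <= S.
    rewrite /S (bigD1 i) //= -[X in X <= _]Rplus_0_r; apply: Rplus_le_compat_l.
    by apply: Rsum_ge0 => j _; exact: Rabs_pos.
  apply: (Rle_lt_trans _ (S * Rabs (y - t))).
    by apply: Rmult_le_compat_r => //; exact: Rabs_pos.
  apply: (Rle_lt_trans _ (S * (d / (S + 1)))); first by apply: Rmult_le_compat_l => //; exact: Rlt_le.
  apply: (Rlt_le_trans _ ((S + 1) * (d / (S + 1)))); last by right; field; lra.
  by apply: Rmult_lt_compat_r; [apply: Rdiv_lt_0_compat|]; lra.
have hr : 0 < exp (- mu) < 1.
  by split; [exact: exp_pos|rewrite -exp_0; apply: exp_increasing; lra].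
have expn k : exp (- (mu * INR k)) = exp (- mu) ^ k.
  elim: k => [|k IH]; first by rewrite Rmult_0_r Ropp_0 exp_0.
  by rewrite S_INR -tech_pow_Rmult -IH -exp_plus; congr exp; ring.
(* The box of radius [k] has degree at most [r k], whence [d = r], and indices outside have size at
   least [k + 1], whence the rate. The factor 2 comes from splitting a mode into two phases; adding
   1 makes the constant positive. *)
exists (2 * W + 1), (exp (- mu)), (INR r), (fun k t => \big[plus/zero]_(al <- box r k) mode al t).
have hk k : 0 <= exp (- mu) ^ k by apply: pow_le; lra.
have htail k : exp (- (mu * INR k.+1)) * W <= W * exp (- mu) ^ k.
  rewrite expn -tech_pow_Rmult Rmult_comm; apply: Rmult_le_compat_l => //.
  by rewrite -[X in _ <= X]Rmult_1_l; apply: Rmult_le_compat_r; [exact: hk|lra].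
have hdeg k al : al \in box r k -> abs1 al <= INR r * INR k.+1.
  rewrite mem_box => /in_box_abs1_le h; apply: Rle_trans; first exact: h.
  by apply: Rmult_le_compat_l; [exact: pos_INR|apply: le_INR; lia].
have hD k : 0 <= INR r * INR k by apply: Rmult_le_pos; exact: pos_INR.
split; first lra; split => //; split; first exact: pos_INR.
split; [|split].
- apply: (trig_flat_weaken (trig_flat_sum (hD 1%N) (fun al hal => trig_flat_mode_f (hdeg 0%N al hal)))) => //.
  rewrite Rsum_mulr; apply: (Rle_trans _ (W * 2)); last by lra.
  by apply: Rmult_le_compat_r; [lra|exact: sum_w (uniq_box r 0)].
- move=> k.
  set s := [seq al <- box r k.+1 | ~~ in_box k al].
  have hs al : al \in s -> abs1 al <= INR r * INR k.+2.
    by rewrite mem_filter => /andP [_]; exact: hdeg.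
  apply: (trig_flat_weaken (trig_flat_sum (hD k.+2) (fun al hal => trig_flat_mode_f (hs al hal)))).
    rewrite Rsum_mulr.
    have H1 : \big[Rplus/0]_(al <- s) w al <= exp (- (mu * INR k.+1)) * W.
      apply: tail_sum; first by rewrite filter_uniq // uniq_box.
      by move=> al; rewrite mem_filter => /andP [h _]; exact: notin_box_abs1_ge.
    apply: (Rle_trans _ (exp (- (mu * INR k.+1)) * W * 2)); last by have := htail k; have := hk k; lra.
    by apply: Rmult_le_compat_r; [lra|exact: H1].
  move=> t _; rewrite [X in minus X _](bigID (in_box k)) /= big_filter.
  have -> : \big[plus/zero]_(al <- box r k.+1 | in_box k al) mode al t =
            \big[plus/zero]_(al <- box r k) mode al t.
    rewrite -big_filter; apply: perm_big; apply: uniq_perm; rewrite ?filter_uniq ?uniq_box //.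
    move=> al; rewrite mem_filter !mem_box.
    case: (boolP (in_box k al)) => //= /in_boxP h; apply/in_boxP => i.
    by move: (al i) (h i) => z; lia.
  set S := \big[plus/zero]_(al <- box r k) _; set S' := \big[plus/zero]_(al <- _ | _) _.
  have e : forall u v : E, v = minus (plus u v) u by move=> u v; module_eq.
  exact: e.
- move=> k t ht; apply: (Rle_trans _ (exp (- (mu * INR k.+1)) * W)).
    apply: (fourier_truncation f_buc f_per coef_le sum_w) => s us hs.
    by apply: tail_sum => // al hal; apply: notin_box_abs1_ge; exact: hs.
  by apply: Rle_trans; [exact: htail|apply: Rmult_le_compat_r => //; lra].
Qed.

End Membership.

(** The second conclusion is the domination of the sup norm by the norm of the decomposition; it
    yields the bound on [An] with the constant [M] itself. *)
Lemma calN_quasi_periodic (E : operators) (E_laws : operator_laws E) r (omega : 'I_r -> R)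
  (mu : R) (a : R -> E) (N : R) : 0 < mu -> calN omega mu a N ->
  quasi_periodic omega a /\ forall t, 0 <= t -> norm (a t) <= N.
Proof.
move=> hmu [fs [ff [hT [[hc hfin] [ha ->]]]]].
have hff t : 0 <= t -> exp t * norm (ff t) <= real (exp_norm ff).
  by move=> ht; apply: finite_Lub_ub => //; exists t.
split.
  apply: (quasi_periodic_ext (f := fun t => plus (fs (fun i => omega i * t)) (ff t))).
    by move=> t ht; rewrite ha.
  apply: quasi_periodic_plus; first exact: in_T_quasi_periodic hmu _ hT.
  apply: (trig_flat_quasi_periodic (D := 0) (s := real (exp_norm ff))).
  apply: trig_flat_decay.
    move=> t; apply: (filterlim_comp _ _ _ (fun s => Rmax 0 s) ff); last first.
      exact: (hc (Rmax 0 t) (Rmax_l _ _)).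
    move=> P hP; have := continuous_Rmax0 hP; rewrite /filtermap; apply: filter_imp => s; apply.
    exact: Rmax_l.
  move=> t ht; have h := hff t ht.
  apply: (Rmult_le_reg_l (exp t)); first exact: exp_pos.
  have -> : exp t * (real (exp_norm ff) * exp (- t)) = real (exp_norm ff).
    by rewrite (Rmult_comm (real _)) -Rmult_assoc -exp_plus Rplus_opp_r exp_0 Rmult_1_l.
  exact: h.
move=> t ht; rewrite ha //; apply: Rle_trans; first exact: norm_triangle.
apply: Rplus_le_compat; first exact: (in_T_sup_le E_laws hmu hT).
apply: Rle_trans (hff t ht).
rewrite -[X in X <= _]Rmult_1_l; apply: Rmult_le_compat_r; first exact: norm_ge_0.
by rewrite -exp_0; case: ht => [ht|<-]; [apply: Rlt_le; exact: exp_increasing|exact: Rle_refl].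
Qed.

(** * Averages and one-sided derivatives *)

Lemma proper_half_locally (t : R) : 0 <= t -> ProperFilter (within (fun s => 0 <= s) (locally t)).
Proof.
move=> ht; split; last exact: within_filter.
move=> P [d Hd]; exists (t + d / 2); have := cond_pos d => hd; apply: Hd; last lra.
rewrite /ball /= /AbsRing_ball /abs /minus /plus /opp /= -/(Rminus _ _).
by replace (t + d / 2 - t) with (d / 2) by ring; rewrite Rabs_pos_eq; lra.
Qed.

Lemma half_locally_lim (t : R) : is_filter_lim (within (fun s => 0 <= s) (locally t)) t.
Proof. by move=> P; exact: filter_le_within. Qed.

Section Derivatives.

Variable E : operators.

(** Compares the two expansions at a point slightly to the right of [t], which stays on the
    half-line even for [t = 0]. It allows the value of [deriv] to be computed. *)
Lemma is_deriv_unique (f : R -> E) (t : R) (l l' : E) : 0 <= t ->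
  is_deriv f t l -> is_deriv f t l' -> l = l'.
Proof.
move=> ht [_ H] [_ H'].
have {}H := H t (@half_locally_lim t); have {}H' := H' t (@half_locally_lim t).
suff n0 : norm (minus l l') = 0.
  by rewrite -[l](plus_zero_r) -(plus_opp_l l') plus_assoc -/(minus l l') (norm_eq_zero _ n0) plus_zero_l.
apply: Rle_antisym; last exact: norm_ge_0.
apply: le_epsilon => e he; rewrite Rplus_0_l.
have he2 : 0 < e / 2 by lra.
have [d Hd] := filter_and (F := locally t) _ _ (H (mkposreal _ he2)) (H' (mkposreal _ he2)).
have hd := cond_pos d; set y := t + d / 2.
have hb : ball t d y.
  rewrite /ball /= /AbsRing_ball /abs /minus /plus /opp /= -/(Rminus _ _) /y.
  by replace (t + d / 2 - t) with (d / 2) by ring; rewrite Rabs_pos_eq; lra.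
have [h1 h2] := Hd y hb.
have {}h1 := h1 ltac:(rewrite /y; lra); have {}h2 := h2 ltac:(rewrite /y; lra).
have ny : norm (minus y t : R_NormedModule) = d / 2.
  rewrite /norm /= /abs /minus /plus /opp /= -/(Rminus _ _) /y.
  by replace (t + d / 2 - t) with (d / 2) by ring; rewrite Rabs_pos_eq; lra.
rewrite ny /= in h1 h2.
have e1 : d / 2 * norm (minus l l') = norm (minus
   (minus (minus (f y) (f t)) (scal (minus y t) l')) (minus (minus (f y) (f t)) (scal (minus y t) l))).
  rewrite -[X in X * _]Rabs_pos_eq; last lra.
  rewrite -norm_scal_R; congr norm.
  have -> : minus y t = d / 2 by rewrite /minus /plus /opp /= /y; ring.
  by module_eq.
apply: (Rmult_le_reg_l (d / 2)); first lra.
rewrite e1; apply: Rle_trans; first exact: norm_triangle.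
rewrite norm_opp; apply: Rle_trans; first exact: Rplus_le_compat h2 h1.
by right; field.
Qed.

Lemma derivE (f : R -> E) (t : R) (l : E) : 0 <= t -> is_deriv f t l -> deriv f t = l.
Proof. by move=> ht Hl; apply: iota_unique => // y Hy; exact: is_deriv_unique Hy Hl. Qed.

Lemma is_deriv_of_is_derive (f g : R -> E) (t : R) (l : E) : 0 <= t ->
  (forall s, 0 <= s -> g s = f s) -> is_derive g t l -> is_deriv f t l.
Proof.
move=> ht Heq Hg.
have P := proper_half_locally ht.
apply: (filterdiff_ext_loc g).
- by exists (mkposreal 1 Rlt_0_1) => y _; exact: Heq.
- move=> x hx; rewrite -(is_filter_lim_unique _ _ (@half_locally_lim t) hx); exact: Heq.
- apply: (filterdiff_locally g t); [exact: (@half_locally_lim t)|exact: Hg].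
Qed.

(** The integral of the extension of [f] by its value at 0 is differentiable on both sides, and
    coincides with the primitive on the half-line. *)
Lemma is_deriv_primitive (f : R -> E) (t k : R) (v w : E) : half_cont f -> 0 <= t ->
  is_deriv (fun s => minus (plus v (scal k (Defs.primitive f s))) w) t (scal k (f t)).
Proof.
move=> hf ht.
apply: (is_deriv_of_is_derive (g := fun s =>
   minus (plus v (scal k (RInt (fun u => f (Rmax 0 u)) 0 s))) w)) => //.
  by move=> s hs; rewrite /Defs.primitive (@RInt_Rmax0 E f s hs).
have := is_derive_RInt_Rmax0 t hf; rewrite Rmax_right // => H.
have -> : scal k (f t) = minus (plus zero (scal k (f t))) zero by module_eq.
apply: is_derive_minus; last exact: is_derive_const.
apply: is_derive_plus; first exact: is_derive_const.
apply: filterdiff_ext_lin; first exact: (filterdiff_scal_r_fct k _ _ Rmult_comm H).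
by move=> y; rewrite /=; module_eq.
Qed.

Lemma is_deriv_const (v : E) (t : R) : 0 <= t -> is_deriv (fun _ => v) t zero.
Proof. by move=> ht; apply: is_deriv_of_is_derive => //; exact: is_derive_const. Qed.

End Derivatives.

Section Averages.

Variables (E : operators) (E_laws : operator_laws E).

(* Implies that the average is reached at rate [1 / t]. *)
Definition strong_average (f : R -> E) (c : E) : Prop :=
  half_cont f /\ exists B, 0 <= B /\
    forall t, 0 <= t -> norm (RInt (fun u => minus (f u) c) 0 t) <= B.

Lemma half_cont_centered (f : R -> E) (c : E) : half_cont f -> half_cont (fun u => minus (f u) c).
Proof. by move=> hf; apply: half_cont_minus; [|exact: half_cont_const]. Qed.

Lemma RInt_centered (f : R -> E) (c : E) (t : R) : half_cont f -> 0 <= t ->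
  RInt f 0 t = plus (RInt (fun u => minus (f u) c) 0 t) (scal t c).
Proof.
move=> hf ht; rewrite RInt_half_minus //; last exact: half_cont_const.
by rewrite RInt_const; module_eq.
Qed.

Lemma strong_average_is_average (f : R -> E) (c : E) : strong_average f c -> is_average f c.
Proof.
move=> [hf [B [hB H]]]; split; first by move=> t ht; apply: half_cont_ex_RInt => //; lra.
apply/filterlim_locally_ball_norm => eps.
have heps := cond_pos eps.
have h0 : 0 <= B / eps by apply: Rmult_le_pos => //; apply: Rlt_le; exact: Rinv_0_lt_compat.
exists (B / eps) => t ht; rewrite /ball_norm.
have tpos : 0 < t by lra.
rewrite (RInt_centered c hf (Rlt_le _ _ tpos)).
set I := RInt _ 0 t.
have -> : minus (scal (/ t) (plus I (scal t c))) c = scal (/ t) I by module_eq; field; lra.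
rewrite norm_scal_R Rabs_pos_eq; last by apply: Rlt_le; exact: Rinv_0_lt_compat.
apply: (Rle_lt_trans _ (/ t * B)).
  by apply: Rmult_le_compat_l; [apply: Rlt_le; exact: Rinv_0_lt_compat|apply: H; lra].
apply: (Rmult_lt_reg_l t) => //; rewrite -Rmult_assoc Rinv_r ?Rmult_1_l; last lra.
replace B with (B / eps * eps) by (field; lra).
by apply: Rmult_lt_compat_r.
Qed.

Lemma is_average_unique (f : R -> E) (c c' : E) : is_average f c -> is_average f c' -> c = c'.
Proof.
move=> [_ H] [_ H'].
exact: (filterlim_locally_unique (F := Rbar_locally p_infty) _ _ _ H H').
Qed.

Lemma averageE (f : R -> E) (c : E) : strong_average f c -> average f = c.
Proof.
move=> /strong_average_is_average H; apply: iota_unique => // y Hy.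
exact: is_average_unique Hy H.
Qed.

Lemma strong_average_ext (f g : R -> E) (c : E) : (forall t, 0 <= t -> f t = g t) ->
  strong_average f c -> strong_average g c.
Proof.
move=> H [hf [B [hB HB]]]; split; first exact: half_cont_ext H hf.
exists B; split => // t ht; apply: Rle_trans (HB t ht); right; congr norm.
by apply: RInt_half_ext => // u hu; rewrite H.
Qed.

Lemma strong_average_const (v : E) : strong_average (fun _ => v) v.
Proof.
split; first exact: half_cont_const.
exists 0; split => [|t ht]; first exact: Rle_refl.
rewrite RInt_const minus_eq_zero.
by rewrite norm_scal_R norm_zero Rmult_0_r; exact: Rle_refl.
Qed.

Lemma strong_average_plus (f g : R -> E) (c d : E) :
  strong_average f c -> strong_average g d -> strong_average (fun t => plus (f t) (g t)) (plus c d).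
Proof.
move=> [hf [B [hB HB]]] [hg [C [hC HC]]]; split; first exact: half_cont_plus.
exists (B + C); split; first lra.
move=> t ht; have -> : RInt (fun u => minus (plus (f u) (g u)) (plus c d)) 0 t =
   plus (RInt (fun u => minus (f u) c) 0 t) (RInt (fun u => minus (g u) d) 0 t).
  rewrite -RInt_half_plus //; [|exact: half_cont_centered|exact: half_cont_centered].
  by apply: RInt_ext => u _; module_eq.
by apply: Rle_trans; [exact: norm_triangle|apply: Rplus_le_compat; [exact: HB|exact: HC]].
Qed.

Lemma strong_average_linear (L : E -> E) (f : R -> E) (c : E) : is_linear L ->
  half_cont (fun t => L (f t)) -> strong_average f c -> strong_average (fun t => L (f t)) (L c).
Proof.
move=> HL hLf [hf [B [hB HB]]]; split => //.
have [M [hM HM]] := linear_norm _ HL.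
exists (M * B); split; first by apply: Rmult_le_pos; lra.
move=> t ht; have -> : RInt (fun u => minus (L (f u)) (L c)) 0 t = L (RInt (fun u => minus (f u) c) 0 t).
  apply: is_RInt_unique; apply: (is_RInt_ext (fun u => L (minus (f u) c))).
    by move=> u _; rewrite /minus (linear_plus _ HL) (linear_opp _ _ HL).
  apply: is_RInt_linear => //; apply: RInt_correct.
  by apply: half_cont_ex_RInt => //; [exact: half_cont_centered|lra].
by apply: Rle_trans; [exact: HM|apply: Rmult_le_compat_l; [lra|exact: HB]].
Qed.

Lemma strong_average_scal (k : R) (f : R -> E) (c : E) :
  strong_average f c -> strong_average (fun t => scal k (f t)) (scal k c).
Proof.
move=> Hf; apply: (strong_average_linear (L := fun v => scal k v)) => //.
- exact: (is_linear_scal_r k Rmult_comm).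
- by apply: half_cont_scal; case: Hf.
Qed.

Lemma strong_average_minus (f g : R -> E) (c d : E) :
  strong_average f c -> strong_average g d -> strong_average (fun t => minus (f t) (g t)) (minus c d).
Proof.
move=> Hf Hg; have := strong_average_plus Hf (strong_average_scal (-1) Hg).
replace (plus c (scal (-1) d)) with (minus c d) by module_eq.
by apply: strong_average_ext => t _; module_eq.
Qed.

Lemma strong_average_comp_r (f : R -> E) (c v : E) :
  strong_average f c -> strong_average (fun t => op_comp (f t) v) (op_comp c v).
Proof.
move=> Hf; apply: (strong_average_linear (L := fun u => op_comp u v)) => //.
- split; [move=> x y; exact: op_comp_plus_l|move=> k x; exact: op_comp_scal_l|].
  exists (norm v + 1); split; first by have := norm_ge_0 v; lra.
  move=> x; apply: Rle_trans; first exact: norm_op_comp.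
  by have := norm_ge_0 x; lra.
- by apply: half_cont_comp => //; [case: Hf|exact: half_cont_const].
Qed.

(** From [t c] being the integral of [f] minus a bounded term, [t * norm c <= t * M + B]; then [t]
    is taken large. *)
Lemma norm_strong_average_le (f : R -> E) (c : E) (M : R) : strong_average f c ->
  (forall t, 0 <= t -> norm (f t) <= M) -> norm c <= M.
Proof.
move=> [hf [B [hB H]]] HM; apply: le_epsilon => e he.
(* So that [t * e = B + e], which exceeds [B]; the summand 1 makes [t] positive. *)
set t := B / e + 1.
have ht : 0 < t.
  by have : 0 <= B / e by [apply: Rmult_le_pos => //; apply: Rlt_le; exact: Rinv_0_lt_compat]; rewrite /t; lra.
apply: (Rmult_le_reg_l t) => //.
have -> : t * norm c = norm (scal t c) by rewrite norm_scal_R Rabs_pos_eq; lra.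
have -> : scal t c = minus (RInt f 0 t) (RInt (fun u => minus (f u) c) 0 t).
  by rewrite (RInt_centered c hf (Rlt_le _ _ ht)); module_eq.
apply: Rle_trans; first exact: norm_triangle.
rewrite norm_opp Rmult_plus_distr_l; apply: Rplus_le_compat.
  by apply: norm_RInt_half_le => //; lra.
apply: Rle_trans; first by apply: H; lra.
have -> : t * e = B + e by rewrite /t; field; lra.
lra.
Qed.

Variables (r : nat) (omega : 'I_r -> R) (omega_dioph : diophantine omega).

Lemma quasi_periodic_strong_average (f : R -> E) : quasi_periodic omega f ->
  exists c, strong_average f c /\ quasi_periodic omega (fun t => RInt (fun u => minus (f u) c) 0 t).
Proof.
move=> Hf; have [c Hc] := quasi_periodic_primitive omega_dioph Hf.
exists c; split => //; split; first by case: Hf.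
have [B [hB HB]] := quasi_periodic_bound Hc.
by exists B; split; [lra|].
Qed.

End Averages.

(** * Polynomials in epsilon with quasi-periodic coefficients *)

Section Families.

Variables (E : operators) (E_laws : operator_laws E).
Variables (r : nat) (omega : 'I_r -> R) (omega_dioph : diophantine omega).
Notation qp := (quasi_periodic omega).

(* [F eps] is a polynomial in [eps], divisible by [eps ^ k], whose
   coefficients are quasi-periodic maps independent of [eps]. *)
Inductive family : nat -> (R -> R -> E) -> Prop :=
  | family_term k f : qp f -> family k (fun e t => scal (e ^ k) (f t))
  | family_plus k F G : family k F -> family k G -> family k (fun e t => plus (F e t) (G e t))
  | family_weaken k l F G : family l F -> (k <= l)%N ->
      (forall e t, 0 <= t -> F e t = G e t) -> family k G.

Lemma family_ext k F G : (forall e t, 0 <= t -> F e t = G e t) -> family k F -> family k G.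
Proof. by move=> H HF; exact: family_weaken HF (leqnn k) H. Qed.

Lemma family_le k l F : (k <= l)%N -> family l F -> family k F.
Proof. by move=> h HF; exact: family_weaken HF h (fun _ _ _ => erefl). Qed.

Lemma family_qp f : qp f -> family 0 (fun _ t => f t).
Proof.
by move=> hf; apply: (family_ext _ (family_term 0 hf)) => e t _; exact: (scal_one (f t)).
Qed.

Lemma family_quasi_periodic k F : family k F -> forall e, qp (F e).
Proof.
elim=> {k F} [k f hf|k F G _ IH1 _ IH2|k l F G _ IH _ H] e.
(* Multiplication by a scalar is composition with a multiple of the identity, hence a case of the
   product. *)
- have := quasi_periodic_comp E_laws (quasi_periodic_const omega (scal (e ^ k) (op_id E))) hf.
  apply: quasi_periodic_ext => t _.
  by rewrite (op_comp_scal_l E_laws) (op_comp_id_l E_laws).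
- exact: quasi_periodic_plus.
- by apply: quasi_periodic_ext (IH e) => t ht; exact: H.
Qed.

Lemma family_half_cont k F : family k F -> forall e, half_cont (F e).
Proof. by move=> HF e; case: (family_quasi_periodic HF e). Qed.

(** The constant is uniform in [e] because the coefficients are independent of it; [e <= 1] allows
    higher powers to be bounded by [e ^ k]. *)
Lemma family_bound k F : family k F -> exists B, 0 < B /\
  forall e t, 0 < e <= 1 -> 0 <= t -> norm (F e t) <= B * e ^ k.
Proof.
elim=> {k F} [k f hf|k F G _ [B [hB IH1]] _ [C [hC IH2]]|k l F G _ [B [hB IH]] hkl H].
- have [B [hB HB]] := quasi_periodic_bound hf; exists B; split => // e t he ht.
  have he' : 0 <= e ^ k by apply: pow_le; lra.
  by rewrite norm_scal_R Rabs_pos_eq // Rmult_comm; apply: Rmult_le_compat_r => //; exact: HB.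
- exists (B + C); split; first lra.
  move=> e t he ht; apply: Rle_trans; first exact: norm_triangle.
  by rewrite Rmult_plus_distr_r; apply: Rplus_le_compat; [exact: IH1|exact: IH2].
- exists B; split => // e t he ht; rewrite -H //; apply: Rle_trans; first exact: IH.
  apply: Rmult_le_compat_l; first lra.
  rewrite -(subnKC hkl) -plusE pow_add -[X in _ <= X]Rmult_1_r.
  apply: Rmult_le_compat_l; first by apply: pow_le; lra.
  by rewrite -[X in _ <= X](pow1 (l - k)); apply: pow_incr; lra.
Qed.

Lemma family_scal k c F : family k F -> family k (fun e t => scal c (F e t)).
Proof.
elim=> {k F} [k f hf|k F G _ IH1 _ IH2|k l F G _ IH hkl H].
- have h : qp (fun t => scal c (f t)).
    have := quasi_periodic_comp E_laws (quasi_periodic_const omega (scal c (op_id E))) hf.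
    apply: quasi_periodic_ext => t _.
    by rewrite (op_comp_scal_l E_laws) (op_comp_id_l E_laws).
  by apply: (family_ext _ (family_term k h)) => e t _; module_eq.
- by apply: (family_ext _ (family_plus IH1 IH2)) => e t _; module_eq.
- by apply: (family_weaken IH hkl) => e t ht; rewrite H.
Qed.

Lemma family_minus k F G : family k F -> family k G -> family k (fun e t => minus (F e t) (G e t)).
Proof.
by move=> HF /(family_scal (-1)) HG; apply: (family_ext _ (family_plus HF HG)) => e t _; module_eq.
Qed.

Lemma family_shift k F : family k F -> family k.+1 (fun e t => scal e (F e t)).
Proof.
elim=> {k F} [k f hf|k F G _ IH1 _ IH2|k l F G _ IH hkl H].
- by apply: (family_ext _ (family_term k.+1 hf)) => e t _; module_eq.
- by apply: (family_ext _ (family_plus IH1 IH2)) => e t _; module_eq.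
- by apply: (family_weaken IH) => // e t ht; rewrite H.
Qed.

Lemma family_comp k l F G : family k F -> family l G ->
  family (k + l) (fun e t => op_comp (F e t) (G e t)).
Proof.
move=> HF HG; elim: HF => {k F} [k f hf|k F1 F2 _ IH1 _ IH2|k k' F1 F2 _ IH hk H].
- elim: HG => {l G} [l g hg|l G1 G2 _ IH1 _ IH2|l l' G1 G2 _ IH hl H].
  + apply: (family_ext _ (family_term (k + l) (quasi_periodic_comp E_laws hf hg))) => e t _.
    by rewrite (op_comp_scal_l E_laws) (op_comp_scal_r E_laws) -plusE pow_add; module_eq.
  + by apply: (family_ext _ (family_plus IH1 IH2)) => e t _; rewrite (op_comp_plus_r E_laws).
  + by apply: (family_weaken IH); [rewrite leq_add2l|move=> e t ht; rewrite H].
- by apply: (family_ext _ (family_plus IH1 IH2)) => e t _; rewrite (op_comp_plus_l E_laws).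
- by apply: (family_weaken IH); [rewrite leq_add2r|move=> e t ht; rewrite H].
Qed.

(** Averages and centered primitives are taken coefficient by coefficient, so they are again
    polynomials in [e] divisible by [e ^ k]. *)
Lemma family_average k F : family k F -> exists c : R -> E,
  (forall e, strong_average (F e) (c e)) /\ family k (fun e _ => c e) /\
  family k (fun e t => RInt (fun u => minus (F e u) (c e)) 0 t).
Proof.
elim=> {k F} [k f hf|k F G HF [c [H1 [H2 H3]]] HG [d [K1 [K2 K3]]]|k l F G HF [c [H1 [H2 H3]]] hkl H].
- have [c [hc Hc]] := quasi_periodic_strong_average omega_dioph hf.
  exists (fun e => scal (e ^ k) c); split; [|split].
  + by move=> e; exact: strong_average_scal.
  + exact: (family_term k (quasi_periodic_const omega c)).
  + apply: (family_ext _ (family_term k Hc)) => e t ht.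
    rewrite -RInt_half_scal //; last by apply: half_cont_centered; case: hf.
    by apply: RInt_ext => u _; module_eq.
- exists (fun e => plus (c e) (d e)); split; [|split].
  + by move=> e; exact: strong_average_plus.
  + exact: family_plus.
  + apply: (family_ext _ (family_plus H3 K3)) => e t ht.
    rewrite -RInt_half_plus //; last 2 first.
    * by apply: half_cont_centered; exact: family_half_cont HF e.
    * by apply: half_cont_centered; exact: family_half_cont HG e.
    by apply: RInt_ext => u _; module_eq.
- exists c; split; [|split].
  + by move=> e; apply: strong_average_ext (H1 e) => t ht; exact: H.
  + exact: family_le hkl H2.
  + apply: (family_weaken H3 hkl) => e t ht.
    by apply: RInt_half_ext => // u hu; rewrite H.
Qed.

(** Uniqueness of averages transfers the polynomial form to an average already known, in particular
    to a zero one. *)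
Lemma family_average_eq k F (c : R -> E) : family k F ->
  (forall e, strong_average (F e) (c e)) ->
  family k (fun e _ => c e) /\ family k (fun e t => RInt (fun u => minus (F e u) (c e)) 0 t).
Proof.
move=> HF Hc; have [d [H1 [H2 H3]]] := family_average HF.
have -> // : c = d.
apply: functional_extensionality => e.
exact: is_average_unique (strong_average_is_average (Hc e)) (strong_average_is_average (H1 e)).
Qed.

(** * The successive approximations as families *)

Variables (a : R -> E) (a_qp : qp a).

Let Lam n e := Lambda a (Phi a e n).

(** The value [zero] at [n = 0] is the convention on [Lambda] of the approximation preceding the
    first; it starts the induction on differences at order 0. *)
Let Lam_prev n e : R -> E := if n is m.+1 then Lam m e else fun _ => zero.

Let I n e := Defs.primitive (Lam n e).

Let PhiS n e t : Phi a e n.+1 t =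
  minus (plus (op_id E) (scal e (I n e t))) (scal e (average (I n e))).
Proof. by []. Qed.

Let family_An n : family 0 (fun e => Phi a e n) ->
  family 0 (fun e _ => An a e n) /\
  forall e, strong_average (comp_map a (Phi a e n)) (An a e n).
Proof.
move=> HF.
have [c [H1 [H2 _]]] := family_average (family_comp (family_qp a_qp) HF).
have Ec e : An a e n = c e by apply: averageE; exact: H1.
split; first by apply: (family_ext _ H2) => e t _; rewrite Ec.
by move=> e; rewrite Ec; exact: H1.
Qed.

(** [Lambda] has zero mean because [Phi] has mean identity: the average of [a Phi] is [An], and that
    of [Phi An] is the identity composed with [An]. *)
Let Lam_props n : family 0 (fun e => Phi a e n) ->
  (forall e, strong_average (Phi a e n) (op_id E)) ->
  family 0 (Lam n) /\ (forall e, strong_average (Lam n e) zero).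
Proof.
move=> HF HA; have [K1 K2] := family_An HF; split.
  exact: family_minus (family_comp (family_qp a_qp) HF) (family_comp HF K1).
move=> e; have := strong_average_minus (K2 e) (strong_average_comp_r E_laws (An a e n) (HA e)).
by rewrite (op_comp_id_l E_laws) minus_eq_zero.
Qed.

Let I_props n : family 0 (Lam n) -> (forall e, strong_average (Lam n e) zero) ->
  family 0 (I n) /\ family 0 (fun e _ => average (I n e)) /\
  forall e, strong_average (I n e) (average (I n e)).
Proof.
move=> HL HA; have [_ HP] := family_average_eq HL HA.
have HI : family 0 (I n).
  by apply: (family_ext _ HP) => e t _; apply: RInt_ext => u _; module_eq.
have [c [H1 [H2 _]]] := family_average HI.
have Ec e : average (I n e) = c e by apply: averageE; exact: H1.
split => //; split; first by apply: (family_ext _ H2) => e t _; rewrite Ec.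
by move=> e; rewrite Ec; exact: H1.
Qed.

(** The mean of [Phi] is carried along the induction since it makes [Lambda] of zero mean, hence the
    next primitive bounded with an average of its own. *)
Lemma family_Phi n : family 0 (fun e => Phi a e n) /\
  forall e, strong_average (Phi a e n) (op_id E).
Proof.
elim: n => [|n [HF HA]].
  split; first by apply: family_qp; exact: quasi_periodic_const.
  by move=> e; exact: strong_average_const.
have [HL HL0] := Lam_props HF HA.
have [HI [HI0 HI1]] := I_props HL HL0.
have Hid : family 0 (fun _ _ => op_id E) by apply: family_qp; exact: quasi_periodic_const.
split.
  exact: family_minus (family_plus Hid (family_le (leq0n 1) (family_shift HI)))
    (family_le (leq0n 1) (family_shift HI0)).
move=> e; have := strong_average_minus
  (strong_average_plus (strong_average_const (op_id E)) (strong_average_scal e (HI1 e)))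
  (strong_average_const (scal e (average (I n e)))).
have E0 : minus (plus (op_id E) (scal e (average (I n e)))) (scal e (average (I n e))) = op_id E.
  by module_eq.
by rewrite E0.
Qed.

Lemma An_strong_average n e : strong_average (comp_map a (Phi a e n)) (An a e n).
Proof. by have [HF _] := family_Phi n; have [_] := family_An HF; apply. Qed.

Lemma Lambda_family n :
  family 0 (Lam n) /\ forall e, strong_average (Lam n e) zero.
Proof. by have [HF HA] := family_Phi n; exact: Lam_props. Qed.

Lemma primitive_Lambda_average n e :
  strong_average (Defs.primitive (Lambda a (Phi a e n)))
    (average (Defs.primitive (Lambda a (Phi a e n)))).
Proof. by have [HL HA] := Lambda_family n; have [_ [_]] := I_props HL HA; apply. Qed.

Lemma Phi_minus_id_family n : family 1 (fun e t => minus (Phi a e n t) (op_id E)).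
Proof.
case: n => [|n].
  have : family 1 (fun e _ => scal e (zero : E)).
    by apply: family_shift; apply: family_qp; exact: quasi_periodic_const.
  by apply: family_ext => e t _ /=; module_eq.
have [HL HA] := Lambda_family n; have [HI [HI0 _]] := I_props HL HA.
by apply: (family_ext _ (family_shift (family_minus HI HI0))) => e t _; rewrite PhiS; module_eq.
Qed.

Let dLam n e t := minus (Lam n e t) (Lam_prev n e t).

Let I_prev n e := Defs.primitive (Lam_prev n e).

Let I_prev_average n e : E := if n is m.+1 then average (I m e) else zero.

(** Writes [Phi] of order [n] in the form of the recursion also when [n = 0], where both corrections
    vanish; consecutive differences then have a single formula. *)
Let Phi_prev n e t : 0 <= t ->
  Phi a e n t = minus (plus (op_id E) (scal e (I_prev n e t))) (scal e (I_prev_average n e)).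
Proof.
case: n => [|n] ht //=.
rewrite /I_prev /= /Defs.primitive RInt_const; module_eq.
Qed.

Let Lam_prev_cont n e : half_cont (Lam_prev n e) /\ strong_average (Lam_prev n e) zero.
Proof.
case: n => [|n] /=; first by split; [exact: half_cont_const|exact: strong_average_const].
by have [HL HA] := Lambda_family n; split; [exact: family_half_cont HL e|exact: HA].
Qed.

Let I_prev_strong n e : strong_average (I_prev n e) (I_prev_average n e).
Proof.
case: n => [|n] /=; last exact: primitive_Lambda_average.
apply: strong_average_ext (strong_average_const zero) => t ht.
by rewrite /I_prev /= /Defs.primitive RInt_const; module_eq.
Qed.

Let dLam_average n e : strong_average (dLam n e) zero.
Proof.
have [_ HA] := Lambda_family n; have [_ HP] := Lam_prev_cont n e.
by have := strong_average_minus (HA e) HP; rewrite minus_eq_zero.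
Qed.

(** The difference of two consecutive approximations is [e] times the zero-mean primitive of
    [dLam n]. The prefactor gains one power of [e]. *)
Let dPhi_family n : family n (dLam n) ->
  family n.+1 (fun e t => minus (Phi a e n.+1 t) (Phi a e n t)).
Proof.
move=> HD; have [_ HP] := family_average_eq HD (dLam_average n).
pose P e t := minus (I n e t) (I_prev n e t).
have [HL _] := Lambda_family n.
have {}HP : family n P.
  apply: (family_ext _ HP) => e t ht; rewrite /P /I /I_prev /Defs.primitive -RInt_half_minus //.
  - by apply: RInt_ext => u _; rewrite /dLam; module_eq.
  - exact: family_half_cont HL e.
  - by case: (Lam_prev_cont n e).
have [HP0 _] := family_average_eq HP (fun e => strong_average_minus
   (primitive_Lambda_average n e) (I_prev_strong n e)).
apply: (family_ext _ (family_shift (family_minus HP HP0))) => e t ht.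
by rewrite PhiS (Phi_prev n e ht) /P -/(Lam n e) -/(I n e); module_eq.
Qed.

(** With [D] the difference of consecutive [Phi], the next difference of [Lambda] is
    [a D - D A' - Phi (A' - A)], where [A] and [A'] are the successive [An] and [A' - A] is the
    average of [a D]. Every term contains [D] or an average linear in it, so the order of [D] in [e]
    is kept. *)
Let dLam_family n : family n (dLam n).
Proof.
elim: n => [|n IH].
  have [HL _] := Lambda_family 0.
  by apply: (family_ext _ HL) => e t _; rewrite /dLam /=; module_eq.
have HD := dPhi_family IH.
have [HF _] := family_Phi n; have [HF1 _] := family_Phi n.+1.
have [HA1 _] := family_An HF1.
have HaD := family_comp (family_qp a_qp) HD.
have [HdA _] := family_average_eq (c := fun e => minus (An a e n.+1) (An a e n))
  HaD ltac:(move=> e; apply: strong_average_ext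
    (strong_average_minus (An_strong_average n.+1 e) (An_strong_average n e)) => t _;
    by rewrite /comp_map (op_comp_minus_r E_laws)).
have HDA := family_comp HD HA1; rewrite addn0 in HDA.
have HFA := family_comp HF HdA.
apply: (family_ext _ (family_minus HaD (family_plus HDA HFA))) => e t _.
rewrite /dLam /Lam_prev /Lam /Lambda -/(An a e n) -/(An a e n.+1).
by rewrite !(op_comp_minus_r E_laws) !(op_comp_minus_l E_laws); module_eq.
Qed.

Lemma Phi_is_deriv n e t : 0 <= t ->
  is_deriv (Phi a e n.+1) t (scal e (Lambda a (Phi a e n) t)).
Proof.
move=> ht; have [HL _] := Lambda_family n.
change (is_deriv (fun s => minus (plus (op_id E) (scal e (Defs.primitive (Lam n e) s)))
  (scal e (average (I n e)))) t (scal e (Lam n e t))).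
by apply: is_deriv_primitive ht; exact: family_half_cont HL e.
Qed.

(** The derivative of [Phi] is [e] times the previous [Lambda], also for [n = 0] where it vanishes;
    dividing by [e] leaves a difference of two values of [Lambda]. *)
Lemma defect_eq n e t : e <> 0 -> 0 <= t -> defect a e n t = opp (dLam n e t).
Proof.
move=> he ht; rewrite /defect -/(Lambda a (Phi a e n) t).
have -> : deriv (Phi a e n) t = scal e (Lam_prev n e t).
  case: n => [|n] /=; last by apply: derivE => //; exact: Phi_is_deriv.
  by rewrite (derivE ht (is_deriv_const (op_id E) ht)); module_eq.
by rewrite /dLam /Lam; module_eq; field.
Qed.

(** The defect has zero mean and order [n] in [e], so its primitive is bounded in [tau] with the
    same order; the factor [e] in front supplies the last power. *)
Lemma defect_integral n : exists B, 0 < B /\ forall e tau, 0 < e <= 1 -> 0 <= tau ->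
  ex_RInt (defect a e n) 0 tau /\
  norm (scal e (RInt (defect a e n) 0 tau)) <= B * e ^ n.+1.
Proof.
have HD := dLam_family n.
have [_ HP] := family_average_eq HD (dLam_average n).
have [B [hB HB]] := family_bound HP.
exists B; split => // e tau he htau.
have hext u : 0 <= u -> opp (dLam n e u) = defect a e n u.
  by move=> hu; rewrite defect_eq //; lra.
have hc : half_cont (defect a e n).
  apply: half_cont_ext hext _.
  apply: (half_cont_ext (f := fun u => scal (-1) (dLam n e u))).
    by move=> u _; module_eq.
  by apply: half_cont_scal; exact: family_half_cont HD e.
split; first by apply: half_cont_ex_RInt => //; lra.
rewrite -(RInt_half_ext htau hext).
have -> : RInt (fun u => opp (dLam n e u)) 0 tau =
  scal (-1) (RInt (fun u => minus (dLam n e u) zero) 0 tau).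
  rewrite -RInt_half_scal //; last by apply: half_cont_centered; exact: family_half_cont HD e.
  by apply: RInt_ext => u _; module_eq.
rewrite !norm_scal_R Rabs_Ropp Rabs_R1 Rmult_1_l Rabs_pos_eq; last lra.
rewrite -tech_pow_Rmult.
have := Rmult_le_compat_l e _ _ ltac:(lra) (HB e tau he htau).
by move=> h; apply: Rle_trans; [exact: h|right; ring].
Qed.

Lemma construction_well_defined n e : well_defined a e n.
Proof.
split => k _.
  split; apply: strong_average_is_average; last exact: An_strong_average.
  by have [_] := family_Phi k; apply.
have [HL _] := Lambda_family k.
split; first by move=> t ht; apply: half_cont_ex_RInt => //; [exact: family_half_cont HL e|lra].
split; first by apply: strong_average_is_average; exact: primitive_Lambda_average.
by move=> t; exact: Phi_is_deriv.
Qed.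

End Families.

(** * Choice of the threshold *)

Theorem theorem2p14
  (X : banach) (r : nat) (hr : (1 <= r)%N) (omega : 'I_r -> R)
  (homega : diophantine omega)
  (a : R -> End X) (mu M : R) (hmu : 0 < mu) (hM : 0 < M)
  (ha : exists N : R, calN omega mu a N /\ N <= M)
  (c : R) (hc : 0 < c < 1) :
  forall n : nat, exists eps_n : R, 0 < eps_n /\
    forall eps : R, 0 < eps <= eps_n ->
      well_defined a eps n /\
      Rbar_le (sup_norm (fun t => minus (Phi a eps n t) (op_id (End X))))
        (c * eps / eps_n) /\
      c * eps / eps_n <= c /\
      norm (An a eps n) <= (1 + c) * M /\
      forall tau : R, 0 <= tau ->
        ex_RInt (defect a eps n) 0 tau /\
        norm (scal eps (RInt (defect a eps n) 0 tau)) <= (eps / eps_n) ^ S n.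
Proof.
move=> n; case: ha => N [hN hNM]; have E_laws := End_laws X.
have [a_qp a_le] := calN_quasi_periodic E_laws hmu hN.
have [C [hC HC]] := family_bound (Phi_minus_id_family E_laws homega a_qp n).
have [B [hB HB]] := defect_integral E_laws homega a_qp n.
(* The bound 1 gives access to the estimates on families and makes powers of [/ en] at least 1;
   [c / C] turns [C * eps] into [c * eps / en]; the last term makes [/ en] dominate [B]. *)
set en := Rmin 1 (Rmin (c / C) (/ (B + 1))).
have hBi : 0 < / (B + 1) by apply: Rinv_0_lt_compat; lra.
have hcC : 0 < c / C by apply: Rdiv_lt_0_compat; lra.
have en0 : 0 < en by apply: Rmin_pos; [lra|exact: Rmin_pos].
have en1 : en <= 1 by exact: Rmin_l.
have enC : en <= c / C by apply: Rle_trans; [exact: Rmin_r|exact: Rmin_l].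
have enB : en <= / (B + 1) by apply: Rle_trans; [exact: Rmin_r|exact: Rmin_r].
exists en; split => // eps heps.
have heps1 : 0 < eps <= 1 by lra.
have hle : c * eps / en <= c.
  apply: (Rmult_le_reg_r en) => //.
  replace (c * eps / en * en) with (c * eps) by (field; lra).
  by apply: Rmult_le_compat_l; lra.
have hPhi t : 0 <= t -> norm (minus (Phi a eps n t) (op_id (End X))) <= c * eps / en.
  move=> ht; apply: Rle_trans; first exact: HC.
  rewrite pow_1; replace (c * eps / en) with (c / en * eps) by (field; lra).
  apply: Rmult_le_compat_r; first lra.
  apply: (Rmult_le_reg_r en) => //; replace (c / en * en) with c by (field; lra).
  apply: Rle_trans; first exact: Rmult_le_compat_l (Rlt_le _ _ hC) enC.
  by right; field; lra.
split; first exact: (construction_well_defined E_laws homega a_qp).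
split.
  have [_ H] := Lub_Rbar_correct (fun v => exists t, 0 <= t /\
    v = norm (minus (Phi a eps n t) (op_id (End X)))).
  by apply: H => _ [t [ht ->]]; exact: hPhi.
split => //; split.
  (* An average inherits a pointwise bound: [a] has norm at most [M], and [Phi] differs from the
     identity by at most [c]. *)
  apply: (norm_strong_average_le (An_strong_average E_laws homega a_qp n eps)) => t ht.
  rewrite /comp_map Rmult_comm; apply: Rle_trans; first exact: norm_op_comp.
  apply: Rmult_le_compat; [exact: norm_ge_0|exact: norm_ge_0| |].
    by apply: Rle_trans; [exact: a_le|lra].
  have h1 := hPhi t ht; have h2 := norm_op_id E_laws.
  replace (Phi a eps n t) with
    (plus (op_id (End X)) (minus (Phi a eps n t) (op_id (End X)))) by module_eq.
  apply: Rle_trans; first exact: norm_triangle.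
  by apply: Rplus_le_compat; lra.
move=> tau htau; have [h1 h2] := HB eps tau heps1 htau; split => //.
apply: Rle_trans; first exact: h2.
rewrite /Rdiv Rpow_mult_distr Rmult_comm; apply: Rmult_le_compat_l; first by apply: pow_le; lra.
(* One factor [/ en] absorbs [B]; the remaining [n] factors are at least 1. *)
have hi : B + 1 <= / en.
  by rewrite -[B + 1]Rinv_inv; apply: Rinv_le_contravar.
have : 1 <= (/ en) ^ n by apply: pow_R1_Rle; lra.
rewrite -tech_pow_Rmult => h; have := Rmult_le_compat_l (/ en) _ _ ltac:(lra) h; lra.
Qed.
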